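(* Let $p$ be an odd prime. As $q,d_1,\dots,d_{p-1}\to\infty$ (with $q\equiv1\pmod p$ and $d_1+2d_2+\cdots+(p-1)d_{p-1}\equiv0\pmod p$), $$\frac1{\sqrt{q+1}}\,\mathrm{Tr}(\mathrm{Frob}_C|_{H^1_{\chi_p}})$$ has (in the limit) a complex Gaussian distribution with mean $0$ and variance $1$ as $C$ varies in $\mathcal H^{(d_1,\dots,d_{p-1})}(\mathbb F_q)$.
   Context: $\mathbb F_q$ is the finite field with $q\equiv1\pmod p$ elements, $p$ an odd prime; $\chi_p$ is a fixed character of $\mathbb F_q^*$ of order $p$, extended by $\chi_p(0)=0$. For integers $e_1,\dots,e_{p-1}\ge0$ let $\widehat{\mathcal F}_{(e_1,\dots,e_{p-1})}$ be the set of $F=\alpha F_1F_2^2\cdots F_{p-1}^{p-1}\in\mathbb F_q[X]$ with $\alpha\in\mathbb F_q^*$ and $F_1,\dots,F_{p-1}$ monic, square-free, pairwise coprime, $\deg F_i=e_i$. Let $\widehat{\mathcal F}_{[d_1,\dots,d_{p-1}]}$ be the union of $\widehat{\mathcal F}_{(d_1,\dots,d_{p-1})}$ and the sets obtained by lowering exactly one $d_i$ by $1$. For $d_1+2d_2+\cdots+(p-1)d_{p-1}\equiv0\pmod p$, $\mathcal H^{(d_1,\dots,d_{p-1})}$ is the irreducible component of the moduli space of cyclic $p$-fold covers of $\mathbb P^1$ over $\mathbb F_q$, of genus $g=(p-1)(d_1+\cdots+d_{p-1}-2)/2$, consisting of $\mathbb F_q$-isomorphism classes of smooth projective curves $C$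 with an affine model $Y^p=F(X)$, $F\in\widehat{\mathcal F}_{[d_1,\dots,d_{p-1}]}$. Each such curve is endowed with its order $p$ automorphism (given on the model by $(X,Y)\mapsto(X,\zeta Y)$ for a fixed primitive $p$-th root of unity $\zeta\in\mathbb F_q$), and isomorphisms and automorphisms are understood to be compatible with it. The distribution over the component is taken with each $C$ weighted proportionally to $1/|\mathrm{Aut}(C)|$ (automorphisms over $\mathbb F_q$). The automorphism splits the first cohomology $H^1$ of $C$ into Frobenius-stable subspaces $H^1_{\chi_p},\dots,H^1_{\chi_p^{p-1}}$, on which it acts via $\chi_p,\dots,\chi_p^{p-1}$. Concretely, if $C$ has model $Y^p=F(X)$ with $F\in\widehat{\mathcal F}_{[d_1,\dots,d_{p-1}]}$, then $\mathrm{Tr}(\mathrm{Frob}_C|_{H^1_{\chi_p}})=-\sum_{x\in\mathbb P^1(\mathbb F_q)}\chi_p(F(x))$, where $F(\infty)$ is the value at zero of $X^{\deg F}F(1/X)$ (the leading coefficient of $F$) if $\deg F\equiv0\pmod p$, and $F(\infty)=0$ otherwise. The complex Gaussian with mean $0$ and variance $1$ is the probability measure on $\mathbb C$ with density $\frac1\pi e^{-|z|^2}$ with respect to Lebesgue measure. *)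

(* Defs.v *)
From mathcomp Require Import all_boot all_order all_algebra.
From mathcomp Require Import finmap complex.
From mathcomp Require Import all_classical all_reals all_analysis.

Set Implicit Arguments.
Unset Strict Implicit.
Unset Printing Implicit Defensive.

Import Order.TTheory GRing.Theory Num.Theory.
Import numFieldNormedType.Exports.

Local Open Scope classical_set_scope.
Local Open Scope ring_scope.
Local Open Scope complex_scope.

(* A multiplicative character of order exactly p, extended by 0 at 0. *)
Definition character_of_order (R : realType) (Fq : finFieldType) (p : nat)
    (chi : Fq -> R[i]) : Prop :=
  [/\ chi 0 = 0, chi 1 = 1, {morph chi : x y / x * y} &
      forall m : nat, (forall x, x != 0 -> chi x ^+ m = 1) <-> (p %| m)%N].

Section CyclicCovers.
Variables (Fq : finFieldType) (p : nat).

Definition square_free (f : {poly Fq}) : Prop :=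
  forall g : {poly Fq}, g ^+ 2 %| f -> size g = 1%N.

(* The index i : 'I_p.-1 stands for the subscript i.+1 in {1, ..., p - 1}.
   size f = n.+1 says that f is nonzero of degree n. *)
Definition Fhat (e : 'I_p.-1 -> nat) : set {poly Fq} :=
  [set F | exists (a : Fq) (f : 'I_p.-1 -> {poly Fq}),
    [/\ a != 0,
        forall i, [/\ f i \is monic, square_free (f i) & size (f i) = (e i).+1],
        forall i j, i != j -> coprimep (f i) (f j) &
        F = a *: \prod_i f i ^+ i.+1]].

(* The lowered degrees are written e with d = e + (indicator of j), so that no
   truncated subtraction occurs when some d j is 0. *)
Definition Fhat_union (d : 'I_p.-1 -> nat) : set {poly Fq} :=
  [set F | Fhat d F \/ exists (j : 'I_p.-1) (e : 'I_p.-1 -> nat),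
    (forall i, d i = (e i + (i == j))%N) /\ Fhat e F].

(* A smooth projective curve is handled through its function field.  For the
   curve with affine model Y^p = F(X) this is Fq(X)[Y] / (Y^p - F(X)); in
   [cover_eq] the polynomial variable is Y, and the coefficients are rational
   functions of X.  [cover_eq F] is monic of degree p, so for p > 0 the
   construction {poly %/ _} is the quotient by [cover_eq F] itself. *)
Definition cover_eq (F : {poly Fq}) : {poly {fraction {poly Fq}}} :=
  'X^p - (tofrac F)%:P.

Definition function_field (F : {poly Fq}) := {poly %/ cover_eq F}.

Definition function_field_const (F : {poly Fq}) (c : Fq) : function_field F :=
  in_qpoly (cover_eq F) (tofrac c%:P)%:P.

(* The action of (X, Y) |-> (X, zeta Y) on functions. *)
Definition deck_transformation (zeta : Fq) (F : {poly Fq})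
    (u : function_field F) : function_field F :=
  in_qpoly (cover_eq F)
    ((u : {poly {fraction {poly Fq}}}) \Po (tofrac zeta%:P *: 'X)).

(* Isomorphisms over Fq of the curves attached to F and G, compatible with the
   automorphisms of order p, given by their action on functions. *)
Definition is_cover_iso (zeta : Fq) (F G : {poly Fq})
    (phi : function_field F -> function_field G) : Prop :=
  [/\ bijective phi,
      zmod_morphism phi,
      monoid_morphism phi,
      forall c : Fq, phi (function_field_const F c) = function_field_const G c &
      forall u, phi (deck_transformation zeta u)
                = deck_transformation zeta (phi u)].

Definition cover_isomorphic (zeta : Fq) (F G : {poly Fq}) : Prop :=
  exists phi : function_field F -> function_field G, is_cover_iso zeta phi.

Definition cover_aut (zeta : Fq) (F : {poly Fq}) :
    set (function_field F -> function_field F) :=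
  [set phi | is_cover_iso (G := F) zeta phi].

Arguments cover_aut : clear implicits.

(* [cover_aut zeta F] is finite for the F of interest; #|` fset_set A| would be
   0 for an infinite set A. *)
Definition card_aut (zeta : Fq) (F : {poly Fq}) : nat :=
  #|` fset_set (cover_aut zeta F)|.

(* H^(d)(Fq): a point is an isomorphism class of curves, represented by the set
   of all its models with F in [Fhat_union d]. *)
Definition moduli (zeta : Fq) (d : 'I_p.-1 -> nat) : set (set {poly Fq}) :=
  [set [set G | Fhat_union d G /\ cover_isomorphic zeta F G]
    | F in Fhat_union d].

Definition model (C : set {poly Fq}) : {poly Fq} := xget 0 C.

Variable R : realType.

(* P^1(Fq) is option Fq, with None the point at infinity; (size F).-1 is the
   degree of F. *)
Definition proj_value (F : {poly Fq}) (x : option Fq) : Fq :=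
  match x with
  | Some a => F.[a]
  | None => if (p %| (size F).-1)%N then lead_coef F else 0
  end.

(* The trace of Frobenius on the chi-part of H^1, by its expression as a
   character sum. *)
Definition frob_trace (chi : Fq -> R[i]) (F : {poly Fq}) : R[i] :=
  - \sum_(x : option Fq) chi (proj_value F x).

Definition normalized_trace (chi : Fq -> R[i]) (C : set {poly Fq}) : R[i] :=
  ((Num.sqrt (#|Fq|%:R + 1))^-1)%:C * frob_trace chi (model C).

Definition aut_weight (zeta : Fq) (C : set {poly Fq}) : R :=
  (card_aut zeta (model C))%:R^-1.

(* Expectation of h over H^(d)(Fq), each C being weighted proportionally to
   1 / |Aut C|. *)
Definition moduli_mean (zeta : Fq) (d : 'I_p.-1 -> nat)
    (h : set {poly Fq} -> R) : R :=
  (\sum_(C \in moduli zeta d) aut_weight zeta C * h C)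
  / (\sum_(C \in moduli zeta d) aut_weight zeta C).

End CyclicCovers.

(* pi^-1 exp (- |z|^2) at z = x + i y, for z = (x, y). *)
Definition complex_gaussian_pdf (R : realType) (z : R * R) : R :=
  pi^-1 * expR (- (z.1 ^+ 2 + z.2 ^+ 2)).

Definition complex_gaussian_mean (R : realType) (f : R[i] -> R) : R :=
  \int[(@lebesgue_measure R \x @lebesgue_measure R)%E]_z
    (f (z.1 +i* z.2) * complex_gaussian_pdf z).

(* Main.v *)
(* A curve of the component is determined, up to isomorphism compatible with the automorphism
   of order p, by F up to Moebius substitutions and p-th powers, and the substitutions act on
   Fhat_union preserving the trace; hence orbit counting turns the weighted mean over the moduli
   space into the uniform mean over Fhat_union.  For an exponent vector nu on P^1(Fq), the mean of
   prod_x chi(F(x))^nu(x) over F is 1 + O(1/q) if p divides all nu(x), and O(q^-m) otherwise: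
   sieving for square-free products, the contribution of square divisors of small degree vanishes
   exactly by character orthogonality, and Rankin's trick bounds that of large degree.  So the
   moments of the trace approach those of a sum of q + 1 independent uniform p-th roots of unity.
   As these moments grow slowly, Taylor expansion of the cosine gives the convergence of
   E cos(c + a Re Z + b Im Z), and the central limit theorem for the independent model gives the
   limit cos(c) exp(-(a^2 + b^2)/4), which is the Gaussian value.  Finally, bounded continuous test
   functions are approximated on squares by bounded trigonometric polynomials (Bernstein
   polynomials in sin), the second moments controlling the rest. *)

From HB Require Import structures.
Require Import Defs.
From mathcomp Require Import all_boot all_order all_algebra.
From mathcomp Require Import finmap complex ring lra zify.
From mathcomp Require Import all_classical all_reals all_analysis.
From mathcomp Require Import measurable_realfun.

Set Implicit Arguments.
Unset Strict Implicit.
Unset Printing Implicit Defensive.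

Import Order.TTheory GRing.Theory Num.Theory.
Import numFieldNormedType.Exports.

Local Open Scope ring_scope.
Local Open Scope complex_scope.

(** * Square-free polynomials *)

(** No relation between the sizes of [q] and of the degrees is assumed, so the error terms must be
    uniform in both. The accuracy fixes the order [K] of the Taylor expansion. The [k]-th power of
    the normalized trace is a sum over [(2 (q + 1)) ^ k] words with coefficients of order
    [(q + 1) ^ (- k / 2)]. Exponents not all divisible by [p] therefore need means much smaller than
    [q ^ (- k / 2)]; sieving to level [K + 1] gives this as soon as all degrees exceed [3 K + 2],
    whatever [q] is. For the other exponents the error [O(1/q)] suffices, because their total
    normalized weight is bounded: it is itself a moment of the independent model. On the geometric
    side an isomorphism is a map of function fields. Compatibility with the automorphism of order
    [p] makes it respect the eigenspaces spanned by [1] and [Y] over the rational functions, so it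
    amounts to a Moebius substitution and a scaling of [Y]. Lowered degrees record a branch point at
    infinity, which substitutions can move to a finite point and back; hence the union of
    families. *)

Section SquareFree.
Variable Fq : finFieldType.
Implicit Types f g P : {poly Fq}.

Lemma irreducible_dvdM P f g :
  irreducible_poly P -> P %| f * g -> (P %| f) || (P %| g).
Proof.
move=> irrP; case: (boolP (P %| f)) => //= nPf.
by rewrite Gauss_dvdpr // irreducible_poly_coprime.
Qed.

Lemma irreducible_dvdX P f n : irreducible_poly P -> P %| f ^+ n -> P %| f.
Proof.
move=> irrP; elim: n => [|n IHn].
  by rewrite expr0 dvdp1 => /eqP sP; case: irrP; rewrite sP.
by rewrite exprS => /(irreducible_dvdM irrP) /orP[].
Qed.

Lemma irreducible_dvd_prod P (I : finType) (f : I -> {poly Fq}) :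
  irreducible_poly P -> P %| \prod_i f i -> exists i, P %| f i.
Proof.
move=> irrP.
elim/big_rec: _ => [|i x _ IH].
  by rewrite dvdp1 => /eqP sP; case: irrP; rewrite sP.
by move=> /(irreducible_dvdM irrP) /orP[? | /IH //]; exists i.
Qed.

Lemma exists_irreducible f :
  f != 0 -> size f != 1%N -> exists2 P, irreducible_poly P & P %| f.
Proof.
have [n] := ubnP (size f); elim: n f => // n IHn f /ltnSE sfn f0 sf1.
have [irrf|] := pselect (irreducible_poly f); first by exists f.
have sf_gt1 : (1 < size f)%N by rewrite ltn_neqAle eq_sym sf1 lt0n size_poly_eq0.
move=> nirr.
have [g [sg1 gf ngf]] : exists g, [/\ size g != 1%N, g %| f & ~~ (g %= f)].
  apply: contrapT => H; apply: nirr; split=> // g sg1 gf.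
  by apply: contrapT => /negP ngf; apply: H; exists g.
have g0 : g != 0 by apply: contraNneq f0 => g0; rewrite -dvd0p -g0.
have sgf : (size g < size f)%N by rewrite ltn_neqAle dvdp_leq // andbT dvdp_size_eqp.
have [P irrP Pg] := IHn g (leq_trans sgf sfn) g0 sg1.
by exists P => //; apply: dvdp_trans gf.
Qed.

Lemma square_freeP f : f != 0 ->
  (square_free f <-> forall P, irreducible_poly P -> ~~ (P ^+ 2 %| f)).
Proof.
move=> f0; split=> [sf P irrP | H g g2f].
  by apply/negP => /sf sP; case: irrP; rewrite sP.
apply/eqP/contraT => sg1.
have g0 : g != 0.
  by apply: contraNneq f0 => g0; move: g2f; rewrite g0 expr2 mul0r dvd0p.
have [P irrP Pg] := exists_irreducible g0 sg1.
by have /negP := H P irrP; case; apply: dvdp_trans g2f; rewrite dvdp_exp2r.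
Qed.

Lemma square_free_neq0 f : square_free f -> f != 0.
Proof.
move=> sf; apply/eqP => f0.
by have := sf 0; rewrite f0 dvdp0 size_poly0 => /(_ isT).
Qed.

Lemma square_free_dvd f g : g %| f -> square_free f -> square_free g.
Proof. by move=> gf sf h h2g; apply: sf; apply: dvdp_trans gf. Qed.

Lemma not_coprimep_irreducible f g : f != 0 -> ~~ coprimep f g ->
  exists P, [/\ irreducible_poly P, P %| f & P %| g].
Proof.
move=> f0; rewrite /coprimep => sg.
have g0 : gcdp f g != 0 by rewrite gcdp_eq0 negb_and f0.
have [P irrP Pd] := exists_irreducible g0 sg.
by exists P; split=> //; apply: dvdp_trans Pd _; rewrite (dvdp_gcdl, dvdp_gcdr).
Qed.

(** Turns the two conditions on the factors in [Fhat] into a single one on their product, which is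
    the form that the sieve detects. *)
Lemma square_free_prod (I : finType) (f : I -> {poly Fq}) :
  (forall i, f i != 0) ->
  (square_free (\prod_i f i) <->
   (forall i, square_free (f i)) /\ (forall i j, i != j -> coprimep (f i) (f j))).
Proof.
move=> f0; have p0 : \prod_i f i != 0 by apply/prodf_neq0 => i _.
split=> [sf | [sf cf]].
  split=> [i|i j ij].
    by apply: (square_free_dvd _ sf); rewrite (bigD1 i) //= dvdp_mulIl.
  apply/contraT => /(not_coprimep_irreducible (f0 i)) [P [irrP Pi Pj]].
  have /negP := (square_freeP p0).1 sf P irrP; case.
  rewrite (bigD1 i) //= (bigD1 j) /=; last by rewrite eq_sym.
  by rewrite mulrA dvdp_mulr // expr2 dvdp_mul.
apply/(square_freeP p0) => P irrP; apply/negP => P2.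
have [i Pi] : exists i, P %| f i.
  by apply: irreducible_dvd_prod irrP _; apply: dvdp_trans P2; rewrite expr2 dvdp_mulIl.
move: (Pi) => /dvdpP [t ft].
have nPt : ~~ (P %| t).
  apply/negP => /dvdpP [s ts]; have /negP := (square_freeP (f0 i)).1 (sf i) P irrP.
  by case; rewrite ft ts -mulrA -expr2 dvdp_mulIr.
move: P2; rewrite (bigD1 i) //= ft expr2 (mulrC t) -mulrA dvdp_mul2l ?irredp_neq0 //.
move=> /(irreducible_dvdM irrP); rewrite (negbTE nPt) /= => Pr.
have : P %| \prod_(j | j != i) f j by [].
rewrite (big_mkcond (fun j => j != i)) /= => /(irreducible_dvd_prod irrP) [j].
case: ifP => [ji Pj | _]; last by rewrite dvdp1 => /eqP sP; case: irrP; rewrite sP.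
have := cf j i ji; apply/negP; rewrite /coprimep.
apply/eqP => s1; have : P %| gcdp (f j) (f i) by rewrite dvdp_gcd Pj Pi.
have /eqP : size (gcdp (f j) (f i)) = 1%N by [].
move=> /size_poly1P [c c0 ->].
rewrite -[c%:P]alg_polyC dvdpZr // dvdp1 => /eqP sP; by case: irrP; rewrite sP.
Qed.

(** Induction on the degree, cancelling one prime [P] from both sides. A prime [Q] left in [f] is
    not associate to [P], since [P ^+ 2] does not divide [f], so it still divides the cofactor of
    [g]. *)
Lemma square_free_dvdp f g : square_free f ->
  (forall P, irreducible_poly P -> P %| f -> P %| g) -> f %| g.
Proof.
have [n] := ubnP (size f); elim: n f g => // n IHn f g /ltnSE sfn sf H.
have f0 := square_free_neq0 sf.
case: (boolP (size f == 1%N)) => [/size_poly1P [c c0 ->]|sf1].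
  by rewrite -[c%:P]alg_polyC dvdpZl // dvd1p.
have [P irrP Pf] := exists_irreducible f0 sf1.
move: (Pf) (H P irrP Pf) => /dvdpP [t ft] /dvdpP [s gs].
rewrite ft gs dvdp_mul2r ?irredp_neq0 //.
have t0 : t != 0 by apply: contraNneq f0 => t0; rewrite ft t0 mul0r.
apply: IHn.
- apply: leq_trans sfn; rewrite ft size_mul ?(irredp_neq0 irrP) //.
  by case: irrP; move: (size P) => [|[|m]] // _ _; rewrite !addnS /= ltnS leq_addr.
- by apply: (square_free_dvd _ sf); rewrite ft dvdp_mulIl.
move=> Q irrQ Qt; have Qf : Q %| f by rewrite ft dvdp_mulr.
have := H Q irrQ Qf; rewrite gs => /(irreducible_dvdM irrQ) /orP[//|QP].
have QeP : Q %= P by apply: irrP => //; case: irrQ => + _; case: (size Q) => [|[]].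
have /negP := (square_freeP f0).1 sf Q irrQ; case.
by rewrite ft expr2 dvdp_mul // .
Qed.

(** A prime factor of [f] occurs exactly [n] times in [f ^+ n]. For [n = p - 1] this makes the
    members of the family free of [p]-th powers. *)
Lemma dvdpX_square_free f g n :
  square_free f -> g ^+ n.+1 %| f ^+ n -> size g = 1%N.
Proof.
move=> sf gf; have f0 := square_free_neq0 sf.
apply/eqP/contraT => sg1.
have g0 : g != 0.
  apply: contraTneq gf => ->; rewrite exprS mul0r dvd0p expf_eq0 negb_and.
  by rewrite f0 orbT.
have [P irrP Pg] := exists_irreducible g0 sg1.
have Pf : P ^+ n.+1 %| f ^+ n by apply: dvdp_trans gf; rewrite dvdp_exp2r.
have : P %| f.
  by apply: (@irreducible_dvdX _ _ n) => //; apply: dvdp_trans Pf; rewrite exprS dvdp_mulIl.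
move=> /dvdpP [t ft].
have nPt : ~~ (P %| t).
  apply/negP => /dvdpP [s ts]; have /negP := (square_freeP f0).1 sf P irrP.
  by case; rewrite ft ts -mulrA -expr2 dvdp_mulIr.
move: Pf; rewrite ft exprMn exprS dvdp_mul2r ?expf_neq0 ?irredp_neq0 //.
by move=> /(irreducible_dvdX irrP); rewrite (negbTE nPt).
Qed.

Lemma power_dvdp_inj P t s i j : irreducible_poly P -> ~~ (P %| t) ->
  ~~ (P %| s) -> P ^+ i * t = P ^+ j * s -> i = j.
Proof.
move=> irrP; have P0 := irredp_neq0 irrP.
wlog ij : i j t s / (i <= j)%N => [H nPt nPs E|nPt nPs E].
  by case/orP: (leq_total i j) => le; [apply: (H i j t s)|apply/esym/(H j i s t)].
move: E; rewrite -(subnKC ij) exprD -mulrA => /(mulfI (expf_neq0 _ P0)) E.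
case: (j - i)%N E => [|m E]; first by rewrite addn0.
by move: nPt; rewrite E exprS -mulrA dvdp_mulIl.
Qed.

End SquareFree.

(** * Evaluation at rational functions, and reversal of polynomials *)

Section RationalFunctions.
Variable Fq : finFieldType.
Implicit Types f g F : {poly Fq}.
Local Notation K := {fraction {poly Fq}}.

Definition frac_const : {rmorphism Fq -> K} := tofrac (R := {poly Fq}) \o polyC.

Definition evalp (x : K) (F : {poly Fq}) : K := (map_poly frac_const F).[x].

Lemma evalpM x f g : evalp x (f * g) = evalp x f * evalp x g.
Proof. by rewrite /evalp rmorphM hornerM. Qed.

Lemma evalpD x f g : evalp x (f + g) = evalp x f + evalp x g.
Proof. by rewrite /evalp rmorphD hornerD. Qed.

Lemma evalpC x c : evalp x c%:P = tofrac c%:P.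
Proof. by rewrite /evalp map_polyC hornerC. Qed.

Lemma evalp_X x : evalp x 'X = x.
Proof. by rewrite /evalp map_polyX hornerX. Qed.

Lemma evalpE x f n : (size f <= n)%N ->
  evalp x f = \sum_(i < n) tofrac (f`_i)%:P * x ^+ i.
Proof.
move=> sfn; rewrite /evalp (@horner_coef_wide _ n).
  by apply: eq_bigr => i _; rewrite coef_map.
by rewrite size_map_poly.
Qed.

Lemma evalp_tofrac g f : evalp (tofrac g) f = tofrac (f \Po g).
Proof.
rewrite (evalpE _ (leqnn _)) comp_polyE rmorph_sum /=; apply: eq_bigr => i _.
by rewrite -mul_polyC rmorphM rmorphXn.
Qed.

Lemma evalp_comp x f g : evalp x (f \Po g) = evalp (evalp x g) f.
Proof.
rewrite /evalp map_comp_poly horner_comp //.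
Qed.

(* For [size F <= n.+1] this is X^n F(1/X). *)
Definition rev_poly n F := \poly_(k < n.+1) F`_(n - k).

Lemma size_rev_poly n F : (size (rev_poly n F) <= n.+1)%N.
Proof. exact: size_poly. Qed.

Lemma coef_rev_poly n F k : (rev_poly n F)`_k = if (k <= n)%N then F`_(n - k) else 0.
Proof. by rewrite coef_poly ltnS. Qed.

Lemma rev_polyK n F : (size F <= n.+1)%N -> rev_poly n (rev_poly n F) = F.
Proof.
move=> sF; apply/polyP => k; rewrite coef_rev_poly; case: leqP => kn.
  by rewrite coef_rev_poly leq_subr subKn.
by rewrite nth_default // (leq_trans sF).
Qed.

Lemma evalp_rev_poly x n F : x != 0 -> (size F <= n.+1)%N ->
  evalp x (rev_poly n F) = x ^+ n * evalp x^-1 F.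
Proof.
move=> x0 sF; rewrite (evalpE _ sF) (evalpE _ (size_rev_poly n F)).
rewrite (reindex_inj rev_ord_inj) /= mulr_sumr; apply: eq_bigr => i _.
rewrite coef_rev_poly subSS leq_subr subKn; last by rewrite -ltnS.
rewrite mulrCA; congr (_ * _).
by rewrite exprB ?exprVn // -1?ltnS // unitfE.
Qed.

Lemma tofrac_rev_poly n F : (size F <= n.+1)%N ->
  tofrac (rev_poly n F) = tofrac 'X ^+ n * evalp (tofrac 'X)^-1 F.
Proof.
move=> sF; rewrite -evalp_rev_poly ?tofrac_eq0 ?polyX_eq0 //.
by rewrite evalp_tofrac comp_polyXr.
Qed.

(** Reading [rev_poly n f] as [X ^ n f(1/X)] in the field of fractions replaces a convolution of
    coefficients by a product of values. *)
Lemma rev_polyM n m f g : (size f <= n.+1)%N -> (size g <= m.+1)%N ->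
  rev_poly (n + m) (f * g) = rev_poly n f * rev_poly m g.
Proof.
move=> sf sg; apply/eqP; rewrite -tofrac_eq; apply/eqP.
rewrite rmorphM /= !tofrac_rev_poly //.
  by rewrite exprD evalpM mulrACA.
apply: leq_trans (size_polyMleq _ _) _.
by move: sf sg; case: (size f) => [|a]; case: (size g) => [|b]; rewrite ?addnS ?addn0 ?add0n /= => *; lia.
Qed.

Lemma rev_poly1 : rev_poly 0 1 = 1.
Proof.
by apply/polyP => k; rewrite coef_rev_poly !coefC; case: k.
Qed.

Lemma size_prod_leqS (I : finType) (P : pred I) (f : I -> {poly Fq}) (n : I -> nat) :
  (forall i, (size (f i) <= (n i).+1)%N) ->
  (size (\prod_(i | P i) f i)%R <= (\sum_(i | P i) n i).+1)%N.
Proof.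
move=> sf; apply: (big_rec2 (fun (x : {poly Fq}) (y : nat) => size x <= y.+1)%N).
  by rewrite size_poly1.
move=> i x y _ IH.
apply: leq_trans (size_polyMleq _ _) _; move: IH (sf i).
by case: (size _) => [|a]; case: (size _) => [|b]; rewrite ?addnS ?addn0 ?add0n /= => *; lia.
Qed.

Lemma rev_poly_prod (I : finType) (f : I -> {poly Fq}) (n : I -> nat) :
  (forall i, (size (f i) <= (n i).+1)%N) ->
  rev_poly (\sum_i n i) (\prod_i f i) = \prod_i rev_poly (n i) (f i).
Proof.
move=> sf; suff [-> _] : rev_poly (\sum_i n i) (\prod_i f i) = \prod_i rev_poly (n i) (f i) /\
  (size (\prod_i f i)%R <= (\sum_i n i).+1)%N by [].
apply: (big_rec3 (fun (x y : {poly Fq}) (z : nat) =>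
  rev_poly z y = x /\ (size y <= z.+1)%N)); first by rewrite rev_poly1 size_poly1.
move=> i x y z _ [IH sz]; split; first by rewrite rev_polyM // IH.
apply: leq_trans (size_polyMleq _ _) _; move: sz (sf i).
by case: (size _) => [|a]; case: (size _) => [|b]; rewrite ?addnS ?addn0 ?add0n /= => *; lia.
Qed.

Lemma rev_polyX n m f : (size f <= n.+1)%N ->
  rev_poly (m * n) (f ^+ m) = rev_poly n f ^+ m.
Proof.
move=> sf; have := @rev_poly_prod 'I_m (fun=> f) (fun=> n) (fun=> sf).
by rewrite !prodr_const sum_nat_const !card_ord.
Qed.

Lemma rev_polyZ n a f : rev_poly n (a *: f) = a *: rev_poly n f.
Proof.
apply/polyP => k; rewrite coefZ !coef_rev_poly coefZ.
by case: ifP; rewrite ?mulr0.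
Qed.

(** The degree of [f] is [n] or [n - 1], so ['X] divides the reversal at most once: otherwise two
    consecutive top coefficients of [f] would vanish. A square divisor prime to ['X] reverses to a
    square divisor of [f] of the same degree. *)
Lemma square_free_rev_poly n f : square_free f ->
  (n <= size f <= n.+1)%N -> square_free (rev_poly n f).
Proof.
move=> sqf /andP[nf fn]; have f0 := square_free_neq0 sqf.
have r0 : rev_poly n f != 0.
  apply: contra_neq f0 => r0; rewrite -(rev_polyK fn) r0.
  by apply/polyP => k; rewrite coef_rev_poly coef0; case: ifP; rewrite ?coef0.
apply/(square_freeP r0) => P irrP; apply/negP => /dvdpP [t rt].
have P0 := irredp_neq0 irrP.
have t0 : t != 0 by apply: contraNneq r0 => t0; rewrite rt t0 mul0r.
have [m sP] : exists m, size P = m.+2.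
  by case: irrP => + _; case: (size P) => [|[|m]] // _; exists m.
have st : (size t + m.+1 + m.+1 <= n.+1)%N.
  have := size_rev_poly n f; rewrite rt expr2.
  rewrite size_mul ?mulf_neq0 // size_mul // sP.
  by move: (size t) (size_poly_gt0 t) => u _; rewrite addnS /= !addnA -!addnA; lia.
have [P00|P00] := eqVneq P`_0 0.
  have XP : 'X %| P.
    by rewrite -['X]subr0 -polyC0 dvdp_XsubCl /root horner_coef0 P00.
  have [s rs] : exists s, rev_poly n f = s * 'X^2.
    apply/dvdpP; rewrite rt; apply: dvdp_trans (dvdp_mulIr _ _).
    by rewrite dvdp_exp2r.
  have n1 : (1 <= n)%N by move: st; lia.
  have c0 : (rev_poly n f)`_0 = 0 by rewrite rs coefMXn.
  have c1 : (rev_poly n f)`_1 = 0 by rewrite rs coefMXn.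
  move: c0 c1; rewrite !coef_rev_poly n1 leq0n subn0 => c0 c1.
  have : lead_coef f = 0.
    rewrite lead_coefE; move: nf fn; rewrite leq_eqVlt => /orP[/eqP <- _|].
      by rewrite -subn1.
    by move=> h1 h2; have -> : size f = n.+1 by apply/eqP; rewrite eqn_leq h2 h1.
  by apply/eqP; rewrite lead_coef_eq0.
have : size (rev_poly m.+1 P) = 1%N.
  apply: sqf; apply/dvdpP; exists (rev_poly (n - 2 * m.+1) t).
  rewrite -[LHS](rev_polyK fn) rt -(@rev_polyX m.+1 2) ?sP //.
  have := t0; rewrite -size_poly_gt0 => st0.
  have mn : (2 * m.+1 <= n)%N by move: st st0; move: (size t) => u; lia.
  rewrite -rev_polyM ?subnK //.
    by move: st; move: (size t) => u; lia.
  apply: leq_trans (size_poly_exp_leq _ _) _.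
  by rewrite sP; lia.
have -> : size (rev_poly m.+1 P) = m.+2 by rewrite size_poly_eq // subnn.
by [].
Qed.

End RationalFunctions.

(** * The family of models and the trace *)

Lemma big_option (V : nmodType) (T : finType) (g : option T -> V) :
  \sum_(x : option T) g x = g None + \sum_(x : T) g (Some x).
Proof.
rewrite (bigD1 None) //=; congr (_ + _).
rewrite (reindex_omap (@Some T) id) /=; last by case.
by apply: eq_bigl => x; rewrite eqxx.
Qed.

Section CoverFamily.
Variables (Fq : finFieldType) (p : nat) (d : 'I_p.-1 -> nat).
Implicit Types (F G : {poly Fq}) (f : 'I_p.-1 -> {poly Fq}).

(* [o] is the index of the lowered degree, i.e. of the multiplicity of the point
   at infinity, if any. *)
Lemma Fhat_unionP F : Fhat_union d F <->
  exists (a : Fq) f (o : option 'I_p.-1),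
    [/\ a != 0, forall i, f i \is monic, square_free (\prod_i f i),
        forall i, (size (f i) + (o == Some i) = (d i).+1)%N &
        F = a *: \prod_i f i ^+ i.+1].
Proof.
have sqf f : (forall i, f i \is monic) ->
    square_free (\prod_i f i) <-> (forall i, square_free (f i)) /\
      (forall i j, i != j -> coprimep (f i) (f j)).
  by move=> mf; apply: square_free_prod => i; rewrite monic_neq0.
split.
  case=> [[a [f [a0 Hf cf ->]]] | [j [e [de [a [f [a0 Hf cf ->]]]]]]].
    exists a, f, None; split=> //; first by move=> i; case: (Hf i).
      apply/sqf; first by move=> i; case: (Hf i).
      by split=> // i; case: (Hf i).
    by move=> i; case: (Hf i) => _ _ ->; rewrite addn0.
  exists a, f, (Some j); split=> //; first by move=> i; case: (Hf i).
    apply/sqf; first by move=> i; case: (Hf i).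
    by split=> // i; case: (Hf i).
  move=> i; case: (Hf i) => _ _ ->; rewrite de addSn; congr (_ + _).+1.
  by rewrite -(inj_eq (@Some_inj _)) eq_sym.
case=> a [f [ o [a0 mf /(sqf f mf) [sf cf] df ->]]].
case: o df => [j df|df]; [right|left].
  exists j, (fun i => (size (f i)).-1); split.
    move=> i; apply: succn_inj; rewrite -df -addSn prednK.
      by rewrite -(inj_eq (@Some_inj _)) eq_sym.
    by rewrite size_poly_gt0 monic_neq0.
  exists a, f; split=> // i; split=> //.
  by rewrite prednK // size_poly_gt0 monic_neq0.
exists a, f; split=> // i; split=> //.
by rewrite -df addn0.
Qed.

(** The degree of [F] as a binary form: whichever factor is lowered, [deg F] plus the multiplicity
    of the point at infinity equals [D]. *)
Let D := (\sum_(i < p.-1) i.+1 * d i)%N.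

Lemma Fhat_union_size F : Fhat_union d F -> (size F <= D.+1)%N.
Proof.
move=> /Fhat_unionP [a [f [ o [a0 mf sf df ->]]]].
apply: leq_trans (size_scale_leq _ _) _.
apply: (@size_prod_leqS _ _ xpredT _ (fun i : 'I_p.-1 => i.+1 * d i)%N) => i.
apply: leq_trans (size_poly_exp_leq _ _) _; rewrite ltnS mulnC leq_mul2l /=.
by have := df i; case: (size _) => // m; rewrite addSn => -[ <-]; rewrite leq_addr.
Qed.

Lemma Fhat_union_neq0 F : Fhat_union d F -> F != 0.
Proof.
move=> /Fhat_unionP [a [f [ o [a0 mf sf df ->]]]].
rewrite scaler_eq0 negb_or a0 /=; apply/prodf_neq0 => i _.
by rewrite expf_neq0 // monic_neq0.
Qed.

Lemma Fhat_union_power_free F g : (0 < p)%N -> Fhat_union d F ->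
  g ^+ p %| F -> size g = 1%N.
Proof.
move=> p_gt0 /Fhat_unionP [a [f [ o [a0 mf sf df ->]]]].
rewrite dvdpZr // -[X in g ^+ X](prednK p_gt0) => gf.
apply: (dvdpX_square_free sf (n := p.-1)).
apply: dvdp_trans gf _; rewrite -prodrXl.
apply: (big_ind2 (fun x y : {poly Fq} => x %| y)) => //.
  by move=> *; apply: dvdp_mul.
by move=> i _; rewrite dvdp_exp2l.
Qed.

Lemma Fhat_unionZ F a : a != 0 -> Fhat_union d F -> Fhat_union d (a *: F).
Proof.
move=> a0 /Fhat_unionP [b [f [ o [b0 mf sf df ->]]]]; apply/Fhat_unionP.
by exists (a * b), f, o; split; rewrite ?mulf_neq0 ?scalerA.
Qed.

(* Rescaling the factors to be monic. *)
Lemma Fhat_union_intro F (a : Fq) f (o : option 'I_p.-1) :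
  a != 0 -> square_free (\prod_i f i) ->
  (forall i, (size (f i) + (o == Some i) = (d i).+1)%N) ->
  F = a *: \prod_i f i ^+ i.+1 -> Fhat_union d F.
Proof.
move=> a0 sf df ->; apply/Fhat_unionP.
have f0 i : f i != 0.
  apply: contraNneq (square_free_neq0 sf) => fi0.
  by rewrite (bigD1 i) //= fi0 mul0r.
have l0 i : (lead_coef (f i))^-1 != 0 by rewrite invr_eq0 lead_coef_eq0.
exists (a * \prod_i lead_coef (f i) ^+ i.+1),
  (fun i => (lead_coef (f i))^-1 *: f i), o; split.
- rewrite mulf_neq0 //; apply/prodf_neq0 => i _.
  by rewrite expf_neq0 // lead_coef_eq0.
- by move=> i; rewrite monicE lead_coefZ mulVf // lead_coef_eq0.
- apply: (square_free_dvd _ sf); rewrite scaler_prod dvdpZl //.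
  by apply/prodf_neq0 => i _.
- by move=> i; rewrite size_scale.
rewrite -scalerA; congr (_ *: _); rewrite -scaler_prod; apply: eq_bigr => i _.
by rewrite exprZn scalerA exprVn divff ?scale1r // expf_neq0 // lead_coef_eq0.
Qed.

Lemma Fhat_union_affine F (a b : Fq) : a != 0 -> Fhat_union d F ->
  Fhat_union d (F \Po (a *: 'X + b%:P)).
Proof.
move=> a0 /Fhat_unionP [c [f [ o [c0 mf sf df ->]]]].
set L := a *: 'X + b%:P.
have sL : size L = 2%N.
  rewrite size_polyDl ?size_scale ?size_polyX //.
  by rewrite (leq_ltn_trans (size_polyC_leq1 _)).
apply: (@Fhat_union_intro _ c (fun i => f i \Po L) o) => //.
(* The inverse substitution carries a square divisor of the composite back to one of the original
   product. *)
- set M := a^-1 *: 'X - (b / a)%:P.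
  have LM : L \Po M = 'X.
    rewrite comp_polyD comp_polyZ comp_polyX comp_polyC /M scalerBr scalerA.
    rewrite divff // scale1r -mul_polyC -polyCM mulrCA divff // mulr1.
    by rewrite subrK.
  have -> : \prod_i (f i \Po L) = (\prod_i f i) \Po L.
    by rewrite rmorph_prod.
  move=> g /dvdpP [t tg].
  have sM : size M = 2%N.
    rewrite size_polyDl ?size_scale ?size_polyX ?invr_eq0 // -polyCN.
    by rewrite (leq_ltn_trans (size_polyC_leq1 _)).
  suff : size (g \Po M) = 1%N by rewrite size_comp_poly2.
  apply: sf; apply/dvdpP; exists (t \Po M).
  by rewrite -[LHS]comp_polyXr -LM comp_polyA tg comp_polyM rmorphXn.
- by move=> i; rewrite size_comp_poly2.
rewrite comp_polyZ; congr (_ *: _).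
rewrite rmorph_prod.
by apply: eq_bigr => i _; rewrite rmorphXn.
Qed.

(** The substitution [1/X] exchanges the points 0 and infinity. A factor lowered in [F] acquires the
    zero 0, and the factor of [F] vanishing at 0 becomes the lowered one. *)
Lemma Fhat_union_rev F : Fhat_union d F -> Fhat_union d (rev_poly D F).
Proof.
move=> /Fhat_unionP [c [f [ o [c0 mf sf df ->]]]].
have f0 i : f i != 0 by rewrite monic_neq0.
have [sqf cf] := (square_free_prod f0).1 sf.
have sdf i : (size (f i) <= (d i).+1)%N by rewrite -df leq_addr.
have dsf i : (d i <= size (f i))%N.
  by rewrite -ltnS -df; case: (o == _); rewrite ?addn0 ?addn1.
(* By coprimality at most one factor vanishes at 0; its reversal loses exactly one degree. *)
pose o' := [pick i | 'X %| f i].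
have o'E i : (o' == Some i) = ('X %| f i).
  rewrite /o'; case: pickP => [j Xj|/(_ i) -> //].
  apply/eqP/idP => [[ <-] //|Xi]; congr Some; apply/eqP/contraT => ji.
  have := cf j i ji; rewrite coprimep_def => /size_poly1P [u u0 E].
  have : 'X %| gcdp (f j) (f i) by rewrite dvdp_gcd Xj Xi.
  by rewrite E -[u%:P]alg_polyC dvdpZr // dvdp1 size_polyX.
have X_dvd (g : {poly Fq}) : ('X %| g) = (g`_0 == 0).
  by rewrite -['X]subr0 -polyC0 dvdp_XsubCl /root horner_coef0.
apply: (@Fhat_union_intro _ c (fun i => rev_poly (d i) (f i)) o') => //.
- rewrite -rev_poly_prod //; apply: square_free_rev_poly => //.
  have szP : (size (\prod_i f i)%R + (o != None) = (\sum_i d i).+1)%N.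
    rewrite size_prod; last by [].
    have Ho : (\sum_i (o == Some i) = (o != None))%N.
      case: o df => [j|] df /=; last by rewrite big1.
      rewrite (bigD1 j) //= eqxx big1 ?addn0 // => i ij.
      by apply/eqP; rewrite eqb0 (inj_eq (@Some_inj _)) eq_sym.
    have Hs : (\sum_i size (f i) + \sum_i (o == Some i) = \sum_i d i + #|'I_p.-1|)%N.
      rewrite -big_split /= -sum1_card -big_split /=.
      by apply: eq_bigr => i _; rewrite df addn1.
    have le : (#|'I_p.-1| <= \sum_i size (f i))%N.
      rewrite -sum1_card; apply: leq_sum => i _; by rewrite size_poly_gt0.
    rewrite -Ho; move: Hs le; move: (\sum_i size (f i))%N (\sum_i d i)%N.
    by move: (\sum_i (o == Some i))%N #|'I_p.-1| => u v w x; lia.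
  by move: szP; case: (o != None); rewrite /= ?addn0 ?addn1 => H;
    apply/andP; split; lia.
- move=> i; rewrite o'E X_dvd.
  have [fi0|fi0] := eqVneq (f i)`_0 0; last first.
    by rewrite addn0 size_poly_eq // subnn.
  have sfi : (1 < size (f i))%N.
    rewrite ltnNge; apply: contra_neqN (f0 i) => s1.
    by rewrite (size1_polyC s1) fi0.
  have f1 : (f i)`_1 != 0.
    apply/eqP => fi1; have := sqf i 'X; rewrite size_polyX => H.
    suff /H : 'X ^+ 2 %| f i by [].
    have -> : f i = drop_poly 2 (f i) * 'X^2.
      rewrite -[LHS](poly_take_drop 2) [take_poly 2 _](_ : _ = 0) ?add0r //.
      by apply/polyP => -[|[|k]]; rewrite coef_take_poly ?coef0 //=.
    exact: dvdp_mulIr.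
  have di : (0 < d i)%N by have := leq_trans sfi (sdf i).
  rewrite addn1; congr _.+1; apply/eqP; rewrite eqn_leq; apply/andP; split.
    apply/leq_sizeP => k; rewrite leq_eqVlt coef_rev_poly => /orP[/eqP <-|].
      by rewrite leqnn subnn fi0.
    by move=> dk; rewrite leqNgt dk.
  rewrite -[X in (X <= _)%N](prednK di) ltnNge.
  apply/negP => /leq_sizeP/(_ _ (leqnn _)); rewrite coef_rev_poly leq_pred -subn1.
  by rewrite subKn // => /eqP; apply/negP.
rewrite rev_polyZ /D rev_poly_prod; last first.
  move=> i; apply: leq_trans (size_poly_exp_leq _ _) _; rewrite ltnS mulnC leq_mul2l /=.
  by have := sdf i; case: (size _).
by congr (_ *: _); apply: eq_bigr => i _; rewrite rev_polyX.
Qed.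

Section Trace.
Variables (R : realType) (chi : Fq -> R[i]).
Hypotheses (p_prime : prime p) (chiP : character_of_order p chi).
Hypothesis Dp : (p %| D)%N.

Let p_gt0 : (0 < p)%N. Proof. exact: prime_gt0. Qed.

(** If the factor of index [j] is lowered, then [deg F = D - j.+1] with [0 < j.+1 < p]. As [p]
    divides [D], it does not divide [deg F], and both sides are 0. If no factor is lowered,
    [deg F = D]. *)
Lemma proj_value_infinity F : Fhat_union d F -> proj_value p F None = F`_D.
Proof.
move=> FS /=; have F0 := Fhat_union_neq0 FS.
move: (FS) (Fhat_union_size FS) => /Fhat_unionP [c [f [ o [c0 mf sf df EF]]]] sD.
have sF : (size F + (if o is Some j then j.+1 else 0) = D.+1)%N.
  rewrite EF size_scale // size_prod; last first.
    by move=> i _; rewrite expf_neq0 // monic_neq0.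
  have szX i : size (f i ^+ i.+1) = ((size (f i)).-1 * i.+1).+1.
    by rewrite -size_exp prednK // size_poly_gt0 expf_neq0 // monic_neq0.
  under eq_bigr do rewrite szX -addn1.
  rewrite big_split /= sum1_card -addSn addnK addSn; congr _.+1.
  have E (i : 'I_p.-1) : (i.+1 * d i = (size (f i)).-1 * i.+1 + (if o == Some i then i.+1 else 0))%N.
    have : d i = ((size (f i)).-1 + (o == Some i))%N.
      apply: succn_inj; rewrite -df -addSn prednK //.
      by rewrite size_poly_gt0 monic_neq0.
    by move=> ->; rewrite mulnDr mulnC; case: (o == _); rewrite ?muln1 ?muln0.
  rewrite /D (eq_bigr _ (fun i _ => E i)) big_split /=; congr addn.
  case: (o) => [j|]; last by rewrite big1.
  rewrite (bigD1 j) //= eqxx big1 ?addn0 // => i ij.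
  by rewrite (inj_eq (@Some_inj _)) eq_sym (negbTE ij).
case: o sF {df} => [j|] sF; last first.
  have -> : (size F).-1 = D by rewrite -[size F]addn0 sF.
  by rewrite Dp lead_coefE; congr nth; rewrite -[size F]addn0 sF.
have ss : (size F).-1 = (D - j.+1)%N.
  by rewrite -(addnK j.+1 (size F)) sF; lia.
have jD : (j.+1 <= D)%N.
  by rewrite -ltnS -sF -addn1 addnC leq_add2r size_poly_gt0.
rewrite ifF.
  by rewrite nth_default // -ltnS -sF addnS ltnS leq_addr.
rewrite ss; apply/negP => pD; have : (p %| j.+1)%N.
  by rewrite -(subKn jD) dvdn_sub.
move=> /dvdn_leq; move/(_ isT); apply/negP; rewrite -ltnNge.
by have := ltn_ord j; rewrite -ltnS prednK.
Qed.

Let chi0 : chi 0 = 0. Proof. by case: chiP. Qed.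
Let chi1 : chi 1 = 1. Proof. by case: chiP. Qed.
Let chiM : {morph chi : x y / x * y}. Proof. by case: chiP. Qed.

Lemma chiX x n : chi (x ^+ n) = chi x ^+ n.
Proof. by elim: n => [|n IH]; rewrite ?expr0 ?chi1 // !exprS chiM IH. Qed.

Lemma chi_pow_p x : x != 0 -> chi x ^+ p = 1.
Proof. by case: chiP => _ _ _ /(_ p) [_ /(_ (dvdnn p))]; apply. Qed.

(** Because [p] divides [D], the character of a value of a form of degree [D] does not depend on the
    homogeneous coordinates of the point. This is what makes the trace invariant under Moebius
    substitutions. *)
Lemma chi_powD x : x != 0 -> chi (x ^+ D) = 1.
Proof.
move=> x0; rewrite chiX; case/dvdnP: Dp => k ->.
by rewrite mulnC exprM chi_pow_p // expr1n.
Qed.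

Lemma frob_traceE F : Fhat_union d F ->
  frob_trace p chi F = - (chi F`_D + \sum_x chi F.[x]).
Proof.
by move=> FS; rewrite /frob_trace big_option proj_value_infinity.
Qed.

Lemma frob_trace_affine F (a b : Fq) : a != 0 -> Fhat_union d F ->
  frob_trace p chi (F \Po (a *: 'X + b%:P)) = frob_trace p chi F.
Proof.
move=> a0 FS; have FS' := Fhat_union_affine b a0 FS.
rewrite !frob_traceE //; congr (- (_ + _)).
  suff -> : (F \Po (a *: 'X + b%:P))`_D = a ^+ D * F`_D.
    by rewrite chiM chi_powD // mul1r.
  have sD := Fhat_union_size FS; rewrite coef_comp_poly.
  have [sF|sF] := leqP (size F) D.
    rewrite (nth_default _ sF) mulr0 big1 // => i _.
    rewrite [X in _ * X]nth_default ?mulr0 //.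
    apply: leq_trans (size_poly_exp_leq _ _) _.
    apply: (@leq_trans i.+1); last by apply: leq_trans sF.
    rewrite ltnS -[X in (_ <= X)%N]mul1n leq_mul2r; apply/orP; right.
    rewrite -subn1 leq_subLR (leq_trans (size_polyD _ _)) // geq_max.
    rewrite (leq_trans (size_scale_leq _ _)) ?size_polyX //.
    by rewrite (leq_trans (size_polyC_leq1 _)).
  have sE : size F = D.+1 by apply/eqP; rewrite eqn_leq sD sF.
  rewrite sE big_ord_recr /= big1 ?add0r; last first.
    move=> i _; rewrite [X in _ * X]nth_default ?mulr0 //.
    apply: leq_trans (size_poly_exp_leq _ _) _.
    apply: (@leq_trans i.+1); last by [].
    rewrite ltnS -[X in (_ <= X)%N]mul1n leq_mul2r; apply/orP; right.
    rewrite -subn1 leq_subLR (leq_trans (size_polyD _ _)) // geq_max.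
    rewrite (leq_trans (size_scale_leq _ _)) ?size_polyX //.
    by rewrite (leq_trans (size_polyC_leq1 _)).
  have sL : size (a *: 'X + b%:P) = 2%N.
    rewrite size_polyDl ?size_scale ?size_polyX //.
    by rewrite (leq_ltn_trans (size_polyC_leq1 _)).
  rewrite mulrC; congr (_ * _).
  have L0 : a *: 'X + b%:P != 0 by rewrite -size_poly_eq0 sL.
  have -> : D = (size ((a *: 'X + b%:P) ^+ D)).-1 by rewrite size_exp sL mul1n.
  rewrite size_exp sL mul1n -[LHS]/(_`_D).
  have := lead_coef_exp (a *: 'X + b%:P) D.
  rewrite !lead_coefE size_exp sL mul1n /= => ->; congr (_ ^+ _).
  by rewrite coefD coefZ coefX coefC addr0 mulr1.
have bij : bijective (fun x => a * x + b).
  exists (fun y => (y - b) / a) => x.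
    by rewrite addrK mulrC mulKf.
  by rewrite mulrC divfK // subrK.
rewrite [RHS](reindex _ (onW_bij _ bij)) /=; apply: eq_bigr => x _.
by rewrite horner_comp hornerD hornerZ hornerX hornerC.
Qed.

Lemma horner_rev_poly n F x : (size F <= n.+1)%N -> x != 0 ->
  (rev_poly n F).[x] = x ^+ n * F.[x^-1].
Proof.
move=> sF x0; rewrite (horner_coef_wide _ (size_rev_poly n F)).
rewrite (horner_coef_wide _ sF) mulr_sumr (reindex_inj rev_ord_inj) /=.
apply: eq_bigr => i _; rewrite coef_rev_poly subSS leq_subr subKn; last by rewrite -ltnS.
rewrite mulrCA; congr (_ * _).
by rewrite exprB ?exprVn ?unitfE // -ltnS.
Qed.

Lemma frob_trace_rev F : Fhat_union d F ->
  frob_trace p chi (rev_poly D F) = frob_trace p chi F.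
Proof.
move=> FS; have FS' := Fhat_union_rev FS; have sF := Fhat_union_size FS.
rewrite !frob_traceE // coef_rev_poly leqnn subnn; congr (- _).
rewrite (bigD1 0) //= [X in _ = _ + X](bigD1 0) //= addrCA; congr (_ + (_ + _)).
- by rewrite horner_coef0 coef_rev_poly subn0.
- by rewrite horner_coef0.
rewrite [RHS](reindex_inj invr_inj) /=.
apply: eq_big => [x|x x0]; first by rewrite invr_eq0.
by rewrite horner_rev_poly // chiM chi_powD // mul1r.
Qed.

End Trace.
End CoverFamily.

(** * Automorphisms of the rational function field *)

Section Mobius.
Variable Fq : finFieldType.
Implicit Types a b f g A B P : {poly Fq}.
Local Notation K := {fraction {poly Fq}}.

Lemma frac_coprime (x : K) : exists n d : {poly Fq},
  [/\ d != 0, coprimep n d & x = tofrac n / tofrac d].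
Proof.
have [n [d [d0 ->]]] : exists n d : {poly Fq}, d != 0 /\ x = tofrac n / tofrac d.
  elim/quotW: x => r; exists (frac r).1, (frac r).2; split; first exact: denom_ratioP.
  have d0 := denom_ratioP r.
  apply: (canRL (mulfK _)); first by rewrite tofrac_eq0.
  rewrite -[in LHS](Ratio_numden r); unlock FracField.tofrac.
  rewrite -[LHS]FracField.pi_mul; apply/eqmodP; rewrite /= FracField.equivfE.
  by rewrite /FracField.mulf !Ratio_numden !numden_Ratio ?mulf_neq0 ?oner_neq0 // !mulr1 mulrC.
have g0 : gcdp n d != 0 by rewrite gcdp_eq0 negb_and d0 orbT.
exists (n %/ gcdp n d), (d %/ gcdp n d); split.
- by rewrite dvdp_div_eq0 ?dvdp_gcdr.
- by rewrite coprimep_div_gcd // d0 orbT.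
rewrite -[in LHS](divpK (dvdp_gcdl n d)) -[in X in _ / X](divpK (dvdp_gcdr n d)).
by rewrite !rmorphM /= -mulf_div divff ?mulr1 // tofrac_eq0.
Qed.

(* b^m A(a/b) *)
Definition homp m A a b := \sum_(i < m.+1) A`_i *: (a ^+ i * b ^+ (m - i)).

Lemma tofrac_homp m A a b : b != 0 -> (size A <= m.+1)%N ->
  tofrac (homp m A a b) = tofrac b ^+ m * evalp (tofrac a / tofrac b) A.
Proof.
move=> b0 sA; rewrite (evalpE _ sA) rmorph_sum mulr_sumr /=; apply: eq_bigr => i _.
rewrite -mul_polyC !rmorphM !rmorphXn /= [RHS]mulrCA; congr (_ * _).
have tb0 : tofrac b != 0 by rewrite tofrac_eq0.
rewrite exprMn exprVn [RHS]mulrCA; congr (_ * _).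
by rewrite exprB ?unitfE // -ltnS.
Qed.

(** The coefficients in degrees [m] and [n] may be zero, so they are read as constant coefficients
    of reversals rather than as leading coefficients. *)
Lemma coef_topM m n f g : (size f <= m.+1)%N -> (size g <= n.+1)%N ->
  (f * g)`_(m + n) = f`_m * g`_n.
Proof.
move=> sf sg; have := congr1 (fun h : {poly Fq} => h`_0) (rev_polyM sf sg).
by rewrite coef0M !coef_rev_poly !subn0.
Qed.

Lemma size_expn_leqS m n f : (size f <= n.+1)%N -> (size (f ^+ m) <= (m * n).+1)%N.
Proof.
move=> sf; apply: leq_trans (size_poly_exp_leq _ _) _; rewrite ltnS mulnC leq_mul2l.
by apply/orP; right; case: (size f) sf.
Qed.

Lemma coef_topX m n f : (size f <= n.+1)%N -> (f ^+ m)`_(m * n) = f`_n ^+ m.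
Proof.
move=> sf; elim: m => [|m IH]; first by rewrite !expr0 coefC.
by rewrite !exprS mulSn coef_topM ?IH // size_expn_leqS.
Qed.

Lemma size_mul_leqS m n f g : (size f <= m.+1)%N -> (size g <= n.+1)%N ->
  (size (f * g)%R <= (m + n).+1)%N.
Proof.
move=> sf sg; apply: leq_trans (size_polyMleq _ _) _.
by move: sf sg; case: (size f) => [|u]; case: (size g) => [|v]; rewrite ?addnS ?addn0 ?add0n /= => *; lia.
Qed.

Lemma coef_homp_top m n A a b : (size a <= n.+1)%N -> (size b <= n.+1)%N ->
  (homp m A a b)`_(m * n) = \sum_(i < m.+1) A`_i * (a`_n ^+ i * b`_n ^+ (m - i)).
Proof.
move=> sa sb; rewrite /homp coef_sum; apply: eq_bigr => i _.
rewrite coefZ; congr (_ * _).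
rewrite -[in (m * n)%N](subnKC (_ : i <= m)%N) -1?ltnS // mulnDl.
by rewrite coef_topM ?coef_topX ?size_expn_leqS.
Qed.

Lemma size_homp m n A a b : (size a <= n.+1)%N -> (size b <= n.+1)%N ->
  (size (homp m A a b) <= (m * n).+1)%N.
Proof.
move=> sa sb; apply: leq_trans (size_sum _ _ _) _; apply/bigmax_leqP => i _.
apply: leq_trans (size_scale_leq _ _) _.
have im : (i <= m)%N by rewrite -ltnS.
rewrite -[in (m * n)%N](subnKC im) mulnDl.
by rewrite size_mul_leqS ?size_expn_leqS.
Qed.

(** Homogenizing a Bezout relation between [A] and [B] expresses a power of [b] by the two values,
    so a common prime [P] divides [b]. Modulo [b] only the top terms in [a ^+ m] survive, and [P]
    does not divide [a]; hence both top coefficients would vanish. *)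
Lemma coprimep_homp m A B a b : b != 0 -> coprimep a b -> coprimep A B ->
  (size A <= m.+1)%N -> (size B <= m.+1)%N -> (A`_m != 0) || (B`_m != 0) ->
  coprimep (homp m A a b) (homp m B a b).
Proof.
move=> b0 cab cAB sA sB ABm; apply/contraT => nc.
have {nc} [P [irrP PA PB]] : exists P, [/\ irreducible_poly P,
    P %| homp m A a b & P %| homp m B a b].
  have [HA0|/not_coprimep_irreducible] := eqVneq (homp m A a b) 0; last exact.
  have [HB0|HB0] := eqVneq (homp m B a b) 0.
    exists 'X; rewrite HA0 HB0 !dvdp0; split=> //.
    by rewrite -['X]subr0 -polyC0; apply: irredp_XsubC.
  have [P [irrP PB PA]] : exists P, [/\ irreducible_poly P,
    P %| homp m B a b & P %| homp m A a b].
    by apply: not_coprimep_irreducible => //; rewrite coprimep_sym.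
  by exists P.
have PnC c : P %| c%:P -> c = 0.
  move=> Pc; apply/eqP/contraT => c0; move: Pc.
  rewrite -[c%:P]alg_polyC dvdpZr // dvdp1 => /eqP sP; by case: irrP; rewrite sP.
have [[U V] /= UV] := Bezout_eq1_coprimepP _ _ cAB.
pose l := maxn (size U) (size V).
have sU : (size U <= l.+1)%N by rewrite leqW // leq_maxl.
have sV : (size V <= l.+1)%N by rewrite leqW // leq_maxr.
have Pb : P %| b.
  apply: (@irreducible_dvdX _ _ _ (l + m)) => //.
  have -> : b ^+ (l + m) = homp l U a b * homp m A a b + homp l V a b * homp m B a b.
    apply/eqP; rewrite -tofrac_eq; apply/eqP.
    rewrite rmorphD !rmorphM rmorphXn /= !tofrac_homp // mulrACA [X in _ + X]mulrACA.
    by rewrite -mulrDr -!evalpM -evalpD UV -polyC1 evalpC polyC1 rmorph1 mulr1 exprD.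
  by rewrite dvdp_add // dvdp_mull.
have top (C : {poly Fq}) : P %| homp m C a b -> C`_m = 0.
  rewrite /homp big_ord_recr /= subnn expr0 mulr1 dvdp_addr; last first.
    apply: (big_ind (fun x : {poly Fq} => P %| x)) => //.
      by move=> *; rewrite dvdp_add.
    move=> i _; rewrite -mul_polyC !dvdp_mull //.
    by rewrite (dvdp_trans Pb) // -(prednK (_ : 0 < m - i)%N) ?exprS ?dvdp_mulIl // subn_gt0.
  rewrite -mul_polyC => /(irreducible_dvdM irrP) /orP[/PnC //|/(irreducible_dvdX irrP) Pa].
  move: cab; rewrite coprimep_def => /size_poly1P [c c0 E].
  have : P %| gcdp a b by rewrite dvdp_gcd Pa Pb.
  by rewrite E => /PnC c0'; rewrite c0' eqxx in c0.
by move: ABm; rewrite (top _ PA) (top _ PB) eqxx.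
Qed.

(* The degree of A/B o a/b is the product of the degrees, so X = (A/B)(a/b) forces
   a/b to have degree one. *)
Lemma mobius_of_inverse a b A B : b != 0 -> coprimep a b -> coprimep A B ->
  tofrac 'X * evalp (tofrac a / tofrac b) B = evalp (tofrac a / tofrac b) A ->
  maxn (size a) (size b) = 2%N.
Proof.
move=> b0 cab cAB E.
pose m := (maxn (size A) (size B)).-1; pose n := (maxn (size a) (size b)).-1.
have AB0 : (A != 0) || (B != 0).
  by rewrite -negb_and; apply: contraL cAB => /andP[/eqP-> /eqP->]; rewrite /coprimep gcdp0 size_poly0.
have mE : maxn (size A) (size B) = m.+1.
  by rewrite prednK // leq_max !size_poly_gt0.
have nE : maxn (size a) (size b) = n.+1.
  by rewrite prednK // leq_max !size_poly_gt0 b0 orbT.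
have sA : (size A <= m.+1)%N by rewrite -mE leq_maxl.
have sB : (size B <= m.+1)%N by rewrite -mE leq_maxr.
have sa : (size a <= n.+1)%N by rewrite -nE leq_maxl.
have sb : (size b <= n.+1)%N by rewrite -nE leq_maxr.
have top (u v : {poly Fq}) k : maxn (size u) (size v) = k.+1 -> (u`_k != 0) || (v`_k != 0).
  move=> kE; have := leq_maxl (size u) (size v); have := leq_maxr (size u) (size v).
  rewrite kE => sv su; apply/contraT; rewrite negb_or !negbK => /andP[/eqP uk /eqP vk].
  have H (w : {poly Fq}) : (size w <= k.+1)%N -> w`_k = 0 -> (size w <= k)%N.
    move=> sw wk; apply/leq_sizeP => j; rewrite leq_eqVlt => /orP[/eqP <- //|kj].
    by rewrite nth_default // (leq_trans sw).
  have : (maxn (size u) (size v) <= k)%N by rewrite geq_max !H.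
  by rewrite kE ltnn.
have topAB := top _ _ _ mE; have topab := top _ _ _ nE.
have XHB : 'X * homp m B a b = homp m A a b.
  apply/eqP; rewrite -tofrac_eq; apply/eqP.
  by rewrite rmorphM /= !tofrac_homp // mulrCA E.
have cH := coprimep_homp b0 cab cAB sA sB topAB.
(* This value is coprime to its own product by ['X], hence constant; the value of [A] then has
   degree one. *)
have sHB : size (homp m B a b) = 1%N.
  move: cH; rewrite -XHB coprimep_def => /eqP sg.
  apply: etrans sg; apply: eqp_size; rewrite eqp_sym.
  exact: eqp_trans (gcdpC _ _) (gcdp_mull _ _).
have sHA : size (homp m A a b) = 2%N.
  by rewrite -XHB mulrC size_mulX -?size_poly_eq0 sHB.
(* If [m * n > 1], the coefficients of degree [m * n] of both values vanish. They are the values of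
   the forms [A] and [B] at the point with coordinates [a_n] and [b_n], which would be a common
   zero. *)
have mn : (m * n <= 1)%N.
  rewrite leqNgt; apply/negP => mn.
  have HA0 : (homp m A a b)`_(m * n) = 0 by rewrite nth_default // sHA.
  have HB0 : (homp m B a b)`_(m * n) = 0 by rewrite nth_default // sHB ltnW.
  move: HA0 HB0; rewrite !coef_homp_top //.
  have [bn0|bn0] := eqVneq b`_n 0.
    have an0 : a`_n != 0 by move: topab; rewrite bn0 eqxx orbF.
    have H (C : {poly Fq}) : \sum_(i < m.+1) C`_i * (a`_n ^+ i * b`_n ^+ (m - i)) = C`_m * a`_n ^+ m.
      rewrite big_ord_recr /= subnn expr0 mulr1 big1 ?add0r // => i _.
      by rewrite bn0 expr0n subn_eq0 leqNgt ltn_ord /= !mulr0.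
    rewrite !H => /eqP; rewrite mulf_eq0 expf_eq0 (negbTE an0) andbF orbF => /eqP A0.
    move=> /eqP; rewrite mulf_eq0 expf_eq0 (negbTE an0) andbF orbF => /eqP B0.
    by move: topAB; rewrite A0 B0 eqxx.
  have H (C : {poly Fq}) : (size C <= m.+1)%N ->
    \sum_(i < m.+1) C`_i * (a`_n ^+ i * b`_n ^+ (m - i)) = b`_n ^+ m * C.[a`_n / b`_n].
    move=> sC; rewrite (horner_coef_wide _ sC) mulr_sumr; apply: eq_bigr => i _.
    rewrite [RHS]mulrCA; congr (_ * _); rewrite exprMn exprVn [RHS]mulrCA; congr (_ * _).
    by rewrite exprB ?unitfE // -ltnS.
  rewrite !H // => /eqP; rewrite mulf_eq0 expf_eq0 (negbTE bn0) andbF /= => A0.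
  move=> /eqP; rewrite mulf_eq0 expf_eq0 (negbTE bn0) andbF /= => B0.
  by have := coprimep_root cAB A0; rewrite B0.
have m0 : (0 < m)%N.
  rewrite lt0n; apply/eqP => m0; move: sHA; rewrite /homp m0 big_ord1 expr0 mul1r subnn expr0.
  by rewrite alg_polyC => H; have := size_polyC_leq1 A`_0; rewrite H.
have n1 : (n <= 1)%N.
  by apply: leq_trans mn; rewrite leq_pmull.
rewrite nE; congr _.+1; apply/eqP; rewrite eqn_leq n1 /= lt0n; apply/eqP => n0.
have : (size (homp m A a b) <= 1)%N.
  have := size_homp m A sa sb; by rewrite n0 muln0.
by rewrite sHA.
Qed.

End Mobius.

Section FracAut.
Variable Fq : finFieldType.
Local Notation K := {fraction {poly Fq}}.

Definition frac_aut (s : K -> K) : Prop :=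
  [/\ bijective s, zmod_morphism s, monoid_morphism s &
      forall c : Fq, s (tofrac c%:P) = tofrac c%:P].

Section Aut.
Variables (s : K -> K) (sP : frac_aut s).

Definition frac_aut_rmorphism : {rmorphism K -> K} :=
  let: And4 _ sZ sM _ := sP in
  HB.pack s (GRing.isZmodMorphism.Build K K s sZ)
            (GRing.isMonoidMorphism.Build K K s sM).

Lemma frac_aut_rmorphismE : (frac_aut_rmorphism : K -> K) = s.
Proof. by rewrite /frac_aut_rmorphism; case: sP. Qed.

End Aut.

(** Replaces the map by a packaged ring morphism, so that the generic lemmas on morphisms apply. *)
Lemma frac_autP (s : K -> K) : frac_aut s -> exists2 t : {rmorphism K -> K},
  s = t & bijective t /\ forall c : Fq, t (tofrac c%:P) = tofrac c%:P.
Proof.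
move=> sP; exists (frac_aut_rmorphism sP); rewrite frac_aut_rmorphismE //.
by case: sP.
Qed.

Lemma frac_aut_evalp s f : frac_aut s -> s (tofrac f) = evalp (s (tofrac 'X)) f.
Proof.
move=> /frac_autP [t -> [_ tc]].
rewrite -[in LHS](comp_polyXr f) -evalp_tofrac !(evalpE _ (leqnn _)) rmorph_sum /=.
by apply: eq_bigr => i _; rewrite rmorphM rmorphXn tc.
Qed.

Lemma frac_aut_eq s s' : frac_aut s -> frac_aut s' ->
  s (tofrac 'X) = s' (tofrac 'X) -> s = s'.
Proof.
move=> sP s'P E; apply/funext => x.
have [n [d [d0 _ ->]]] := frac_coprime x.
have H f : s (tofrac f) = s' (tofrac f) by rewrite (frac_aut_evalp f sP) (frac_aut_evalp f s'P) E.
move: H; have [t -> _] := frac_autP sP; have [t' -> _] := frac_autP s'P => H.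
by rewrite !fmorph_div !H.
Qed.

Lemma frac_aut_comp s s' : frac_aut s -> frac_aut s' -> frac_aut (s \o s').
Proof.
move=> [bs Zs [s1 sM] cs] [bs' Zs' [s1' sM'] cs'].
split; first exact: bij_comp.
- by move=> x y /=; rewrite Zs' Zs.
- by split=> [|x y] /=; rewrite ?s1' ?sM'.
by move=> c /=; rewrite cs' cs.
Qed.

Lemma frac_aut_inv s : frac_aut s ->
  exists2 s', frac_aut s' & cancel s s' /\ cancel s' s.
Proof.
move=> [[s' sK s'K] Zs [s1 sM] cs]; exists s' => //; split; first by exists s.
- by move=> x y; apply: (can_inj sK); rewrite Zs !s'K.
- split; first by apply: (can_inj sK); rewrite s'K s1.
  by move=> x y; apply: (can_inj sK); rewrite sM !s'K.
by move=> c; apply: (can_inj sK); rewrite s'K cs.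
Qed.

Lemma frac_aut_mobius s : frac_aut s -> exists a b : {poly Fq},
  [/\ b != 0, coprimep a b, maxn (size a) (size b) = 2%N &
      s (tofrac 'X) = tofrac a / tofrac b].
Proof.
move=> sP; have [s' s'P [sK s'K]] := frac_aut_inv sP.
have [a [b [b0 cab E]]] := frac_coprime (s (tofrac 'X)).
have [A [B [B0 cAB E']]] := frac_coprime (s' (tofrac 'X)).
exists a, b; split=> //; apply: (mobius_of_inverse b0 cab cAB).
rewrite -E -!frac_aut_evalp //.
have : s (s' (tofrac 'X)) = tofrac 'X by rewrite s'K.
rewrite E'; have [t -> _] := frac_autP sP; rewrite fmorph_div.
by move=> <-; rewrite divfK // fmorph_eq0 tofrac_eq0.
Qed.

(** An automorphism is determined by the image of ['X], a quotient of two polynomials of degree at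
    most one. The value [id] of [g] is a default for pairs that come from no automorphism. *)
Lemma finite_frac_aut : finite_set [set s | frac_aut s].
Proof.
pose g (ab : {poly_2 Fq} * {poly_2 Fq}) : K -> K :=
  xget (@id K : K -> K) [set s : K -> K | frac_aut s /\
    s (tofrac 'X) = tofrac (ab.1 : {poly Fq}) / tofrac (ab.2 : {poly Fq})].
apply: (@sub_finite_set _ _ (g @` setT)); last exact/finite_image/finite_finset.
move=> s /= sP; have [a [b [b0 cab sab E]]] := frac_aut_mobius sP.
have sa : (size a <= 2)%N by rewrite -sab leq_maxl.
have sb : (size b <= 2)%N by rewrite -sab leq_maxr.
exists (npolyp 2 a, npolyp 2 b) => //; rewrite /g; case: xgetP => [s' _ /= [s'P E']|].
  by apply: frac_aut_eq => //; rewrite E E' !npolypK.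
by move/(_ s) => /=; rewrite !npolypK //; case.
Qed.

End FracAut.

(** * Action of Moebius substitutions on the family *)

Section MobiusModel.
Variables (Fq : finFieldType) (p : nat) (d : 'I_p.-1 -> nat).
Variables (R : realType) (chi : Fq -> R[i]).
Hypotheses (p_prime : prime p) (chiP : character_of_order p chi).
Hypothesis Dp : (p %| \sum_(i < p.-1) i.+1 * d i)%N.

Lemma poly_size2 (a : {poly Fq}) : (size a <= 2)%N -> a = a`_1 *: 'X + (a`_0)%:P.
Proof.
move=> sa; apply/polyP => k; rewrite coefD coefZ coefX coefC.
by case: k => [|[|k]]; rewrite /= ?mulr0 ?mulr1 ?addr0 ?add0r // nth_default // (leq_trans sa).
Qed.

(** A Moebius substitution is affine or a composite of an affine map, [1/X] and an affine map. The
    reversal introduces the factor [b ^ (- D)], which is a [p]-th power since [p] divides [D]. *)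
Lemma mobius_model (s : {fraction {poly Fq}} -> {fraction {poly Fq}}) F :
  frac_aut s -> Fhat_union d F ->
  exists u G, [/\ u != 0, Fhat_union d G, s (tofrac F) = u ^+ p * tofrac G &
    frob_trace p chi G = frob_trace p chi F].
Proof.
move=> sP FS; rewrite (frac_aut_evalp _ sP).
have [a [b [b0 cab sab ->]]] := frac_aut_mobius sP.
have sa : (size a <= 2)%N by rewrite -sab leq_maxl.
have sb : (size b <= 2)%N by rewrite -sab leq_maxr.
have [b1|b1] := eqVneq b`_1 0.
  have Eb : b = (b`_0)%:P by rewrite [LHS]poly_size2 // b1 scale0r add0r.
  have b00 : b`_0 != 0 by rewrite -polyC_eq0 -Eb.
  have a1 : a`_1 != 0.
    apply/eqP => a1; move: sab; rewrite Eb (poly_size2 sa) a1 scale0r add0r.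
    have := size_polyC_leq1 a`_0; have := size_polyC_leq1 b`_0.
    by case: (size _) => [|[|?]]; case: (size _) => [|[|?]].
  exists 1, (F \Po ((a`_1 / b`_0) *: 'X + (a`_0 / b`_0)%:P)).
  have ab0 : a`_1 / b`_0 != 0 by rewrite mulf_neq0 // invr_eq0.
  split; rewrite ?oner_eq0 ?expr1n ?mul1r //.
  - exact: Fhat_union_affine.
  - have -> : tofrac a / tofrac b = tofrac ((a`_1 / b`_0) *: 'X + (a`_0 / b`_0)%:P).
      apply: (canLR (mulfK _)); first by rewrite tofrac_eq0.
      rewrite -rmorphM; congr tofrac; rewrite [LHS](poly_size2 sa) {3}Eb mulrC mul_polyC.
      by rewrite scalerDr scalerA scale_polyC ![b`_0 * _]mulrC !divfK.
    by rewrite evalp_tofrac.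
  - exact: (frob_trace_affine p_prime chiP Dp).
(* These constants satisfy [a = al b + be], so that [a / b = be (1 / b) + al]. *)
pose al := a`_1 / b`_1; pose be := (a`_0 * b`_1 - a`_1 * b`_0) / b`_1.
have be0 : be != 0.
  rewrite mulf_neq0 ?invr_eq0 // subr_eq0; apply/eqP => E.
  have ba : b %| a.
    rewrite -(@dvdpZr _ b`_1) //; apply/dvdpP; exists (a`_1)%:P.
    rewrite mul_polyC [in LHS](poly_size2 sa) [X in _ = _ *: X](poly_size2 sb).
    rewrite !scalerDr !scalerA !scale_polyC [b`_1 * a`_1]mulrC; congr (_ + _%:P).
    by rewrite mulrC E.
  move: cab; rewrite /coprimep (eqp_size (dvdp_gcd_idr ba)) => /eqP sb1.
  by move: b1; rewrite nth_default ?eqxx // sb1.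
set F1 := F \Po (be *: 'X + al%:P).
have F1S : Fhat_union d F1 by exact: Fhat_union_affine.
set F2 := rev_poly (\sum_(i < p.-1) i.+1 * d i)%N F1.
have F2S : Fhat_union d F2 by exact: Fhat_union_rev.
have Eb := poly_size2 sb.
have tb0 : tofrac b != 0 by rewrite tofrac_eq0.
have [k Dk] := dvdnP Dp.
exists ((tofrac b)^-1 ^+ k), (F2 \Po (b`_1 *: 'X + (b`_0)%:P)); split.
- exact: expf_neq0 (invr_neq0 tb0).
- exact: Fhat_union_affine.
- have -> : tofrac a / tofrac b = evalp (tofrac b)^-1 (be *: 'X + al%:P).
    rewrite evalpD -mul_polyC evalpM !evalpC evalp_X.
    apply: (canLR (mulfK _)); first by rewrite tofrac_eq0.
    rewrite mulrDl mulfVK // -rmorphM -rmorphD; congr tofrac.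
    rewrite [LHS](poly_size2 sa) mul_polyC [X in _ = _ + _ *: X]Eb scalerDr scalerA scale_polyC.
    rewrite /al divfK // addrCA -polyCD; congr (_ + _%:P).
    by rewrite /be; field.
  rewrite -evalp_comp -/F1 -Eb -evalp_tofrac evalp_rev_poly //; last exact: Fhat_union_size.
  by rewrite Dk -exprM exprVn mulrA (mulVf (expf_neq0 _ tb0)) mul1r.
- rewrite (frob_trace_affine p_prime chiP Dp) // (frob_trace_rev p_prime chiP Dp) //.
  exact: (frob_trace_affine p_prime chiP Dp).
Qed.

(** Writing [u / u'] as a reduced fraction [n / m] gives [n ^+ p * F = m ^+ p * G]. Then [n ^+ p]
    divides [G] and [m ^+ p] divides [F], which are free of [p]-th powers, so [n] and [m] are
    constants. *)
Lemma model_unique (u u' : {fraction {poly Fq}}) F G : u != 0 -> u' != 0 ->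
  Fhat_union d F -> Fhat_union d G ->
  u ^+ p * tofrac F = u' ^+ p * tofrac G ->
  exists2 c : Fq, c != 0 & u = tofrac c%:P * u'.
Proof.
move=> u0 u'0 FS GS E.
have [n [m [m0 cnm E']]] := frac_coprime (u / u').
have p_gt0 := prime_gt0 p_prime.
have {}E : n ^+ p * F = m ^+ p * G.
  have tm0 : tofrac m != 0 by rewrite tofrac_eq0.
  apply/eqP; rewrite -tofrac_eq; apply/eqP; rewrite !rmorphM !rmorphXn /=.
  have -> : tofrac n = u / u' * tofrac m by rewrite E' divfK.
  rewrite exprMn mulrC mulrA -[u / u']mulrC exprMn mulrCA [tofrac F * _]mulrC E exprVn.
  by rewrite mulrA (mulVf (expf_neq0 _ u'0)) mul1r [RHS]mulrC.
have n0 : n != 0.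
  apply: contraNneq (Fhat_union_neq0 GS) => n0; move/eqP: E.
  by rewrite n0 expr0n gtn_eqF // mul0r eq_sym mulf_eq0 expf_eq0 (negbTE m0) andbF.
have /size_poly1P [c c0 nc] : size n == 1%N.
  apply/eqP; apply: (Fhat_union_power_free p_gt0 GS).
  rewrite -(@Gauss_dvdpr _ _ (m ^+ p)) -?E ?dvdp_mulIl //.
  by rewrite coprimep_expl // coprimep_expr.
have /size_poly1P [e e0 me] : size m == 1%N.
  apply/eqP; apply: (Fhat_union_power_free p_gt0 FS).
  rewrite -(@Gauss_dvdpr _ _ (n ^+ p)) ?E ?dvdp_mulIl //.
  by rewrite coprimep_expl // coprimep_expr // coprimep_sym.
exists (c / e); first by rewrite mulf_neq0 // invr_eq0.
rewrite -[LHS](divfK u'0) E' nc me; congr (_ * _).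
apply: (canLR (mulfK _)); first by rewrite tofrac_eq0 polyC_eq0.
by rewrite -rmorphM -polyCM /= divfK.
Qed.

End MobiusModel.

(** * Isomorphisms of cyclic covers *)

Section CoverIso.
Variables (Fq : finFieldType) (p : nat) (zeta : Fq).
Hypotheses (p_gt1 : (1 < p)%N) (zetaP : p.-primitive_root zeta).
Local Notation K := {fraction {poly Fq}}.
Local Notation KF F := (function_field p F).
Implicit Types F G : {poly Fq}.

Lemma size_cover_eq F : size (cover_eq p F) = p.+1.
Proof.
rewrite /cover_eq size_polyDl size_polyXn // size_polyN.
by rewrite (leq_ltn_trans (size_polyC_leq1 _)) // ltnS ltnW.
Qed.

Lemma monic_cover_eq F : cover_eq p F \is monic.
Proof.
rewrite monicE /cover_eq lead_coefDl ?lead_coefXn // size_polyXn size_polyN.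
by rewrite (leq_ltn_trans (size_polyC_leq1 _)) // ltnS ltnW.
Qed.

Lemma mk_monic_cover_eq F : mk_monic (cover_eq p F) = cover_eq p F.
Proof. by rewrite /mk_monic size_cover_eq ltnS (ltnW p_gt1) monic_cover_eq. Qed.

Lemma size_function_field F (h : KF F) : (size (h : {poly K}) <= p)%N.
Proof.
have E : size (mk_monic (cover_eq p F)) = p.+1 by rewrite mk_monic_cover_eq size_cover_eq.
by rewrite -ltnS -E; apply: size_mk_monic.
Qed.

Lemma in_qpoly_coverE F (h : {poly K}) : (size h <= p)%N ->
  in_qpoly (cover_eq p F) h = h :> {poly K}.
Proof. by move=> sh; rewrite in_qpoly_small // mk_monic_cover_eq size_cover_eq ltnS. Qed.

Lemma in_qpolyK F (h : KF F) : in_qpoly (cover_eq p F) (h : {poly K}) = h.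
Proof. by apply: val_inj; exact: in_qpoly_coverE (size_function_field h). Qed.

Lemma in_qpoly_cover_eq F : in_qpoly (cover_eq p F) (cover_eq p F) = 0.
Proof.
by apply: val_inj; rewrite /= mk_monic_cover_eq Pdiv.RingMonic.rmodpp // monic_cover_eq.
Qed.

Lemma in_qpoly_Xp F :
  in_qpoly (cover_eq p F) ('X ^+ p) = in_qpoly (cover_eq p F) (tofrac F)%:P.
Proof.
apply/eqP; rewrite -subr_eq0 -rmorphB; apply/eqP; exact: in_qpoly_cover_eq.
Qed.

Lemma function_field_sum F (h : KF F) :
  h = \sum_(k < p) in_qpoly (cover_eq p F) (h`_k)%:P * in_qpoly (cover_eq p F) 'X ^+ k.
Proof.
have sh := size_function_field h.
transitivity (in_qpoly (cover_eq p F) (\sum_(k < p) (h`_k)%:P * 'X^k)); last first.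
  by rewrite rmorph_sum; apply: eq_bigr => k _; rewrite rmorphM rmorphXn.
apply: etrans (esym (in_qpolyK h)) _; congr (in_qpoly _ _).
apply/polyP => j; rewrite coef_sum; have [jp|pj] := ltnP j p; last first.
  rewrite nth_default ?(leq_trans sh) // big1 // => i _.
  by rewrite coefCM coefXn gtn_eqF ?mulr0 // (leq_trans (ltn_ord i)).
rewrite (bigD1 (Ordinal jp)) //= coefCM coefXn eqxx mulr1 big1 ?addr0 // => i.
by rewrite -(inj_eq val_inj) /= coefCM coefXn eq_sym => /negbTE ->; rewrite mulr0.
Qed.

Lemma coef_deck F (h : KF F) k :
  (deck_transformation zeta h)`_k = h`_k * tofrac (zeta ^+ k)%:P.
Proof.
rewrite /deck_transformation in_qpoly_coverE; last first.
  apply: leq_trans (size_comp_poly_leq _ _) _.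
  have sz : (size (tofrac zeta%:P *: 'X : {poly K}) <= 2)%N.
    by rewrite (leq_trans (size_scale_leq _ _)) // size_polyX.
  have := size_function_field h.
  case: (size (h : {poly K})) => [_|m sm]; first by rewrite mul0n ltnW.
  apply: leq_trans sm; rewrite ltnS -[X in (_ <= X)%N]muln1 leq_mul2l.
  by case: (size _) sz => [|[|[|]]] //; rewrite orbT.
rewrite comp_polyE coef_sum.
have E i : ((h : {poly K})`_i *: (tofrac zeta%:P *: 'X) ^+ i)`_k =
    h`_i * tofrac (zeta ^+ i)%:P * (i == k)%:R.
  by rewrite exprZn !coefZ coefXn mulrA rmorphXn /= rmorphXn eq_sym.
under eq_bigr do rewrite E.
have [kh|kh] := ltnP k (size (h : {poly K})).
  rewrite (bigD1 (Ordinal kh)) //= eqxx mulr1 big1 ?addr0 // => i.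
  by rewrite -(inj_eq val_inj) /= => /negbTE ->; rewrite mulr0.
rewrite nth_default // mul0r big1 // => i _.
by rewrite ltn_eqF ?mulr0 // (leq_trans (ltn_ord i)).
Qed.

Lemma coef_mulC F (h : KF F) (c : K) k :
  (h * in_qpoly (cover_eq p F) c%:P)`_k = h`_k * c.
Proof.
have -> : h * in_qpoly (cover_eq p F) c%:P =
    in_qpoly (cover_eq p F) ((h : {poly K}) * c%:P) by rewrite rmorphM; congr (_ * _); apply/esym/in_qpolyK.
rewrite in_qpoly_coverE ?coefMC // mulrC mul_polyC (leq_trans (size_scale_leq _ _)) //.
exact: size_function_field.
Qed.

Lemma in_qpolyCB F (x y : K) : in_qpoly (cover_eq p F) (x - y)%:P =
    in_qpoly (cover_eq p F) x%:P - in_qpoly (cover_eq p F) y%:P.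
Proof. by rewrite polyCB; exact: (rmorphB (in_qpoly (cover_eq p F)) x%:P y%:P). Qed.

Lemma in_qpolyCM F (x y : K) : in_qpoly (cover_eq p F) (x * y)%:P =
    in_qpoly (cover_eq p F) x%:P * in_qpoly (cover_eq p F) y%:P.
Proof. by rewrite polyCM; exact: in_qpolyM. Qed.

(* Compatibility with the deck transformation: the eigenspaces of zeta^0 and zeta are
   K and K Y, so the map is determined by its values on K and at Y. *)
Lemma cover_morphP F G (phi : KF F -> KF G) :
  injective phi -> zmod_morphism phi -> monoid_morphism phi ->
  (forall c, phi (function_field_const p F c) = function_field_const p G c) ->
  (forall u, phi (deck_transformation zeta u) = deck_transformation zeta (phi u)) ->
  exists s u, [/\ zmod_morphism s, monoid_morphism s,
    (forall c : Fq, s (tofrac c%:P) = tofrac c%:P) /\ u != 0,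
    s (tofrac F) = u ^+ p * tofrac G &
    forall h k, (phi h)`_k = s h`_k * u ^+ k].
Proof.
move=> phi_inj phiZ phiM phiC phiD.
pose Phi : {rmorphism KF F -> KF G} :=
  HB.pack phi (GRing.isZmodMorphism.Build _ _ phi phiZ)
              (GRing.isMonoidMorphism.Build _ _ phi phiM).
have PhiE h : phi h = Phi h by [].
have zk k : (0 < k < p)%N -> zeta ^+ k != 1.
  move=> /andP[k0 kp]; rewrite -(prim_order_dvd zetaP).
  by apply/negP => /(dvdn_leq k0); rewrite leqNgt kp.
have zkK k : (0 < k < p)%N -> tofrac (zeta ^+ k)%:P - 1 != 0 :> K.
  by move=> /zk; rewrite subr_eq0 -[tofrac _]/(frac_const Fq _) fmorph_eq1.
pose s x := (phi (in_qpoly (cover_eq p F) x%:P))`_0.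
pose u := (phi (in_qpoly (cover_eq p F) 'X))`_1.
have sizeC H (x : K) : in_qpoly (cover_eq p H) x%:P = x%:P :> {poly K}.
  by apply: in_qpoly_coverE; rewrite (leq_trans (size_polyC_leq1 _)) // ltnW.
have c0 H (x : K) : (in_qpoly (cover_eq p H) x%:P)`_0 = x by rewrite sizeC coefC.
have sizeX H : in_qpoly (cover_eq p H) 'X = 'X :> {poly K}.
  by apply: in_qpoly_coverE; rewrite size_polyX.
have extF (H : {poly Fq}) (x y : KF H) : (forall k, (k < p)%N -> x`_k = y`_k) -> x = y.
  move=> E; apply: val_inj; apply/polyP => k; have [kp|pk] := ltnP k p; first exact: E.
  by rewrite !nth_default //; apply: leq_trans (size_function_field _) pk.
(* The deck transformation fixes constants, so the image of a constant has no coefficient in degrees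
   [0 < k < p], where [zeta ^+ k] differs from 1. *)
have phi_const x : phi (in_qpoly (cover_eq p F) x%:P) = in_qpoly (cover_eq p G) (s x)%:P.
  apply: (extF _) => -[|k] kp; rewrite sizeC coefC //=.
  have : phi (deck_transformation zeta (in_qpoly (cover_eq p F) x%:P)) =
         phi (in_qpoly (cover_eq p F) x%:P).
    congr phi; apply: (extF _) => -[|j] jp; rewrite coef_deck sizeC coefC /= ?mul0r //.
    by rewrite expr0 rmorph1 mulr1.
  rewrite phiD => /(congr1 (fun h : KF G => h`_k.+1)); rewrite coef_deck => /eqP.
  rewrite -[X in _ == X]mulr1 -subr_eq0 -mulrBr mulf_eq0 => /orP[/eqP //|].
  by rewrite (negbTE (zkK _ _)).
(* [Y] is an eigenvector for [zeta], hence so is its image; among the exponents [k < p] only [k = 1]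
   satisfies [zeta ^+ k = zeta]. *)
have phi_X : phi (in_qpoly (cover_eq p F) 'X) = in_qpoly (cover_eq p G) (u *: 'X).
  have E : deck_transformation zeta (in_qpoly (cover_eq p F) 'X) =
      in_qpoly (cover_eq p F) 'X * function_field_const p F zeta.
    rewrite /function_field_const -rmorphM; apply: (extF _) => k kp.
    rewrite coef_deck sizeX in_qpoly_coverE; last first.
      by rewrite mulrC mul_polyC (leq_trans (size_scale_leq _ _)) // size_polyX.
    rewrite coefMC coefX; case: eqP => [->|]; first by rewrite expr1.
    by rewrite !mul0r.
  have : phi (deck_transformation zeta (in_qpoly (cover_eq p F) 'X)) =
     phi (in_qpoly (cover_eq p F) 'X) * function_field_const p G zeta.
    by rewrite E PhiE rmorphM; congr (_ * _); apply: phiC.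
  rewrite phiD => E'; apply: (extF _) => k kp.
  rewrite in_qpoly_coverE; last first.
    by rewrite (leq_trans (size_scale_leq _ _)) // size_polyX.
  rewrite coefZ coefX; case: eqP => [->|/eqP k1]; first by rewrite mulr1.
  rewrite mulr0; move: E' => /(congr1 (fun h : KF G => h`_k)).
  rewrite coef_deck coef_mulC => /eqP; rewrite -subr_eq0 -mulrBr mulf_eq0 => /orP[/eqP //|].
  rewrite subr_eq0 tofrac_eq (inj_eq (@polyC_inj _)).
  case: k k1 kp => [|k] k1 kp.
    rewrite expr0 eq_sym => /eqP z1; have := zk 1%N; rewrite expr1 z1 eqxx => /(_ _).
    by rewrite p_gt1 => /(_ isT).
  rewrite exprS -[X in _ == X]mulr1 -subr_eq0 -mulrBr mulf_eq0 => /orP[|].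
    move=> /eqP z0; have := prim_expr_order zetaP.
    by rewrite z0 expr0n gtn_eqF ?(ltnW p_gt1) // => /eqP; rewrite eq_sym oner_eq0.
  by rewrite subr_eq0 (negbTE (zk _ _)) // lt0n; case: k k1 kp => [|k] // _ /ltnW.
have PhiC x : Phi (in_qpoly (cover_eq p F) x%:P) = in_qpoly (cover_eq p G) (s x)%:P.
  exact: phi_const.
have PhiX : Phi (in_qpoly (cover_eq p F) 'X) = in_qpoly (cover_eq p G) (u *: 'X).
  exact: phi_X.
clearbody Phi s u.
have sE x : in_qpoly (cover_eq p G) (s x)%:P = Phi (in_qpoly (cover_eq p F) x%:P).
  by rewrite PhiC.
have sinj x y : in_qpoly (cover_eq p G) x%:P = in_qpoly (cover_eq p G) y%:P -> x = y.
  move=> E; exact: etrans (esym (c0 G x)) (etrans (congr1 (fun h : KF G => h`_0) E) (c0 G y)).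
have s0 : s 0 = 0.
  apply: etrans (esym (c0 G (s 0))) _; rewrite sE.
  have -> : in_qpoly (cover_eq p F) 0%:P = 0 by rewrite polyC0; apply: in_qpoly0.
  by rewrite rmorph0 coef0.
have phi_coef h k : (phi h)`_k = s h`_k * u ^+ k.
  set g : {poly K} := \sum_(i < p) (s h`_i * u ^+ i) *: 'X^i.
  have -> : phi h = in_qpoly (cover_eq p G) g.
    rewrite {1}(function_field_sum h) PhiE (rmorph_sum Phi) [RHS]rmorph_sum; apply: eq_bigr => i _.
    by rewrite rmorphM rmorphXn PhiC PhiX -rmorphXn -rmorphM exprZn mul_polyC scalerA.
  have sg : (size g <= p)%N.
    apply: leq_trans (size_sum _ _ _) _; apply/bigmax_leqP => i _.
    by rewrite (leq_trans (size_scale_leq _ _)) // size_polyXn.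
  apply: etrans (congr1 (fun q : {poly K} => q`_k) (in_qpoly_coverE G sg)) _; rewrite /g.
  rewrite coef_sum; have [kp|pk] := ltnP k p; last first.
    rewrite big1 => [|i _]; last first.
      by rewrite coefZ coefXn gtn_eqF ?mulr0 // (leq_trans (ltn_ord i)).
    rewrite nth_default ?(leq_trans (size_function_field _)) //.
    by rewrite s0 mul0r.
  rewrite (bigD1 (Ordinal kp)) //= coefZ coefXn eqxx mulr1 big1 ?addr0 // => i.
  by rewrite -(inj_eq val_inj) /= coefZ coefXn eq_sym => /negbTE ->; rewrite mulr0.
exists s, u; split.
- move=> x y; apply: (sinj _); apply: etrans (sE _) _.
  exact: etrans (congr1 Phi (in_qpolyCB F x y)) (etrans (rmorphB Phi _ _)
    (etrans (congr2 (fun a b => a - b) (PhiC x) (PhiC y)) (esym (in_qpolyCB G _ _)))).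
- split=> [|x y]; apply: (sinj _); apply: etrans (sE _) _.
    exact: etrans (congr1 Phi (in_qpoly1 _)) (etrans (rmorph1 Phi) (esym (in_qpoly1 _))).
  exact: etrans (congr1 Phi (in_qpolyCM F x y)) (etrans (rmorphM Phi _ _)
    (etrans (congr2 (fun a b => a * b) (PhiC x) (PhiC y)) (esym (in_qpolyCM G _ _)))).
- split=> [c|].
    by apply: (sinj _); apply: etrans (esym (phi_const _)) (phiC c).
  apply/eqP => u0; have : phi (in_qpoly (cover_eq p F) 'X) = phi 0.
    rewrite phi_X u0 scale0r PhiE; exact: etrans (in_qpoly0 _) (esym (rmorph0 Phi)).
  move=> /phi_inj E; have := etrans (esym (congr1 (fun q : {poly K} => q`_1) (sizeX F)))
    (congr1 (fun h : KF F => h`_1) E).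
  by rewrite coefX coef0 => /eqP; rewrite oner_eq0.
- apply: (sinj _); apply: etrans (sE _) _.
  apply: etrans (congr1 Phi (esym (in_qpoly_Xp F))) _.
  apply: etrans (congr1 Phi (rmorphXn (in_qpoly (cover_eq p F)) p 'X)) _.
  apply: etrans (rmorphXn Phi p _) _.
  apply: etrans (congr1 (fun h : KF G => h ^+ p) PhiX) _.
  apply: etrans (esym (rmorphXn (in_qpoly (cover_eq p G)) p _)) _.
  rewrite exprZn -mul_polyC; apply: etrans (in_qpolyM (cover_eq p G) _ _) _.
  apply: etrans _ (esym (in_qpolyCM G _ _)); congr (_ * _); exact: in_qpoly_Xp.
- exact: phi_coef.
Qed.

(** What [cover_morphP] leaves open is that [s] is onto. Applied to the inverse isomorphism it
    yields a map [t], and comparing coefficients of degree 0 shows that [s] and [t] are inverse to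
    each other. *)
Lemma cover_isoP F G (phi : KF F -> KF G) : is_cover_iso zeta phi ->
  exists s u, [/\ frac_aut s, u != 0, s (tofrac F) = u ^+ p * tofrac G &
    forall h k, (phi h)`_k = s h`_k * u ^+ k].
Proof.
move=> [[psi phiK psiK] phiZ [phi1 phiM] phiC phiD].
have phi_inj := can_inj phiK; have psi_inj := can_inj psiK.
have [s [u [sZ sM [sC u0] sF sE]]] := cover_morphP phi_inj phiZ (conj phi1 phiM) phiC phiD.
have [||||t [v [tZ tM [tC v0] tG tE]]] := @cover_morphP G F psi psi_inj.
- move=> x y; apply: (phi_inj _); apply: etrans (psiK _) (esym (etrans (phiZ (psi x) (psi y)) _)).
  by congr (_ - _); apply: (psiK _).
- split; first by apply: (phi_inj _); exact: etrans (psiK _) (esym phi1).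
  move=> x y; apply: (phi_inj _); apply: etrans (psiK _) (esym (etrans (phiM (psi x) (psi y)) _)).
  by congr (_ * _); apply: (psiK _).
- by move=> c; apply: (phi_inj _); exact: etrans (psiK _) (esym (phiC c)).
- move=> x; apply: (phi_inj _); apply: etrans (psiK _) (esym (etrans (phiD (psi x)) _)).
  by congr deck_transformation; apply: (psiK _).
suff sbij : bijective s by exists s, u; split; [split|exact: u0|exact: sF|exact: sE].
have c0 (H : {poly Fq}) (x : K) : (in_qpoly (cover_eq p H) x%:P)`_0 = x.
  by rewrite in_qpoly_coverE ?coefC // (leq_trans (size_polyC_leq1 _)) // ltnW.
have sE0 h : (phi h)`_0 = s h`_0 by have := sE h 0; rewrite expr0 mulr1.
have tE0 h : (psi h)`_0 = t h`_0 by have := tE h 0; rewrite expr0 mulr1.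
exists t => x.
  apply: etrans (congr1 (fun y => t (s y)) (esym (c0 F x))) _.
  apply: etrans (congr1 t (esym (sE0 _))) _; apply: etrans (esym (tE0 _)) _.
  exact: etrans (congr1 (fun h : KF F => h`_0) (phiK _)) (c0 F x).
apply: etrans (congr1 (fun y => s (t y)) (esym (c0 G x))) _.
apply: etrans (congr1 s (esym (tE0 _))) _; apply: etrans (esym (sE0 _)) _.
exact: etrans (congr1 (fun h : KF G => h`_0) (psiK _)) (c0 G x).
Qed.

End CoverIso.

(** * Isomorphisms built from a substitution and a scaling *)

Section IsoOfCode.
Variables (Fq : finFieldType) (p : nat) (zeta : Fq).
Hypotheses (p_gt1 : (1 < p)%N).
Local Notation K := {fraction {poly Fq}}.
Local Notation KF F := (function_field p F).
Implicit Types F G : {poly Fq}.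

Lemma function_field_eq F (x y : KF F) : (forall k, x`_k = y`_k) -> x = y.
Proof. by move=> E; apply: val_inj; apply/polyP => k; exact: E. Qed.

Lemma coef_functionB F (x y : KF F) k : (x - y)`_k = x`_k - y`_k.
Proof. by have -> : (x - y : {poly K}) = (x : {poly K}) - (y : {poly K}) by []; rewrite coefB. Qed.

Lemma in_qpoly_mod F (h : {poly K}) : exists q : {poly K},
  h = q * cover_eq p F + (in_qpoly (cover_eq p F) h : {poly K}).
Proof.
exists (Pdiv.Ring.rdivp h (cover_eq p F)).
have := Pdiv.RingMonic.rdivp_eq (monic_cover_eq p_gt1 F) h.
by rewrite /in_qpoly /= mk_monic_cover_eq.
Qed.

Section Twist.
Variables (t : {rmorphism K -> K}) (u : K).

Definition twist (h : {poly K}) : {poly K} := map_poly t h \Po (u *: 'X).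

Lemma twistB x y : twist (x - y) = twist x - twist y.
Proof. by rewrite /twist rmorphB comp_polyB. Qed.

Lemma twistD x y : twist (x + y) = twist x + twist y.
Proof. by rewrite /twist rmorphD comp_polyD. Qed.

Lemma twistM x y : twist (x * y) = twist x * twist y.
Proof. by rewrite /twist rmorphM comp_polyM. Qed.

Lemma twistC c : twist c%:P = (t c)%:P.
Proof. by rewrite /twist map_polyC comp_polyC. Qed.

Lemma coef_twist h k : (twist h)`_k = t h`_k * u ^+ k.
Proof.
rewrite /twist comp_polyE coef_sum size_map_poly.
have E i : ((map_poly t h)`_i *: (u *: 'X) ^+ i)`_k = t h`_i * u ^+ i * (i == k)%:R.
  by rewrite coef_map exprZn !coefZ coefXn mulrA eq_sym.
under eq_bigr do rewrite E.
have [kh|kh] := ltnP k (size h).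
  rewrite (bigD1 (Ordinal kh)) //= eqxx mulr1 big1 ?addr0 // => i.
  by rewrite -(inj_eq val_inj) /= => /negbTE ->; rewrite mulr0.
rewrite nth_default // rmorph0 mul0r big1 // => i _.
by rewrite ltn_eqF ?mulr0 // (leq_trans (ltn_ord i)).
Qed.

Lemma size_twist h : (size (twist h) <= size h)%N.
Proof.
by apply/leq_sizeP => k hk; rewrite coef_twist nth_default // rmorph0 mul0r.
Qed.

Lemma twist_cover_eq F G : t (tofrac F) = u ^+ p * tofrac G ->
  twist (cover_eq p F) = (u ^+ p)%:P * cover_eq p G.
Proof.
move=> tF; rewrite /cover_eq twistB twistC tF mulrBr polyCM; congr (_ - _).
by rewrite /twist map_polyXn comp_Xn_poly exprZn mul_polyC.
Qed.

(** The lift [twist] sends the equation of the first curve to the multiple by [u ^+ p] of the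
    equation of the second, so it descends to the quotients. *)
Lemma twist_mod F G h : t (tofrac F) = u ^+ p * tofrac G ->
  in_qpoly (cover_eq p G) (twist (in_qpoly (cover_eq p F) h : {poly K})) =
  in_qpoly (cover_eq p G) (twist h).
Proof.
move=> tF; have [q Eq] := in_qpoly_mod F h.
rewrite [in RHS]Eq twistD twistM (twist_cover_eq tF) mulrA.
apply: etrans _ (esym (in_qpolyD (cover_eq p G) _ _)).
apply: etrans (esym (add0r _)) _; congr (_ + _).
apply/esym; apply: etrans (in_qpolyM (cover_eq p G) _ _) _.
by rewrite (in_qpoly_cover_eq p_gt1) mulr0.
Qed.

End Twist.

Definition cover_map F G (t : {rmorphism K -> K}) (u : K) (h : KF F) : KF G :=
  in_qpoly (cover_eq p G) (twist t u h).

Lemma coef_cover_map F G t u (h : KF F) k :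
  (cover_map G t u h)`_k = t h`_k * u ^+ k.
Proof.
have sh : (size (twist t u h) <= p)%N.
  exact: leq_trans (size_twist _ _ _) (size_function_field p_gt1 _).
apply: etrans (congr1 (fun q : {poly K} => q`_k) (in_qpoly_coverE p_gt1 G sh)) _.
exact: coef_twist.
Qed.

Lemma cover_map_iso F G (s : K -> K) (u : K) : frac_aut s -> u != 0 ->
  s (tofrac F) = u ^+ p * tofrac G ->
  exists2 phi : KF F -> KF G, is_cover_iso zeta phi &
    forall h k, (phi h)`_k = s h`_k * u ^+ k.
Proof.
move=> sP u0 sF.
have [s' s'P [sK s'K]] := frac_aut_inv sP.
move: sF sK s'K; have [t -> [tbij tC]] := frac_autP sP => sF sK s'K.
move: sK s'K; have [t' -> [t'bij t'C]] := frac_autP s'P => sK s'K.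
exists (@cover_map F G t u); last exact: coef_cover_map.
split.
- have tu0 : t' u != 0 by rewrite fmorph_eq0.
  have tvu : t (t' u)^-1 = u^-1 by rewrite fmorphV s'K.
  (* From [Y |-> u Y] the inverse must send [Y] to [(t' u)^-1 Y], where [t'] is the inverse
     substitution. *)
  exists (@cover_map G F t' (t' u)^-1) => h; apply: function_field_eq => k.
    apply: etrans (coef_cover_map _ _ _ _ _) _; rewrite coef_cover_map rmorphM rmorphXn sK.
    by rewrite exprVn; exact: mulfK (expf_neq0 k tu0) _.
  apply: etrans (coef_cover_map _ _ _ _ _) _; rewrite coef_cover_map rmorphM rmorphXn s'K.
  rewrite tvu exprVn; exact: mulfVK (expf_neq0 k u0) _.
- move=> x y; apply: function_field_eq => k.
  apply: etrans (coef_cover_map _ _ _ _ _) _.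
  apply: etrans _ (esym (coef_functionB _ _ _)).
  apply: etrans _ (esym (congr2 (fun a b : K => a - b)
    (coef_cover_map G t u x k) (coef_cover_map G t u y k))).
  apply: etrans _ (mulrBl _ _ _); congr (_ * _).
  by apply: etrans _ (rmorphB t _ _); congr (t _); apply: coef_functionB.
- split.
    rewrite /cover_map; have -> : ((1 : KF F) : {poly K}) = 1%:P by [].
    apply: etrans (congr1 (in_qpoly _) (twistC t u 1)) _.
    by apply: etrans _ (in_qpoly1 (cover_eq p G)); rewrite (rmorph1 t) polyC1.
  move=> x y; rewrite /cover_map.
  have E : x * y = in_qpoly (cover_eq p F) ((x : {poly K}) * (y : {poly K})).
    apply: etrans _ (esym (in_qpolyM (cover_eq p F) _ _)).
    by congr (_ * _); apply/esym/(in_qpolyK p_gt1).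
  apply: etrans (congr1 (fun z : KF F => in_qpoly (cover_eq p G) (twist t u z)) E) _.
  apply: etrans (twist_mod _ sF) _; apply: etrans (congr1 (in_qpoly _) (twistM _ _ _ _)) _.
  exact: in_qpolyM.
- move=> c; apply: etrans (twist_mod _ sF) _.
  by apply: etrans (congr1 (in_qpoly _) (twistC t u _)) _; rewrite tC.
- move=> h; apply: function_field_eq => k.
  apply: etrans (coef_cover_map _ _ _ _ _) _.
  apply: etrans _ (esym (coef_deck zeta p_gt1 _ _)).
  apply: etrans _ (esym (congr1 (fun a : K => a * tofrac (zeta ^+ k)%:P) (coef_cover_map G t u h k))).
  apply: etrans (congr1 (fun a : K => t a * u ^+ k) (coef_deck zeta p_gt1 h k)) _.
  by rewrite rmorphM tC mulrAC.
Qed.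

End IsoOfCode.

(** * The mean over the moduli space *)

Section ModuliMean.
Variables (Fq : finFieldType) (p : nat) (zeta : Fq) (d : 'I_p.-1 -> nat).
Variables (R : realType) (chi : Fq -> R[i]).
Hypotheses (p_prime : prime p) (zetaP : p.-primitive_root zeta).
Hypothesis chiP : character_of_order p chi.
Hypothesis Dp : (p %| \sum_(i < p.-1) i.+1 * d i)%N.
Local Notation K := {fraction {poly Fq}}.
Implicit Types F G : {poly Fq}.

Let p_gt1 : (1 < p)%N. Proof. exact: prime_gt1. Qed.

(* An isomorphism from the cover F to the cover G is given by its action s on K and
   by u with Y mapped to u Y. *)
Definition codes F G : set ((K -> K) * K) :=
  [set su | [/\ frac_aut su.1, su.2 != 0 & su.1 (tofrac F) = su.2 ^+ p * tofrac G]]%classic.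

Lemma frac_aut_id : frac_aut (@id K).
Proof. by split=> //; exists id. Qed.

Lemma cover_isomorphicP F G : cover_isomorphic p zeta F G <-> (codes F G !=set0)%classic.
Proof.
split=> [[phi /(cover_isoP p_gt1 zetaP) [s [u [sP u0 sF _]]]] | [[s u] /= [sP u0 sF]]].
  by exists (s, u).
by have [phi phiP _] := cover_map_iso zeta p_gt1 sP u0 sF; exists phi.
Qed.

Lemma codes_refl F : codes F F (id, 1).
Proof. by split; [exact: frac_aut_id|exact: oner_neq0|rewrite expr1n mul1r]. Qed.

Lemma codes_comp F G H a b : codes F G a -> codes G H b ->
  codes F H (b.1 \o a.1, b.1 a.2 * b.2).
Proof.
case: a b => [s u] [t v] [sP u0 sF] [tP v0 tG].
rewrite /= in sP u0 sF tP v0 tG *; have [t' Et _] := frac_autP tP.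
split; first exact: frac_aut_comp tP sP.
  apply: mulf_neq0 v0; rewrite Et fmorph_eq0; exact: u0.
rewrite /= sF; move: tG; rewrite Et => tG.
rewrite rmorphM rmorphXn tG exprMn; exact: mulrA.
Qed.

Lemma codes_inv F G a : codes F G a -> exists2 t, frac_aut t &
  (cancel a.1 t /\ cancel t a.1) /\ codes G F (t, t (a.2)^-1).
Proof.
case: a => [s u] /= [sP u0 sF]; have [t tP [sK tK]] := frac_aut_inv sP.
exists t; first exact: tP.
split; first by split.
have [t' Et _] := frac_autP tP.
split; first exact: tP.
  rewrite /= Et fmorph_eq0; exact: invr_neq0.
rewrite /= -[in LHS](mul1r (tofrac G)) -(mulVf (expf_neq0 p u0)) -mulrA -sF.
rewrite Et rmorphM -Et sK Et -exprVn rmorphXn; by [].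
Qed.

Let S := [set F : {poly Fq} | Fhat_union d F]%classic.
Let A := fset_set [set s : K -> K | frac_aut s]%classic.

Lemma finite_Fhat_union : finite_set S.
Proof.
set D := (\sum_(i < p.-1) i.+1 * d i)%N.
apply: (@sub_finite_set _ _ ((fun f : {poly_D.+1 Fq} => (f : {poly Fq})) @` setT)%classic).
  move=> F FS; exists (npolyp D.+1 F) => //=; rewrite npolypK //.
  exact: Fhat_union_size.
exact/finite_image/finite_finset.
Qed.

(** Indexes all isomorphisms from the curve of a given [F] to models in the family: a substitution,
    together with the constant by which the scaling of [Y] can still vary. Its size does not depend
    on [F]. *)
Let B : {fset (K -> K) * Fq} :=
  [fset x in (A `*` [fset c in Fq])%fset | x.2 != 0]%fset.

Lemma mem_B x : (x \in B) = ((x.1 \in A) && (x.2 != 0)).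
Proof. by rewrite !inE andbT. Qed.

Lemma mem_A s : reflect (frac_aut s) (s \in A).
Proof.
rewrite in_fset_set; last exact: finite_frac_aut.
by apply: (iffP idP); rewrite inE.
Qed.

Lemma frob_traceZ F (c : Fq) : c != 0 -> Fhat_union d F ->
  frob_trace p chi (c ^+ p *: F) = frob_trace p chi F.
Proof.
move=> c0 FS; have cp0 : c ^+ p != 0 by rewrite expf_neq0.
rewrite !(frob_traceE chi p_prime Dp) //; last exact: Fhat_unionZ.
have chiM x : chi (c ^+ p * x) = chi x.
  by case: (chiP) => _ _ cM _; rewrite cM (chiX chiP) (chi_pow_p chiP) ?mul1r.
rewrite coefZ chiM; congr (- (_ + _)); apply: eq_bigr => x _.
by rewrite hornerZ chiM.
Qed.

Lemma tofracXZ (c : Fq) n G : tofrac (c ^+ n *: G) = tofrac c%:P ^+ n * tofrac G.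
Proof. by rewrite -mul_polyC polyC_exp rmorphM rmorphXn. Qed.

(** [mobius_model] attaches to a substitution [s] one scaling [u] and one target [G0]. By
    [model_unique] the other scalings for [s] are [c u] with [c] a nonzero constant, with target
    [c ^ (- p) G0]; this target is [T (s, c)]. Thus [B] enumerates the codes from [F], sorted by
    their targets. *)
Lemma card_codes_sum F : Fhat_union d F -> exists (T : (K -> K) * Fq -> {poly Fq}),
  (forall G, Fhat_union d G -> finite_set (codes F G) /\
    #|` fset_set (codes F G)| = #|` [fset x in B | T x == G]%fset|) /\
  (forall x, x \in B -> Fhat_union d (T x) /\ frob_trace p chi (T x) = frob_trace p chi F).
Proof.
move=> FS.
have /choice [b bP] : forall s : K -> K, exists uG : K * {poly Fq}, frac_aut s ->
    [/\ uG.1 != 0, Fhat_union d uG.2, s (tofrac F) = uG.1 ^+ p * tofrac uG.2 &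
      frob_trace p chi uG.2 = frob_trace p chi F].
  move=> s; have [sP|sP] := pselect (frac_aut s); last by exists (0, 0).
  by have [u [G H]] := mobius_model p_prime chiP Dp sP FS; exists (u, G).
pose T (x : (K -> K) * Fq) := x.2^-1 ^+ p *: (b x.1).2.
pose Th (x : (K -> K) * Fq) := (x.1, tofrac (x.2)%:P * (b x.1).1).
exists T; split; last first.
  move=> x; rewrite mem_B => /andP[/mem_A xA x0]; have [u0 GS sF tr] := bP _ xA.
  have c0 : (x.2)^-1 != 0 by rewrite invr_eq0.
  split; first by apply: Fhat_unionZ; rewrite ?expf_neq0.
  by rewrite /T frob_traceZ.
move=> G GS.
have codesE : codes F G = [set Th x | x in [set` [fset x in B | T x == G]%fset]]%classic.
  apply/seteqP; split=> [[s v] [sP v0 sF]|_ [x + <-]].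
    rewrite /= in sP v0 sF.
    have [u0 G0S sF0 _] := bP _ sP.
    have E : v ^+ p * tofrac G = (b s).1 ^+ p * tofrac (b s).2 by rewrite -sF0 -sF.
    have [c c0 vE] := model_unique p_prime v0 u0 GS G0S E.
    exists (s, c); last by rewrite /Th /= vE.
    rewrite /= !inE /= andbT c0 andbT; apply/andP; split.
      exact/mem_A.
    rewrite /T /=; apply/eqP.
    have E' : tofrac (c ^+ p *: G) = tofrac (b s).2.
      apply: (mulfI (expf_neq0 p u0)); rewrite -E vE exprMn tofracXZ.
      by rewrite mulrCA mulrA.
    move: E' => /eqP; rewrite tofrac_eq => /eqP <-.
    by rewrite scalerA -exprMn mulVf // expr1n scale1r.
  rewrite /= => /imfsetP [y /=]; rewrite inE => /andP[yB /eqP Ty] ->.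
  move: yB; rewrite mem_B => /andP[/mem_A yA y0]; have [u0 G0S sF _] := bP _ yA.
  have c0 : tofrac (y.2)%:P != 0 by rewrite tofrac_eq0 polyC_eq0.
  have cV : tofrac (y.2)%:P * tofrac (y.2^-1)%:P = 1 by rewrite -rmorphM -polyCM mulfV // polyC1 rmorph1.
  split; [exact: yA | exact: mulf_neq0 c0 u0 |].
  apply: etrans sF _; rewrite -Ty /T tofracXZ exprMn mulrACA -exprMn cV expr1n.
  by rewrite mul1r.
rewrite codesE; split; first exact/finite_image/finite_fset.
rewrite fset_set_image ?set_fsetK; last exact: finite_fset.
rewrite card_in_imfset /=; first by [].
have H z : z \in [fset x in B | T x == G]%fset -> z \in B.
  by move=> /imfsetP [y /=]; rewrite inE => /andP[yB _] ->.
move=> x y /H; rewrite mem_B => /andP[/mem_A xA x0] _ [].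
case: x y xA x0 => [s c] [s' c'] /= sP c0 <- /(mulIf _) E; congr (_, _).
have [u0 _ _ _] := bP _ sP.
by apply: polyC_inj; apply/eqP; rewrite -tofrac_eq; apply/eqP/E.
Qed.


Definition cover_class F := [set G | Fhat_union d G /\ cover_isomorphic p zeta F G]%classic.

Lemma cover_class_refl F : Fhat_union d F -> cover_class F F.
Proof. by move=> FS; split=> //; apply/cover_isomorphicP; exists (id, 1); apply: codes_refl. Qed.

Lemma cover_class_eq F G : cover_class F G -> cover_class F = cover_class G.
Proof.
move=> [GS /cover_isomorphicP [a aP]]; have [t _ [_ bP]] := codes_inv aP.
apply/seteqP; split=> H [HS /cover_isomorphicP [c cP]]; split=> //;
  apply/cover_isomorphicP.
  by eexists; apply: codes_comp bP cP.
by eexists; apply: codes_comp aP cP.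
Qed.

(** Following an automorphism of [F] by one fixed isomorphism to [G] gives each isomorphism exactly
    once. *)
Lemma card_codes_iso F G : cover_class F G -> (codes F G #= codes F F)%card.
Proof.
move=> [GS /cover_isomorphicP [a aP]]; have [t tP [[at_ ta] bP]] := codes_inv aP.
rewrite card_eq_sym.
pose g (c : (K -> K) * K) := (a.1 \o c.1, a.1 c.2 * a.2).
have [aA a0 _] := aP.
have -> : codes F G = [set g c | c in codes F F]%classic.
  apply/seteqP; split=> [c cP|_ [c cP <-]]; last exact: codes_comp cP aP.
  exists (t \o c.1, t c.2 * t (a.2)^-1); first exact: codes_comp cP bP.
  rewrite /g /= [RHS]surjective_pairing; congr (_, _).
    by apply/funext => x /=; rewrite ta.
  case: aA => _ _ [_ aM] _.
  apply: etrans (congr1 (fun y => y * a.2) (aM _ _)) _; rewrite !ta.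
  exact: mulfVK a0 _.
rewrite card_eq_sym; apply: inj_card_eq => c c' _ _ [E1 E2].
rewrite [c]surjective_pairing [c']surjective_pairing; congr (_, _).
  by apply/funext => x; rewrite -[LHS]at_ -[RHS]at_; congr t; exact: (congr1 (fun f => f x) E1).
by rewrite -[LHS]at_ -[RHS]at_; congr t; exact: (mulIf a0 E2).
Qed.

(** Orbit counting: both sides count the codes from [F] to all members of the family. Members
    outside the class contribute nothing, and those inside contribute equally. *)
Lemma card_cover_class F : Fhat_union d F ->
  (#|` fset_set (cover_class F)| * #|` fset_set (codes F F)| = #|` B|)%N.
Proof.
move=> FS; have [T [TG TB]] := card_codes_sum FS.
have finC : finite_set (cover_class F).
  by apply: sub_finite_set finite_Fhat_union => G [].
transitivity (\sum_(G <- fset_set S) #|` fset_set (codes F G)|)%N.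
  rewrite (card_fset_sum1 (fset_set (cover_class F))) big_distrl /=.
  under eq_bigr do rewrite mul1n.
  have E G : G \in fset_set S -> #|` fset_set (codes F G)| =
      (if G \in fset_set (cover_class F) then #|` fset_set (codes F F)| else 0)%N.
    rewrite in_fset_set ?inE; last exact: finite_Fhat_union.
    move=> GS; rewrite in_fset_set //.
    have [GC|GC] := pselect (cover_class F G); [rewrite mem_set //|rewrite memNset //].
      have [fG _] := TG _ GS; have [fF _] := TG _ FS.
      by apply/eqP; rewrite -(rwP eqP); apply/fcard_eq => //; exact: card_codes_iso.
    rewrite (_ : codes F G = set0) ?fset_set0 ?cardfs0 //.
    apply/seteqP; split=> c //= cP; apply: GC; split=> //.
    by apply/cover_isomorphicP; exists c.
  rewrite [RHS](eq_big_seq _ E) -big_mkcond /=.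
  rewrite -[RHS]big_filter; apply: perm_big; apply: uniq_perm; rewrite ?filter_uniq ?fset_uniq //.
  move=> G; rewrite mem_filter; apply/idP/andP => [GC|[] //]; split=> //.
  move: GC; rewrite !in_fset_set ?inE //; first by case.
  exact: finite_Fhat_union.
have E G : G \in fset_set S -> #|` fset_set (codes F G)| = (\sum_(x <- B | T x == G) 1)%N.
  rewrite in_fset_set ?inE; last exact: finite_Fhat_union.
  by move=> GS; rewrite (TG _ GS).2 card_fset_sum1 -big_fset_condE.
rewrite (eq_big_seq _ E) (exchange_big_dep xpredT) //= card_fset_sum1.
apply: eq_big_seq => x xB; rewrite sum1_count.
under eq_count do rewrite eq_sym.
rewrite count_uniq_mem ?fset_uniq // in_fset_set; last exact: finite_Fhat_union.
by rewrite mem_set //; exact: (TB _ xB).1.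
Qed.

Lemma card_B_gt0 : (0 < #|` B|)%N.
Proof.
rewrite cardfs_gt0; apply/fset0Pn; exists (id, 1); rewrite mem_B /= oner_eq0 andbT.
by apply/mem_A; exact: frac_aut_id.
Qed.

(** The map [cod] reads the code off an automorphism: the substitution from the images of constants,
    the scaling from the image of [Y]. *)
Lemma card_aut_codes F : Fhat_union d F -> card_aut p zeta F = #|` fset_set (codes F F)|.
Proof.
move=> FS; have [T [TG _]] := card_codes_sum FS; have [finF _] := TG _ FS.
pose cod (phi : function_field p F -> function_field p F) : (K -> K) * K :=
  (fun x => (phi (in_qpoly (cover_eq p F) x%:P))`_0, (phi (in_qpoly (cover_eq p F) 'X))`_1).
have codE (phi : function_field p F -> function_field p F) s u : (forall h k, (phi h)`_k = s h`_k * u ^+ k) -> s 1 = 1 -> cod phi = (s, u).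
  move=> H s1; rewrite /cod; congr (_, _).
    apply/funext => x; rewrite H in_qpoly_coverE //.
      by rewrite coefC expr0 mulr1.
    by rewrite (leq_trans (size_polyC_leq1 _)) // ltnW.
  by rewrite H in_qpoly_coverE ?size_polyX // coefX s1 mul1r expr1.
have E : codes F F = [set cod phi | phi in @cover_aut Fq p zeta F]%classic.
  apply/seteqP; split=> [[s u] [sP u0 sF]|_ [phi phiP <-]].
    have [phi phiP H] := cover_map_iso zeta p_gt1 sP u0 sF.
    by exists phi => //; apply: codE => //; case: sP => _ _ [].
  have [s [u [sP u0 sF H]]] := cover_isoP p_gt1 zetaP phiP.
  by rewrite (codE _ s u) //; case: sP => _ _ [].
have cod_inj : {in @cover_aut Fq p zeta F &, injective cod}.
  move=> phi psi /set_mem phiP /set_mem psiP.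
  have [s [u [sP u0 sF H]]] := cover_isoP p_gt1 zetaP phiP.
  have [t [v [tP v0 tF H']]] := cover_isoP p_gt1 zetaP psiP.
  have s1 : s 1 = 1 by case: sP => _ _ [].
  have t1 : t 1 = 1 by case: tP => _ _ [].
  move=> Ec; have := etrans (esym (codE phi s u H s1)) (etrans Ec (codE psi t v H' t1)).
  case=> Es Eu; apply/funext => h; apply: function_field_eq => k.
  by apply: etrans (H h k) (esym (etrans (H' h k) _)); rewrite Es Eu.
have card_E := inj_card_eq cod_inj; rewrite -E in card_E.
rewrite /card_aut; apply/fcard_eq => //.
  by rewrite -(eq_finite_set card_E).
by rewrite card_eq_sym.
Qed.

(** By [card_cover_class] the weight of a class is its number of models divided by the size of [B].
    The weighted sum over classes is thus a sum over models, and the size of [B] cancels in the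
    quotient. *)
Theorem moduli_mean_uniform (f : R[i] -> R) :
  moduli_mean zeta d (fun C => f (normalized_trace p chi C)) =
  (\sum_(F <- fset_set S) f (((Num.sqrt (#|Fq|%:R + 1))^-1)%:C * frob_trace p chi F))
  / (#|` fset_set S|)%:R.
Proof.
have moduliE : moduli zeta d = [set cover_class F | F in S]%classic by [].
have finS := finite_Fhat_union.
have modelP F : Fhat_union d F -> cover_class F (model (cover_class F)).
  move=> FS; rewrite /model; case: xgetP => [G -> //|].
  by move=> /(_ F); case; apply: cover_class_refl.
have trE F : Fhat_union d F -> frob_trace p chi (model (cover_class F)) = frob_trace p chi F.
  move=> FS; have [GS /cover_isomorphicP [a aP]] := modelP F FS.
  have [T [TG TB]] := card_codes_sum FS; have [fG cG] := TG _ GS.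
  have : fset_set (codes F (model (cover_class F))) != fset0.
    by apply/fset0Pn; exists a; rewrite in_fset_set // mem_set.
  rewrite -cardfs_gt0 cG cardfs_gt0 => /fset0Pn [x /imfsetP [y /=]].
  by rewrite inE => /andP[yB /eqP <-] _; exact: (TB _ yB).2.
have wE F : Fhat_union d F -> aut_weight p R zeta (cover_class F) =
    (#|` fset_set (cover_class F)|)%:R / (#|` B|)%:R.
  move=> FS; have GC := modelP F FS; have GS : Fhat_union d (model (cover_class F)) by case: GC.
  have := card_cover_class GS; rewrite -(cover_class_eq GC) => E.
  rewrite /aut_weight (card_aut_codes GS).
  have B0 := card_B_gt0; move: (B0); rewrite -E muln_gt0 => /andP[c0 a0].
  rewrite natrM invfM mulrA mulfV ?mul1r //.
  by rewrite pnatr_eq0 -lt0n.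
have key (h : set {poly Fq} -> R) :
    \sum_(C \in moduli zeta d) aut_weight p R zeta C * h C =
    (#|` B|)%:R^-1 * \sum_(F <- fset_set S) h (cover_class F).
  rewrite moduliE fsbig_finite; last exact: finite_image.
  rewrite fset_set_image // [in RHS](partition_big_imfset _ cover_class) mulr_sumr.
  apply: eq_big_seq => C /imfsetP [F /=]; rewrite in_fset_set // inE => FS ->.
  rewrite wE // mulrAC [RHS]mulrC; congr (_ / _).
  rewrite (eq_bigr (fun=> h (cover_class F))); last by move=> G /eqP ->.
  rewrite big_const_seq iter_addr_0 -[RHS]mulr_natl; congr (_%:R * _).
  rewrite -size_filter; apply: perm_size; apply: uniq_perm; rewrite ?filter_uniq ?fset_uniq //.
  move=> G; rewrite mem_filter !in_fset_set //; last first.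
    by apply: sub_finite_set finS => H [].
  apply/idP/andP => [/set_mem GC|[/eqP E /set_mem GS]].
    by split; [rewrite (cover_class_eq GC) | apply: mem_set; case: GC].
  by apply: mem_set; rewrite -E; apply: cover_class_refl.
rewrite /moduli_mean.
have -> : \sum_(C \in moduli zeta d) aut_weight p R zeta C =
    \sum_(C \in moduli zeta d) aut_weight p R zeta C * (fun=> 1) C.
  by apply: eq_fsbigr => C _; rewrite mulr1.
rewrite (key (fun C => f (normalized_trace p chi C))) key -mulf_div divff ?mul1r; last first.
  by rewrite invr_eq0 pnatr_eq0 -lt0n card_B_gt0.
congr (_ / _); last by rewrite card_fset_sum1 natr_sum.
apply: eq_big_seq => F; rewrite in_fset_set // inE => FS.
by rewrite /normalized_trace trE.
Qed.

End ModuliMean.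

(** * Sieving for square-free products *)

Section Monics.
Variables (Fq : finFieldType) (n : nat).
Local Notation q := #|Fq|.
Implicit Types (f g : {poly_n Fq}) (P : {poly Fq}).

(** Polynomials are placed in the finite type [{poly_n Fq}] so that the sieve sums range over finite
    types; the bound [n] only has to exceed all degrees that occur. *)
Definition monics k : {set {poly_n Fq}} :=
  [set f : {poly_n Fq} | ((f : {poly Fq}) \is monic) && (size (f : {poly Fq}) == k.+1)].

Lemma card_monics k : (k < n)%N -> #|monics k| = (q ^ k)%N.
Proof.
move=> kn; rewrite -card_npoly.
pose h (v : {poly_k Fq}) : {poly_n Fq} := npolyp n ('X^k + (v : {poly Fq})).
have sX (v : {poly_k Fq}) : size ('X^k + (v : {poly Fq})) = k.+1.
  by rewrite size_polyDl size_polyXn // ltnS size_npoly.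
have hE v : h v = 'X^k + (v : {poly Fq}) :> {poly Fq} by rewrite npolypK // sX.
have h_inj : injective h.
  by move=> u v /(congr1 (@polyn _ _)); rewrite !hE => /addrI /val_inj.
rewrite -(fintype.card_image h_inj); apply: eq_card => f; rewrite [LHS]inE.
apply/andP/fintype.imageP => [[fm /eqP sf]|[v _ ->]].
  exists (npolyp k ((f : {poly Fq}) - 'X^k)) => //; apply: val_inj => /=.
  have sv : (size ((f : {poly Fq}) - 'X^k)%R <= k)%N.
    apply/leq_sizeP => j; rewrite leq_eqVlt coefB coefXn => /orP[/eqP <-|kj].
      by rewrite eqxx -[k]/(k.+1.-1) -sf -lead_coefE (monicP fm) subrr.
    by rewrite gtn_eqF // subr0 nth_default // sf.
  by rewrite hE npolypK // addrC subrK.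
rewrite hE sX eqxx; split=> //.
by rewrite monicE lead_coefDl ?lead_coefXn // size_polyXn ltnS size_npoly.
Qed.

Lemma card_monics_dvd k P : (k < n)%N -> P \is monic ->
  (#|[set f in monics k | (P %| (f : {poly Fq}))%R]| * q ^ (size P).-1 <= q ^ k)%N.
Proof.
move=> kn Pm; have P0 := monic_neq0 Pm.
have sP : (0 < size P)%N by rewrite size_poly_gt0.
have [kP|Pk] := ltnP k (size P).-1.
  rewrite (_ : [set f in _ | _] = finset.set0) ?cards0 //.
  apply/setP => f; rewrite !inE; apply/negP => /andP[/andP[fm /eqP sf] Pf].
  have := dvdp_leq (monic_neq0 fm) Pf; rewrite sf -(prednK sP) ltnS.
  by rewrite leqNgt kP.
rewrite -{2}(subnK Pk) expnD leq_mul2r; apply/orP; right.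
have kn' : (k - (size P).-1 < n)%N by apply: leq_ltn_trans kn; rewrite leq_subr.
rewrite -(card_monics kn').
pose h f : {poly_n Fq} := npolyp n ((f : {poly Fq}) %/ P).
have hE f : h f = (f : {poly Fq}) %/ P :> {poly Fq}.
  by rewrite npolypK // (leq_trans (leq_divp _ _)) ?size_npoly.
have h_inj : {in [set f in monics k | P %| (f : {poly Fq})] &, injective h}.
  move=> f g; rewrite !inE => /andP[_ Pf] /andP[_ Pg] E.
  by apply: val_inj; rewrite /= -(divpK Pf) -(divpK Pg) -!hE E.
rewrite -(card_in_imset h_inj); apply: subset_leq_card; apply/fintype.subsetP => _ /imsetP [f + ->].
rewrite !inE hE => /andP[/andP[fm /eqP sf] Pf]; apply/andP; split.
  by move: fm; rewrite -{1}(divpK Pf) monicMr.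
by rewrite size_divp // sf subSn.
Qed.

End Monics.

Section Sieve.
Variables (Fq : finFieldType) (n : nat) (I : finType) (R : realType).
Local Notation q := (#|Fq|%:R : R).
Local Notation r := (#|I|%:R : R).
Local Notation deg P := (size (P : {poly Fq})).-1.

Definition prime_poly (P : {poly Fq}) : bool := `[< irreducible_poly P >] && (P \is monic).

(** Primality is part of the predicate, so that in the inclusion and exclusion over arbitrary sets
    of polynomials only sets of primes contribute. *)
Definition sqdvd (f : {ffun I -> {poly_n Fq}}) (P : {poly Fq}) : bool :=
  prime_poly P && (P ^+ 2 %| \prod_i (f i : {poly Fq})).

Definition fam (e : I -> nat) (f : {ffun I -> {poly_n Fq}}) : bool :=
  [forall i, f i \in monics Fq n (e i)].

Definition all_dvd (g : I -> {poly Fq}) (f : {ffun I -> {poly_n Fq}}) : bool :=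
  [forall i, g i %| (f i : {poly Fq})].

Lemma prime_polyP P : prime_poly P -> irreducible_poly P /\ P \is monic.
Proof. by move=> /andP[/asboolP]. Qed.

Lemma coprimep_prime_poly P Q : prime_poly P -> prime_poly Q -> P != Q -> coprimep P Q.
Proof.
move=> /prime_polyP [iP mP] /prime_polyP [iQ mQ] PQ.
rewrite irreducible_poly_coprime //; apply: contraNN PQ => PQ.
rewrite -eqp_monic //; apply: iQ => //.
by case: iP => + _; case: (size P) => [|[]].
Qed.

Lemma q_gt0 : 0 < q.
Proof. by rewrite ltr0n; apply/card_gt0P; exists 0. Qed.

Lemma sum_fam (e : I -> nat) (F : I -> {poly_n Fq} -> R) :
  \sum_(f | fam e f) \prod_i F i (f i) = \prod_i \sum_(g in monics Fq n (e i)) F i g.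
Proof.
rewrite [RHS]bigA_distr_big_dep.
by apply: eq_bigl => f; rewrite /fam; apply/forallP/familyP.
Qed.

Lemma sum_fam_dvd (e : I -> nat) (g : I -> {poly Fq}) :
  (forall i, (e i < n)%N) -> (forall i, g i \is monic) ->
  \sum_(f | fam e f) (all_dvd g f)%:R
    <= \prod_i (q ^+ e i / q ^+ deg (g i)).
Proof.
move=> en gm.
have E f : (all_dvd g f)%:R = \prod_i (g i %| (f i : {poly Fq}))%R%:R :> R.
  rewrite /all_dvd; case: forallP => [H|/existsNP [i /negP H]].
    by rewrite big1 // => i _; rewrite H.
  by rewrite (bigD1 i) //= (negbTE H) mul0r.
rewrite (eq_bigr _ (fun f _ => E f)).
rewrite (sum_fam e (fun i f => (g i %| (f : {poly Fq}))%R%:R)).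
apply: ler_prod => i _; apply/andP; split; first by apply: sumr_ge0.
rewrite ler_pdivlMr ?exprn_gt0 ?q_gt0 //.
have := card_monics_dvd (en i) (gm i); rewrite -(ler_nat R) natrM !natrX.
congr (_ * _ <= _); rewrite -sum1_card natr_sum [RHS]big_mkcond [LHS]big_mkcond /=.
by apply: eq_bigr => f _; rewrite finset.in_set; case: (f \in monics _ _ _); case: (g i %| _).
Qed.

(** The case [i = j] encodes a square dividing a single factor; for [i != j] the prime divides two
    different factors. *)
Lemma dvdp_sqr_prod (f : I -> {poly Fq}) P : irreducible_poly P ->
  P ^+ 2 %| \prod_i f i -> exists i j, forall l, P ^+ ((l == i) + (l == j)) %| f l.
Proof.
move=> irrP P2; have P0 := irredp_neq0 irrP.
have [i Pi] : exists i, P %| f i.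
  by apply: irreducible_dvd_prod irrP _; apply: dvdp_trans P2; rewrite expr2 dvdp_mulIl.
move: (Pi) => /dvdpP [t ft].
move: P2; rewrite (bigD1 i) //= ft expr2 (mulrC t) -mulrA dvdp_mul2l //.
move=> /(irreducible_dvdM irrP) /orP[Pt|Pr].
  exists i, i => l; case: eqP => [->|_]; last by rewrite expr0 dvd1p.
  by rewrite ft expr2 dvdp_mul2r.
have : P %| \prod_(j | j != i) f j by [].
rewrite (big_mkcond (fun j => j != i)) /= => /(irreducible_dvd_prod irrP) [j].
case: ifP => [ji Pj | _]; last by rewrite dvdp1 => /eqP sP; case: irrP; rewrite sP.
exists i, j => l; case: (eqVneq l i) => [->|li].
  by rewrite eq_sym (negbTE ji) expr1.
by case: eqP => [->|_]; rewrite ?expr1 ?expr0 ?dvd1p.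
Qed.

(** Induction on [s], with [g] collecting the divisors already imposed on each factor. A prime whose
    square divides the product does so through one of at most [r ^+ 2] pairs of positions, each
    choice costing [q ^ (- 2 deg P)]. Coprimality to the remaining primes lets the new divisor be
    multiplied into [g]. *)
Lemma sum_fam_sqdvd (e : I -> nat) (s : seq {poly Fq}) (g : I -> {poly Fq}) :
  (forall i, (e i < n)%N) -> (forall i, g i \is monic) ->
  uniq s -> all prime_poly s -> (forall i P, P \in s -> coprimep (g i) P) ->
  \sum_(f | fam e f) (all (sqdvd f) s && all_dvd g f)%:R
    <= \prod_(P <- s) (r ^+ 2 / q ^+ (2 * deg P)) * \prod_i (q ^+ e i / q ^+ deg (g i)).
Proof.
move=> en; elim: s g => [|P s IH] g gm.
  by move=> _ _ _; rewrite big_nil mul1r; apply: sum_fam_dvd.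
move=> /= /andP[Ps us] /andP[pP ps] cg; have [iP mP] := prime_polyP pP.
pose t (ij : I * I) l := ((l == ij.1) + (l == ij.2))%N.
pose g' ij l := g l * P ^+ t ij l.
have g'm ij i : g' ij i \is monic by rewrite monicMr // monic_exp.
have cg' ij i Q : Q \in s -> coprimep (g' ij i) Q.
  move=> Qs; rewrite coprimepMl cg ?inE ?Qs ?orbT //= coprimep_expl //.
  apply: coprimep_prime_poly => //; first by have /allP := ps; apply.
  by apply: contraNneq Ps => ->.
apply: (@le_trans _ _ (\sum_(ij : I * I) \sum_(f | fam e f)
    (all (sqdvd f) s && all_dvd (g' ij) f)%:R)).
  rewrite exchange_big /=; apply: ler_sum => f _.
  case: (boolP (_ && _ && _)) => [|_]; last by apply: sumr_ge0.
  move=> /andP[/andP[/andP[_ P2] sf] /forallP gf].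
  have [i [j ij]] := dvdp_sqr_prod iP P2.
  rewrite (bigD1 (i, j)) //= sf /=.
  have -> : all_dvd (g' (i, j)) f.
    apply/forallP => l; rewrite Gauss_dvdp ?gf ?ij //.
    by rewrite coprimep_expr // cg ?inE ?eqxx.
  by rewrite lerDl sumr_ge0.
have q0 : q != 0 by rewrite gt_eqF // q_gt0.
apply: (@le_trans _ _ (\sum_(ij : I * I) (\prod_(Q <- s) (r ^+ 2 / q ^+ (2 * deg Q)) *
    \prod_i (q ^+ e i / q ^+ deg (g' ij i))))).
  by apply: ler_sum => ij _; apply: IH => // i Q; apply: cg'.
rewrite -mulr_sumr big_cons mulrAC -mulrA mulrC.
rewrite [leRHS](_ : _ = (\prod_(Q <- s) (r ^+ 2 / q ^+ (2 * deg Q))) *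
  (r ^+ 2 / q ^+ (2 * deg P) * \prod_i (q ^+ e i / q ^+ deg (g i)))); last by ring.
rewrite mulrC ler_wpM2l //.
  by rewrite prodr_ge0 // => Q _; rewrite divr_ge0 ?exprn_ge0 ?ler0n.
have E ij : \prod_i (q ^+ e i / q ^+ deg (g' ij i)) =
    (q ^+ (2 * deg P))^-1 * \prod_i (q ^+ e i / q ^+ deg (g i)).
  have dg i : deg (g' ij i) = (deg (g i) + deg P * t ij i)%N.
    rewrite size_mul ?monic_neq0 ?monic_exp // -size_exp.
    have := monic_neq0 (gm i); rewrite -size_poly_gt0.
    have : P ^+ t ij i != 0 by rewrite monic_neq0 // monic_exp.
    rewrite -size_poly_gt0; case: (size (g i)) => // a; case: (size (P ^+ _)) => // b _ _.
    by rewrite addSn addnS.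
  under eq_bigr do rewrite dg exprD invfM mulrA.
  rewrite big_split /= mulrC; congr (_ * _).
  under eq_bigr do rewrite -exprVn.
  rewrite prodrXr -exprVn; congr (_ ^+ _).
  rewrite -big_distrr /= mulnC; congr (_ * _)%N.
  rewrite /t big_split /= -[RHS]/(1 + 1)%N; congr (_ + _)%N.
    by rewrite (bigD1 ij.1) //= eqxx big1 ?addn0 // => l /negbTE ->.
  by rewrite (bigD1 ij.2) //= eqxx big1 ?addn0 // => l /negbTE ->.
rewrite (eq_bigr _ (fun ij _ => E ij)).
rewrite sumr_const card_prod -[leLHS]mulr_natl natrM -expr2 mulrA.
by rewrite lexx.
Qed.

(* There are at most q^k primes of degree k. *)
Lemma sum_prime_poly (y : R) : 0 <= y -> q * y <= 2^-1 ->
  \sum_(P : {poly_n Fq} | prime_poly P) y ^+ deg P <= 2 * (q * y).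
Proof.
move=> y0 qy; have qy0 : 0 <= q * y by rewrite mulr_ge0 // ltW // q_gt0.
apply: (@le_trans _ _ (\sum_(k < n) (if (0 < k)%N then (q * y) ^+ k else 0))).
  rewrite (eq_bigl (fun P : {poly_n Fq} => prime_poly P && (deg P < n)%N)); last first.
    move=> P; case: (boolP (prime_poly _)) => // /prime_polyP [[sP _] _] /=.
    by apply/esym; rewrite prednK ?(ltnW sP) ?size_npoly.
  case: n => [|m]; first by rewrite big_ord0 big1 // => P /andP[_]; rewrite ltn0.
  rewrite (partition_big (fun P : {poly_m.+1 Fq} => inord (deg P) : 'I_m.+1) xpredT) //=.
  apply: ler_sum => k _.
  apply: (@le_trans _ _ (\sum_(P in monics Fq m.+1 k) (if (0 < k)%N then y ^+ k else 0))).
    rewrite big_mkcond [leRHS]big_mkcond /=; apply: ler_sum => P _.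
    case: ifP => [/andP[/andP[/prime_polyP [[sP _] mP] sPm] /eqP Ek]|_]; last first.
      by case: ifP => // _; case: ifP => // _; rewrite exprn_ge0.
    have kE : k = deg P :> nat by rewrite -Ek inordK.
    rewrite inE mP kE prednK ?eqxx ?(ltnW sP) //=.
    by rewrite -ltnS prednK ?(ltnW sP) // sP.
  case: ifP => _; rewrite sumr_const ?mul0rn //.
  by rewrite card_monics // -[leLHS]mulr_natl natrX exprMn.
(* A geometric series of ratio at most one half: every partial sum is at most twice the first
   term. *)
elim: n => [|m IH]; first by rewrite big_ord0 mulr_ge0.
rewrite big_ord_recl /= add0r.
apply: (@le_trans _ _ (q * y * (1 + \sum_(k < m) (if (0 < k)%N then (q * y) ^+ k else 0)))).
  case: m IH => [|m] IH; first by rewrite !big_ord0 addr0 mulr1.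
  rewrite [in leRHS]big_ord_recl /= add0r mulrDr mulr1 mulr_sumr big_ord_recl /= expr1 lerD2l.
  by apply: ler_sum => k _; rewrite -exprS.
rewrite mulrC; apply: ler_wpM2r => //.
apply: (@le_trans _ _ (1 + 2 * (q * y))); first by rewrite lerD2l.
lra.
Qed.

End Sieve.

(** * Inclusion and exclusion over squares of primes *)

Section SieveBound.
Variables (Fq : finFieldType) (n : nat) (I : finType) (R : realType).
Local Notation q := (#|Fq|%:R : R).
Local Notation r := (#|I|%:R : R).
Local Notation deg P := (size (P : {poly Fq})).-1.
Variables (e : I -> nat).
Hypothesis en : forall i, (e i < n)%N.
Local Notation T := ({ffun I -> {poly_n Fq}}).

Definition good (f : T) : bool := [forall P : {poly_n Fq}, ~~ sqdvd f P].

(** Testing only primes in [{poly_n Fq}] is enough, since the product itself has size at most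
    [n]. *)
Lemma sqr_free_good (f : T) : (\sum_i e i < n)%N -> fam e f ->
  good f <-> square_free (\prod_i (f i : {poly Fq})).
Proof.
move=> sn /forallP ff.
have fm i : ((f i : {poly Fq}) \is monic) /\ size (f i : {poly Fq}) = (e i).+1.
  by have := ff i; rewrite inE => /andP[? /eqP].
have p0 : \prod_i (f i : {poly Fq}) != 0.
  by apply/prodf_neq0 => i _; rewrite monic_neq0 //; case: (fm i).
have sp : (size (\prod_i (f i : {poly Fq}))%R <= n)%N.
  apply: leq_trans sn; apply: size_prod_leqS => i; by case: (fm i) => _ ->.
split=> [/forallP gf|sf].
  apply/(square_freeP p0) => P irrP; apply/negP => P2.
  pose Q := (lead_coef P)^-1 *: P.
  have l0 : (lead_coef P)^-1 != 0 by rewrite invr_eq0 lead_coef_eq0 irredp_neq0.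
  have QP : Q %= P by rewrite eqp_scale.
  have Qm : Q \is monic by rewrite monicE lead_coefZ mulVf // -invr_eq0.
  have Q2 : Q ^+ 2 %| \prod_i (f i : {poly Fq}).
    by rewrite exprZn dvdpZl // expf_neq0.
  have irrQ : irreducible_poly Q.
    split; first by rewrite size_scale //; case: irrP.
    move=> g sg gQ; apply: (eqp_trans _ (_ : P %= Q)); last by rewrite eqp_sym.
    by apply: irrP => //; rewrite -(eqp_dvdr _ QP).
  have sQ : (size Q <= n)%N.
    apply: leq_trans sp; apply: leq_trans (dvdp_leq p0 Q2).
    by rewrite dvdp_leq ?expf_neq0 ?monic_neq0 // expr2 dvdp_mulIl.
  have := gf (npolyp n Q); rewrite /sqdvd npolypK // Q2 andbT /prime_poly Qm andbT.
  by move=> /negP; apply; apply/asboolP.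
apply/forallP => P; apply/negP => /andP[/prime_polyP [irrP _] P2].
by have /negP := (square_freeP p0).1 sf _ irrP.
Qed.

Lemma card_fam : \sum_(f : T | fam e f) 1 = \prod_i q ^+ e i :> R.
Proof.
transitivity (\sum_(f : T | fam e f) \prod_(i : I) (1 : R)).
  by apply: eq_bigr => f _; rewrite big1.
rewrite (sum_fam e (fun _ _ => 1)); apply: eq_bigr => i _.
by rewrite sumr_const card_monics // natrX.
Qed.

Lemma sum_sqdvd (s : seq {poly Fq}) : uniq s -> all (@prime_poly Fq) s ->
  \sum_(f : T | fam e f) (all (sqdvd f) s)%:R
    <= \prod_(P <- s) (r ^+ 2 / q ^+ (2 * deg P)) * \prod_i q ^+ e i.
Proof.
move=> us ps.
have := @sum_fam_sqdvd Fq n I R e s (fun=> 1) en (fun=> monic1 _) us ps (fun _ _ _ => coprime1p _).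
under [X in _ * X]eq_bigr do rewrite size_poly1 expr0 invr1 mulr1.
apply: le_trans; apply: ler_sum => f _; rewrite ler_nat.
by have -> : all_dvd (fun=> 1) f; [apply/forallP => i; rewrite dvd1p|rewrite andbT].
Qed.

(** Union bound over the primes: each contributes [r ^+ 2 / q ^+ (2 * deg P)], and [sum_prime_poly]
    with [y = q ^- 2] sums these. *)
Lemma sum_not_good : 2 <= q ->
  \sum_(f : T | fam e f && ~~ good f) 1 <= 2 * r ^+ 2 / q * \prod_i q ^+ e i.
Proof.
move=> q2; have q0 : 0 < q := q_gt0 Fq R.
have Q0 : 0 <= \prod_i q ^+ e i by rewrite prodr_ge0 // => i _; rewrite exprn_ge0 // ltW.
apply: (@le_trans _ _ (\sum_(P : {poly_n Fq} | prime_poly P)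
    \sum_(f : T | fam e f) (all (sqdvd f) [:: (P : {poly Fq})])%:R)).
  rewrite exchange_big /= big_mkcondr; apply: ler_sum => f _.
  case: ifP => [/forallPn [P]|_]; last by apply: sumr_ge0.
  rewrite negbK => bP; have /andP[pP _] := bP.
  by rewrite (bigD1 P) //= bP /= lerDl sumr_ge0.
apply: (@le_trans _ _ (\sum_(P : {poly_n Fq} | prime_poly P)
    r ^+ 2 * (q ^- 2) ^+ deg P * \prod_i q ^+ e i)).
  apply: ler_sum => P pP; have := @sum_sqdvd [:: (P : {poly Fq})] isT.
  rewrite /= pP => /(_ isT) /le_trans; apply.
  by rewrite big_seq1 exprM -exprVn.
rewrite -mulr_suml -mulr_sumr ler_wpM2r //.
apply: (@le_trans _ _ (r ^+ 2 * (2 * (q * q ^- 2)))).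
  rewrite ler_wpM2l ?exprn_ge0 ?ler0n //; apply: sum_prime_poly.
    by rewrite invr_ge0 exprn_ge0 // ltW.
  by rewrite expr2 invfM mulrA mulfV ?gt_eqF // mul1r lef_pV2 ?posrE.
by rewrite expr2 invfM [q * _]mulrA mulfV ?gt_eqF // mul1r mulrCA mulrA.
Qed.

Lemma sum_root (x : Fq) :
  \sum_(f : T | fam e f && ((\prod_i (f i : {poly Fq})).[x] == 0)) 1
    <= r / q * \prod_i q ^+ e i.
Proof.
have q0 : 0 < q := q_gt0 Fq R.
pose g (j i : I) : {poly Fq} := if i == j then 'X - x%:P else 1.
have gm j i : g j i \is monic by rewrite /g; case: ifP => _; rewrite ?monicXsubC ?monic1.
apply: (@le_trans _ _ (\sum_j \sum_(f : T | fam e f) (all_dvd (g j) f)%:R)).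
  rewrite exchange_big /= big_mkcondr; apply: ler_sum => f _.
  case: ifP => [|_]; last by apply: sumr_ge0.
  rewrite horner_prod prodf_seq_eq0 => /hasP [j _ /= fj].
  rewrite (bigD1 j) //= (_ : all_dvd (g j) f).
    by rewrite lerDl sumr_ge0.
  apply/forallP => i; rewrite /g; case: eqP => [->|_]; last by rewrite dvd1p.
  by rewrite dvdp_XsubCl /root.
apply: (@le_trans _ _ (\sum_(j : I) (q^-1 * \prod_i q ^+ e i))); last first.
  by rewrite sumr_const -[leLHS]mulr_natl mulrA.
apply: ler_sum => j _; apply: le_trans (sum_fam_dvd R en (gm j)) _.
rewrite big_split /= mulrC ler_wpM2r ?prodr_ge0 //.
rewrite (bigD1 j) //= /g eqxx size_XsubC expr1 big1 ?mulr1 // => i /negbTE ->.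
by rewrite size_poly1 expr0 invr1.
Qed.

Lemma prod_indic (f : T) (A : {set {poly_n Fq}}) (V : comPzRingType) :
  \prod_(P in A) (sqdvd f P)%:R = (all (sqdvd f) (map (@polyn _ _) (enum A)))%:R :> V.
Proof.
rewrite all_map -big_enum /=.
by elim: (enum A) => [|P s IH]; rewrite ?big_nil // big_cons IH /=; case: (sqdvd f P); rewrite ?mul1r ?mul0r.
Qed.

(** Inclusion and exclusion, by expanding the product over [P] of one minus the indicator of
    [sqdvd f P]. *)
Lemma goodE (f : T) (V : comPzRingType) : (good f)%:R =
  \sum_(A : {set {poly_n Fq}}) (-1) ^+ #|A| * \prod_(P in A) (sqdvd f P)%:R :> V.
Proof.
transitivity (\prod_(P : {poly_n Fq}) (- (sqdvd f P)%:R + 1) : V).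
  rewrite /good; case: forallP => [H|/existsNP [P /negP]].
    by rewrite big1 // => P _; rewrite (negbTE (H P)) oppr0 add0r.
  by rewrite negbK => bP; rewrite (bigD1 P) //= bP addNr mul0r.
rewrite bigA_distr; apply: eq_bigr => A _.
rewrite -big_mkcond /= -prodrN. by [].
Qed.

(* Rankin's trick: the tail of the sieve is bounded by weighting each prime P by
   (q/2)^(deg P). *)
Lemma sieve_bound (Psi : T -> R[i]) (m : nat) : 2 <= q ->
  (forall f, `|Psi f| <= 1) ->
  (forall A : {set {poly_n Fq}}, (forall P : {poly_n Fq}, P \in A -> prime_poly P) ->
    (\sum_(P in A) deg P <= m)%N ->
    \sum_(f : T | fam e f) \prod_(P in A) (sqdvd f P)%:R * Psi f = 0) ->
  `|\sum_(f : T | fam e f && good f) Psi f|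
    <= ((2 / q) ^+ m * expR (r ^+ 2) * \prod_i q ^+ e i)%:C.
Proof.
move=> q2 Psi1 vanish; have q0 : 0 < q := q_gt0 Fq R.
have Q0 : 0 <= \prod_i q ^+ e i by rewrite prodr_ge0 // => i _; rewrite exprn_ge0 // ltW.
pose pA (A : {set {poly_n Fq}}) := [forall (P | P \in A), prime_poly (P : {poly Fq})].
pose dA (A : {set {poly_n Fq}}) := (\sum_(P in A) deg P)%N.
pose bad (A : {set {poly_n Fq}}) : R := \sum_(f : T | fam e f) \prod_(P in A) (sqdvd f P)%:R.
have -> : \sum_(f : T | fam e f && good f) Psi f =
    \sum_(A : {set {poly_n Fq}}) (-1) ^+ #|A| *
      \sum_(f : T | fam e f) \prod_(P in A) (sqdvd f P)%:R * Psi f.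
  under [RHS]eq_bigr do rewrite mulr_sumr.
  rewrite exchange_big /= big_mkcondr; apply: eq_bigr => f _.
  under eq_bigr do rewrite mulrA.
  by rewrite -mulr_suml -goodE; case: (good f); rewrite ?mul1r ?mul0r.
apply: le_trans (ler_norm_sum _ _ _) _.
apply: (@le_trans _ _ (\sum_(A : {set {poly_n Fq}} | pA A && (m < dA A)%N) (bad A)%:C)).
  rewrite [leRHS]big_mkcond /=; apply: ler_sum => A _.
  rewrite normrM normrX normrN1 expr1n mul1r; case: ifP => [_|].
    apply: le_trans (ler_norm_sum _ _ _) _.
    rewrite /bad rmorph_sum /=; apply: ler_sum => f _.
    rewrite !prod_indic normrM normr_nat rmorph_nat.
    by rewrite -[leRHS]mulr1 ler_wpM2l.
  move=> /negbT; rewrite negb_and => /orP[npA|]; last first.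
    rewrite -leqNgt => dm; case: (boolP (pA A)) => [/forall_inP pAA|npA].
      by rewrite vanish ?normr0.
    rewrite big1 ?normr0 // => f _; have /forall_inPn [P PA nP] := npA.
    by rewrite (bigD1 P) //= /sqdvd (negbTE nP) !mul0r.
  rewrite big1 ?normr0 // => f _; have /forall_inPn [P PA nP] := npA.
  by rewrite (bigD1 P) //= /sqdvd (negbTE nP) !mul0r.
rewrite -rmorph_sum /= lecR.
(* The factor [r ^+ 2 / q ^+ (2 deg P)] is split into [(2 / q) ^+ deg P] and [a P]. The first parts
   multiply to at most [(2 / q) ^+ m], as the total degree exceeds [m]. The [a P] have sum at most
   [r ^+ 2], by [sum_prime_poly] at [y = 1 / (2 q)], so the product of the [1 + a P] is at most
   [expR (r ^+ 2)]. *)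
pose a (P : {poly_n Fq}) : R := if prime_poly P then r ^+ 2 * ((2 * q)^-1) ^+ deg P else 0.
have a0 P : 0 <= a P.
  rewrite /a; case: ifP => // _; rewrite mulr_ge0 ?exprn_ge0 ?ler0n //.
have badle A : pA A && (m < dA A)%N ->
    bad A <= (2 / q) ^+ m * \prod_i q ^+ e i * \prod_(P in A) a P.
  move=> /andP[/forall_inP pAA mA].
  have -> : bad A = \sum_(f : T | fam e f) (all (sqdvd f) (map (@polyn _ _) (enum A)))%:R.
    by apply: eq_bigr => f _; rewrite prod_indic.
  apply: le_trans (sum_sqdvd _ _) _.
  - by rewrite map_inj_uniq ?enum_uniq //; exact: val_inj.
  - by apply/allP => _ /mapP [P + ->]; rewrite mem_enum => /pAA.
  rewrite big_map big_enum /= [leRHS]mulrAC ler_wpM2r //.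
  have -> : \prod_(P in A) (r ^+ 2 / q ^+ (2 * deg P)) =
      (2 / q) ^+ dA A * \prod_(P in A) a P.
    rewrite /dA -prodrXr -big_split /=; apply: eq_bigr => P /pAA pP.
    rewrite /a pP mulrCA; congr (_ * _).
    rewrite -exprMn invfM mulrACA mulfV ?mul1r //.
    by rewrite -expr2 -exprM exprVn.
  rewrite ler_wpM2r ?prodr_ge0 //.
  rewrite ler_wiXn2l ?divr_ge0 ?(ltW q0) ?ler_pdivrMr ?mul1r //.
  exact: ltnW.
apply: le_trans (ler_sum _ badle) _.
rewrite -mulr_sumr -[leRHS]mulrA [X in _ <= _ * X]mulrC mulrA ler_wpM2l ?mulr_ge0 //.
apply: (@le_trans _ _ (\sum_(A : {set {poly_n Fq}}) \prod_(P in A) a P)).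
  rewrite [leRHS](bigID (fun A => pA A && (m < dA A)%N)) /= lerDl sumr_ge0 // => A _.
  by rewrite prodr_ge0.
have -> : \sum_(A : {set {poly_n Fq}}) \prod_(P in A) a P = \prod_P (a P + 1).
  by rewrite bigA_distr; apply: eq_bigr => A _; rewrite -big_mkcond.
apply: (@le_trans _ _ (\prod_P expR (a P))).
  apply: ler_prod => P _; rewrite addr_ge0 //= addrC.
  exact: expR_ge1Dx.
rewrite -expR_sum ler_expR /a -big_mkcond /= -mulr_sumr.
rewrite -[leRHS]mulr1 ler_wpM2l ?exprn_ge0 ?ler0n //.
have qE : q * (2 * q)^-1 = 2^-1 by rewrite invfM mulrCA mulfV ?mulr1 // gt_eqF.
have := @sum_prime_poly Fq n R (2 * q)^-1; rewrite qE lexx => /(_ _ isT).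
rewrite mulfV //; apply.
by rewrite invr_ge0 mulr_ge0 // ltW.
Qed.

End SieveBound.

(** * Character sums over the family *)

Section Vanishing.
Variables (Fq : finFieldType) (n : nat) (p : nat) (R : realType).
Variables (chi : Fq -> R[i]) (e : 'I_p.-1 -> nat) (i0 : 'I_p.-1).
Hypotheses (chiP : character_of_order p chi) (en : forall i, (e i < n)%N).
Hypothesis i00 : i0 = 0%N :> nat.
Local Notation T := ({ffun 'I_p.-1 -> {poly_n Fq}}).
Local Notation deg P := (size (P : {poly Fq})).-1.
Variable nu : Fq -> nat.

Definition prodX (f : T) : {poly Fq} := \prod_i (f i : {poly Fq}) ^+ i.+1.

Definition Psi (f : T) : R[i] := \prod_(x : Fq) chi (prodX f).[x] ^+ nu x.

Lemma character_nontrivial (k : nat) : ~~ (p %| k)%N ->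
  exists2 x, x != 0 & chi x ^+ k != 1.
Proof.
case: chiP => _ _ _ H pk; apply: contrapT => nex.
have /H pk' : forall x, x != 0 -> chi x ^+ k = 1.
  by move=> x x0; apply: contrapT => /eqP c1; apply: nex; exists x.
by rewrite pk' in pk.
Qed.

Section Shift.
Variables (x0 : Fq) (L : {poly Fq}).
Hypotheses (sL : (size L <= e i0)%N) (Lx0 : L.[x0] = 1).

(* Multiplies the value of the factor [f i0] at [x0] by [la], without changing it
   modulo [L / ('X - x0)]. *)
Definition shift (la : Fq) (f : T) : T := [ffun i => if i == i0 then
  npolyp n ((f i0 : {poly Fq}) + ((la - 1) * (f i0 : {poly Fq}).[x0]) *: L) else f i].

Lemma shiftE la f i : shift la f i = (if i == i0 then
  (f i0 : {poly Fq}) + ((la - 1) * (f i0 : {poly Fq}).[x0]) *: L else f i) :> {poly Fq}.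
Proof.
rewrite ffunE; case: eqP => // _; rewrite npolypK //.
rewrite (leq_trans (size_polyD _ _)) // geq_max size_npoly.
by rewrite (leq_trans (size_scale_leq _ _)) // (leq_trans sL) // ltnW.
Qed.

Lemma shiftK la : la != 0 -> cancel (shift la) (shift la^-1).
Proof.
move=> la0 f; apply/ffunP => i; apply: val_inj => /=; rewrite !shiftE eqxx.
case: eqP => [->|//]; rewrite -addrA -scalerDl hornerD hornerZ Lx0 mulr1.
rewrite [X in X *: L](_ : _ = 0) ?scale0r ?addr0 //.
rewrite -[X in (_ - 1) * (X + _)]mul1r -mulrDl [1 + _]addrC subrK mulrA -mulrDl.
by rewrite mulrBl mulVf // mul1r addrC addrA subrK subrr mul0r.
Qed.

Lemma fam_shift la f : fam e f -> fam e (shift la f).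
Proof.
move=> /forallP ff; apply/forallP => i; rewrite inE shiftE.
have [->|ii0] := eqVneq i i0; last by have := ff i; rewrite inE.
have := ff i0; rewrite inE => /andP[fm /eqP sf].
have sl : (size (((la - 1) * (f i0 : {poly Fq}).[x0]) *: L)%R < size (f i0 : {poly Fq}))%N.
  by rewrite sf ltnS (leq_trans (size_scale_leq _ _)).
by rewrite size_polyDl // sf eqxx andbT monicE lead_coefDl.
Qed.

Lemma sqdvd_shift la f P : P ^+ 2 %| L -> sqdvd (shift la f) P = sqdvd f P.
Proof.
move=> PL; rewrite /sqdvd; congr (_ && _).
rewrite (bigD1 i0) //= [in RHS](bigD1 i0) //= shiftE eqxx mulrDl.
rewrite (eq_bigr (fun i => f i : {poly Fq})); last first.
  by move=> i ii0; rewrite shiftE (negbTE ii0).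
by rewrite dvdp_addl // dvdp_mulr // -mul_polyC dvdp_mull.
Qed.

End Shift.

(** The factor of index [i0] enters [F] to the first power. Adding to it a multiple of a polynomial
    [L] with [L.[x0] = 1], zero at the other points of the support of [nu] and divisible by the
    squares of the primes in [A], multiplies [F(x0)] by [la] and changes nothing else in the
    summand. The sum is then equal to itself times [chi la ^+ nu x0], which is not 1. *)
Lemma sum_Psi_vanish (A : {set {poly_n Fq}}) (m k : nat) (x0 : Fq) :
  (forall P : {poly_n Fq}, P \in A -> prime_poly P) ->
  (\sum_(P in A) deg P <= m)%N -> ~~ (p %| nu x0)%N ->
  (#|[set x | nu x != 0%N]| <= k)%N -> (2 * m + k <= e i0)%N ->
  \sum_(f : T | fam e f) \prod_(P in A) (sqdvd f P)%:R * Psi f = 0.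
Proof.
move=> pA dA nux0 suppk me.
have chi0 : chi 0 = 0 by case: chiP.
have chiM : {morph chi : x y / x * y} by case: chiP.
have nu0 : nu x0 != 0%N by apply: contraNneq nux0 => ->.
(* If some [P] in [A] vanishes at [x0], no such [L] exists; but then [F(x0) = 0] whenever [P ^+ 2]
   divides the product, and every summand is zero. *)
have [[P PA Px0]|noroot] := pselect (exists2 P : {poly_n Fq}, P \in A & (P : {poly Fq}).[x0] = 0).
  rewrite big1 // => f _; rewrite (bigD1 P) //=.
  case: (boolP (sqdvd f P)) => [|_]; last by rewrite !mul0r.
  move=> /andP[pP P2]; have [irrP _] := prime_polyP pP.
  have /(irreducible_dvd_prod irrP) [i Pi] : (P : {poly Fq}) %| \prod_i (f i : {poly Fq}).
    by apply: dvdp_trans P2; rewrite expr2 dvdp_mulIl.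
  suff -> : Psi f = 0 by rewrite mulr0.
  rewrite /Psi (bigD1 x0) //= (_ : (prodX f).[x0] = 0).
    by rewrite chi0 expr0n (negbTE nu0) mul0r.
  apply/eqP; rewrite /prodX horner_prod (bigD1 i) //= horner_exp mulf_eq0 expf_eq0 /=.
  by have /dvdpP [t ->] := Pi; rewrite hornerM Px0 mulr0 eqxx.
pose L0 : {poly Fq} := (\prod_(P in A) (P : {poly Fq})) ^+ 2 *
  \prod_(x | (nu x != 0%N) && (x != x0)) ('X - x%:P).
have L00 : L0.[x0] != 0.
  rewrite /L0 hornerM mulf_neq0 //.
    rewrite horner_exp expf_neq0 // horner_prod; apply/prodf_neq0 => P PA.
    by apply/eqP => P0; apply: noroot; exists P.
  rewrite horner_prod; apply/prodf_neq0 => x /andP[_ xx0].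
  by rewrite hornerXsubC subr_eq0 eq_sym.
pose L := (L0.[x0])^-1 *: L0.
have Lx0 : L.[x0] = 1 by rewrite hornerZ mulVf.
(* Leaving out [x0] keeps at most [k - 1] linear factors, so the degree of [L] is below [e i0] and
   the shifted factor stays monic of the same degree. *)
have sL : (size L <= e i0)%N.
  apply: leq_trans me; rewrite (leq_trans (size_scale_leq _ _)) //.
  have s1 : (size (\prod_(P in A) (P : {poly Fq}))%R <= m.+1)%N.
    rewrite (leq_trans _ (_ : (\sum_(P in A) deg P).+1 <= m.+1)%N) //.
    rewrite (big_mkcond (fun P => P \in A)) (big_mkcond (fun P => P \in A)) /=.
    apply: (@size_prod_leqS _ _ xpredT) => P; case: (P \in A) => //.
      exact: leqSpred.
    by rewrite size_poly1.
  have s2 : (size (\prod_(x | (nu x != 0%N) && (x != x0)) ('X - x%:P))%R <= k)%N.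
    rewrite -big_filter size_prod_XsubC size_filter -sum1_count sum1_card.
    apply: leq_trans suppk; rewrite (cardsD1 x0) inE nu0 add1n ltnS.
    by apply: subset_leq_card; apply/fintype.subsetP => x; rewrite !inE unfold_in andbC.
  have s3 := size_expn_leqS 2 s1.
  apply: leq_trans (size_polyMleq _ _) _.
  apply: (@leq_trans ((2 * m).+1 + k).-1); last by rewrite addSn.
  by rewrite -!subn1 leq_sub2r // leq_add.
have PL (P : {poly_n Fq}) : P \in A -> (P : {poly Fq}) ^+ 2 %| L.
  move=> PA; rewrite dvdpZr ?invr_eq0 // /L0 dvdp_mulr // dvdp_exp2r //.
  by rewrite (bigD1 P) //= dvdp_mulIl.
have [la la0 chila] := character_nontrivial nux0.
have Psi_shift f : Psi (shift x0 L la f) = chi la ^+ nu x0 * Psi f.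
  rewrite /Psi (bigD1 x0) //= [in RHS](bigD1 x0) //= mulrA; congr (_ * _).
    rewrite -exprMn -chiM; congr (chi _ ^+ _).
    rewrite /prodX (bigD1 i0) //= [in RHS](bigD1 i0) //= shiftE // eqxx.
    rewrite !hornerM mulrA; congr (_ * _).
      rewrite !horner_exp hornerD hornerZ Lx0 i00 !expr1 mulr1 mulrBl mul1r.
      by rewrite addrC subrK.
    congr horner; apply: eq_bigr => i ii0; by rewrite shiftE // (negbTE ii0).
  apply: eq_bigr => x xx0; have [->|nux] := eqVneq (nu x) 0%N; first by rewrite !expr0.
  congr (chi _ ^+ _); rewrite /prodX !horner_prod; apply: eq_bigr => i _.
  rewrite !horner_exp shiftE //; case: eqP => [->|//]; congr (_ ^+ _).
  rewrite hornerD !hornerZ (_ : L0.[x] = 0) ?mulr0 ?addr0 //.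
  apply/eqP; rewrite /L0 hornerM mulf_eq0; apply/orP; right.
  by rewrite horner_prod (bigD1 x) ?nux //= hornerXsubC subrr mul0r.
set Sum := \sum_(f | _) _.
have : Sum = chi la ^+ nu x0 * Sum.
  rewrite {1}/Sum (reindex (shift x0 L la)) /=; last first.
    exists (shift x0 L la^-1) => f _; first exact: shiftK.
    by rewrite -[X in shift _ _ X]invrK shiftK // invr_eq0.
  rewrite mulr_sumr; apply: eq_big => f.
    apply/idP/idP => [|/fam_shift ->//].
    by move=> /(fam_shift x0 sL la^-1); rewrite shiftK.
  move=> _; rewrite Psi_shift mulrCA; congr (_ * (_ * _)).
  by apply: eq_bigr => P PA; rewrite sqdvd_shift // PL.
move=> /eqP; rewrite -subr_eq0 -[X in X - _]mul1r -mulrBl mulf_eq0 => /orP[|/eqP //].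
by rewrite subr_eq0 eq_sym (negbTE chila).
Qed.

End Vanishing.

(** * Uniqueness of the factorization *)

Section FactorInjective.
Variables (Fq : finFieldType) (m : nat).
Implicit Types f g : 'I_m -> {poly Fq}.

Lemma prime_multiplicity f i P : irreducible_poly P -> square_free (\prod_i f i) ->
  P %| f i -> exists2 t, ~~ (P %| t) & \prod_i f i ^+ i.+1 = P ^+ i.+1 * t.
Proof.
move=> irrP sf /dvdpP [s fs].
have f0 j : f j != 0.
  apply: contraNneq (square_free_neq0 sf) => fj0; by rewrite (bigD1 j) //= fj0 mul0r.
have nP : ~~ (P %| s * \prod_(j | j != i) f j).
  apply/negP => Ps; have /negP := (square_freeP (square_free_neq0 sf)).1 sf P irrP; case.
  by rewrite (bigD1 i) //= fs -mulrA mulrCA expr2 dvdp_mul.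
exists (s ^+ i.+1 * \prod_(j | j != i) f j ^+ j.+1); last first.
  by rewrite (bigD1 i) //= fs exprMn -mulrA mulrCA.
apply: contraNN nP => /(irreducible_dvdM irrP) /orP[/(irreducible_dvdX irrP) Ps|].
  by rewrite dvdp_mulr.
rewrite (big_mkcond (fun j => j != i)) /= => /(irreducible_dvd_prod irrP) [j].
case: ifP => [ji /(irreducible_dvdX irrP) Pj | _]; last first.
  by rewrite dvdp1 => /eqP sP; case: irrP; rewrite sP.
by rewrite dvdp_mull // (bigD1 j) //= dvdp_mulr.
Qed.

(** The multiplicity [i.+1] of a prime in the product tells which factor it divides, and a monic
    square-free factor is determined by its primes. *)
Lemma factorization_inj (a b : Fq) f g : a != 0 ->
  (forall i, f i \is monic) -> (forall i, g i \is monic) ->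
  square_free (\prod_i f i) -> square_free (\prod_i g i) ->
  a *: \prod_i f i ^+ i.+1 = b *: \prod_i g i ^+ i.+1 -> a = b /\ f = g.
Proof.
move=> a0 mf mg sf sg E.
have mon (h : 'I_m -> {poly Fq}) : (forall i, h i \is monic) -> \prod_i h i ^+ i.+1 \is monic.
  by move=> mh; apply: monic_prod => i _; rewrite monic_exp.
have ab : a = b.
  by have := congr1 lead_coef E; rewrite !lead_coefZ !(monicP (mon _ _)) // !mulr1.
split=> //; move: E; rewrite -ab => /(scalerI a0) E.
have key (u v : 'I_m -> {poly Fq}) : (forall i, u i \is monic) -> square_free (\prod_i u i) ->
    square_free (\prod_i v i) -> \prod_i u i ^+ i.+1 = \prod_i v i ^+ i.+1 ->
    forall i, u i %| v i.
  move=> mu su sv E' i; apply: square_free_dvdp.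
    by apply: square_free_dvd su; rewrite (bigD1 i) //= dvdp_mulIl.
  move=> P irrP Pu; have [t nt Et] := prime_multiplicity irrP su Pu.
  have [j Pj] : exists j, P %| v j ^+ j.+1.
    by apply: irreducible_dvd_prod => //; rewrite -E' Et exprS -mulrA dvdp_mulIl.
  have {}Pj := irreducible_dvdX irrP Pj.
  have [s ns Es] := prime_multiplicity irrP sv Pj.
  have : i.+1 = j.+1 by apply: (power_dvdp_inj irrP nt ns); rewrite -Et -Es.
  by move=> [] /val_inj ->.
apply/funext => i; apply/eqP; rewrite -eqp_monic // /eqp.
by rewrite (key f g) // (key g f).
Qed.

End FactorInjective.

(** * Summation over the family by factors *)

Section FamilySum.
Variables (Fq : finFieldType) (p : nat) (d : 'I_p.-1 -> nat).
Hypothesis d_gt0 : forall i, (0 < d i)%N.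
Local Notation n := (\sum_(i < p.-1) d i).+1.
Local Notation T := ({ffun 'I_p.-1 -> {poly_n Fq}}).

(** Since all [d i] are positive in this section, the truncated subtraction is exact. *)
Definition lowered (o : option 'I_p.-1) (i : 'I_p.-1) := (d i - (o == Some i))%N.

Lemma lowered_lt o i : (lowered o i < n)%N.
Proof. by rewrite ltnS (leq_trans (leq_subr _ _)) // (bigD1 i) //= leq_addr. Qed.

Lemma sum_lowered_lt o : (\sum_i lowered o i < n)%N.
Proof. by rewrite ltnS leq_sum // => i _; rewrite leq_subr. Qed.

Lemma finite_family : finite_set [set F : {poly Fq} | Fhat_union d F]%classic.
Proof. exact: finite_Fhat_union. Qed.

(** The parametrization is injective: [factorization_inj] recovers [a] and [f], and the degrees of
    [f] then recover [o]. *)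
Lemma big_Fhat_union (V : nmodType) (h : {poly Fq} -> V) :
  \sum_(F <- fset_set [set F : {poly Fq} | Fhat_union d F]%classic) h F =
  \sum_(o : option 'I_p.-1) \sum_(a : Fq | a != 0)
    \sum_(f : T | fam (lowered o) f && good f) h (a *: prodX f).
Proof.
rewrite [RHS](eq_bigr (fun o => \sum_(z : Fq * T | (z.1 != 0) &&
  (fam (lowered o) z.2 && good z.2)) h (z.1 *: prodX z.2))); last first.
  by move=> o _; rewrite pair_big_dep.
rewrite pair_big_dep /=.
pose Z := (option 'I_p.-1 * (Fq * T))%type.
pose Q (z : Z) := [&& z.2.1 != 0, fam (lowered z.1) z.2.2 & good z.2.2].
pose Fm (z : Z) := z.2.1 *: prodX z.2.2.
have QP z : Q z -> [/\ z.2.1 != 0, forall i, (z.2.2 i : {poly Fq}) \is monic,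
    forall i, size (z.2.2 i : {poly Fq}) = (lowered z.1 i).+1 &
    square_free (\prod_i (z.2.2 i : {poly Fq}))].
  move=> /and3P[z0 fz gz]; split=> //.
  - by move=> i; have /forallP /(_ i) := fz; rewrite inE => /andP[].
  - by move=> i; have /forallP /(_ i) := fz; rewrite inE => /andP[_ /eqP].
  - by apply/(sqr_free_good (sum_lowered_lt z.1) fz).
transitivity (\sum_(z in [pred z | Q z]) h (Fm z)); last exact: eq_bigl.
rewrite -big_enum /=.
rewrite -(big_map Fm xpredT h); apply: perm_big; apply: uniq_perm.
- exact: fset_uniq.
- rewrite map_inj_in_uniq ?enum_uniq // => -[ o [a f]] [ o' [b g]].
  rewrite !mem_enum !inE => /QP /= [a0 mf df sf] /QP /= [b0 mg dg sg].
  rewrite /Fm /prodX /= => /(factorization_inj a0 mf mg sf sg) [ab fg].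
  have {}fg : f = g by apply/ffunP => i; apply: val_inj; exact: (congr1 (fun h => h i) fg).
  congr (_, (_, _)) => //; move: df dg; rewrite fg => df dg.
  have E i : (o == Some i) = (o' == Some i).
    have := df i; rewrite dg => -[]; rewrite /lowered; have := d_gt0 i.
    by case: (d i) => // c _; case: (o == _); case: (o' == _); rewrite ?subn0 ?subSS ?subn0 //= => /eqP; rewrite ?(gtn_eqF (leqnn _)) ?(ltn_eqF (leqnn _)).
  case: o o' E {df dg} => [i|] [j|] // E.
  - by have := E i; rewrite eqxx => /esym /eqP ->.
  - by have := E i; rewrite eqxx.
  - by have := E j; rewrite eqxx.
move=> F; rewrite in_fset_set; last exact: finite_family.
apply/idP/mapP => [/set_mem /Fhat_unionP [a [f [ o [a0 mf sf df ->]]]]|].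
  have sfn i : (size (f i) <= n)%N.
    by apply: leq_trans (lowered_lt o i); rewrite /lowered -subSn ?leq_b1 ?(leq_trans (leq_b1 _)) // -df addnK.
  have fE : (fun i => (npolyp n (f i) : {poly Fq})) = f.
    by apply/funext => i; rewrite npolypK.
  pose g : T := [ffun i => npolyp n (f i)].
  have gE i : (g i : {poly Fq}) = f i by rewrite ffunE npolypK.
  exists (o, (a, g)).
    rewrite mem_enum inE; apply/and3P; split=> //.
      apply/forallP => i; rewrite inE gE mf /=; apply/eqP; rewrite /lowered.
      by rewrite -subSn ?(leq_trans (leq_b1 _)) // -df addnK.
    apply/(@sqr_free_good _ n _ (lowered o)).
    - exact: sum_lowered_lt.
    - apply/forallP => i; rewrite inE gE mf /=; apply/eqP; rewrite /lowered.
      by rewrite -subSn ?(leq_trans (leq_b1 _)) // -df addnK.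
    by rewrite (eq_bigr f) // => i _; rewrite gE.
  rewrite /Fm /prodX /=; congr (_ *: _); apply: eq_bigr => i _; by rewrite gE.
move=> [[ o [a f]] zQ ->]; move: zQ; rewrite mem_enum => zQ.
have /QP /= [a0 mf df sf] : Q (o, (a, f)) by [].
apply: mem_set; apply/Fhat_unionP; exists a, (fun i => (f i : {poly Fq})), o; split=> // i.
rewrite df /lowered addSn subnK // (leq_trans (leq_b1 _)) //.
Qed.

End FamilySum.

(** * Mixed character moments over the family *)

Section Moments.
Variables (Fq : finFieldType) (p : nat) (d : 'I_p.-1 -> nat).
Variables (R : realType) (chi : Fq -> R[i]).
Hypotheses (p_prime : prime p) (p_odd : odd p) (chiP : character_of_order p chi).
Hypothesis Dp : (p %| \sum_(i < p.-1) i.+1 * d i)%N.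
Hypothesis d_gt0 : forall i, (0 < d i)%N.
Local Notation n := (\sum_(i < p.-1) d i).+1.
Local Notation T := ({ffun 'I_p.-1 -> {poly_n Fq}}).
Local Notation S := (fset_set [set F : {poly Fq} | Fhat_union d F]%classic).
Local Notation q := (#|Fq|%:R : R).
Local Notation r := (#|'I_p.-1|%:R : R).

Let Qd : R := \prod_i q ^+ d i.
Let N : R := (#|` S|)%:R.

Definition moment (nu : option Fq -> nat) (F : {poly Fq}) : R[i] :=
  \prod_(x : option Fq) chi (proj_value p F x) ^+ nu x.

Lemma chi_norm x : x != 0 -> `|chi x| = 1.
Proof.
move=> x0; have /eqP := congr1 (fun z => `|z|) (chi_pow_p chiP x0).
by rewrite normrX normr1 pexpr_eq1 ?normr_ge0 ?prime_gt0 // => /eqP.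
Qed.

Lemma chi_eq0 : chi 0 = 0. Proof. by case: chiP. Qed.

Lemma chi_norm_le1 x : `|chi x| <= 1.
Proof.
have [->|x0] := eqVneq x 0; first by rewrite chi_eq0 normr0.
by rewrite chi_norm.
Qed.

Lemma chi_mul : {morph chi : x y / x * y}. Proof. by case: chiP. Qed.

Lemma family_mem o (a : Fq) (f : T) : a != 0 -> fam (lowered d o) f && good f ->
  Fhat_union d (a *: prodX f).
Proof.
move=> a0 /andP[ff gf]; apply/Fhat_unionP.
exists a, (fun i => (f i : {poly Fq})), o; split=> //.
- by move=> i; have /forallP /(_ i) := ff; rewrite inE => /andP[].
- by apply/(sqr_free_good (sum_lowered_lt d o) ff).
move=> i; have /forallP /(_ i) := ff; rewrite inE => /andP[_ /eqP ->].
by rewrite /lowered addSn subnK // (leq_trans (leq_b1 _)).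
Qed.

Lemma proj_value_family o (a : Fq) (f : T) : a != 0 -> fam (lowered d o) f && good f ->
  proj_value p (a *: prodX f) None = if o == None then a else 0.
Proof.
move=> a0 fg; rewrite (proj_value_infinity p_prime Dp (family_mem a0 fg)).
have /andP[/forallP ff _] := fg; rewrite coefZ.
have sf i : size (f i : {poly Fq}) = (lowered d o i).+1.
  by have := ff i; rewrite inE => /andP[_ /eqP].
have sfd i : (size (f i : {poly Fq}) <= (d i).+1)%N by rewrite sf ltnS leq_subr.
have sfX (i : 'I_p.-1) : (size ((f i : {poly Fq}) ^+ i.+1) <= (i.+1 * d i).+1)%N.
  exact: size_expn_leqS.
have := congr1 (fun h : {poly Fq} => h`_0) (rev_poly_prod sfX).
rewrite coef_rev_poly subn0 /= => ->.
rewrite -horner_coef0 horner_prod.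
have E (i : 'I_p.-1) : (rev_poly (i.+1 * d i) ((f i : {poly Fq}) ^+ i.+1)).[0] =
    (f i : {poly Fq})`_(d i) ^+ i.+1.
  by rewrite horner_coef0 coef_rev_poly subn0 /= coef_topX.
rewrite (eq_bigr _ (fun i _ => E i)).
case: o fg ff sf => [j|] _ ff sf.
  rewrite (bigD1 j) //= nth_default ?expr0n ?mul0r ?mulr0 //.
  by rewrite sf /lowered eqxx subn1 prednK.
rewrite big1 ?mulr1 // => i _.
have -> : (f i : {poly Fq})`_(d i) = lead_coef (f i : {poly Fq}).
  by rewrite lead_coefE sf /lowered subn0.
by have := ff i; rewrite inE => /andP[/monicP -> _]; rewrite expr1n.
Qed.

Lemma moment_family nu o (a : Fq) (f : T) : a != 0 -> fam (lowered d o) f && good f ->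
  moment nu (a *: prodX f) =
  chi (if o == None then a else 0) ^+ nu None *
    chi a ^+ (\sum_x nu (Some x)) * Psi chi (fun x => nu (Some x)) f.
Proof.
move=> a0 fg; rewrite /moment (bigD1 None) //= -/(proj_value p _ None) (proj_value_family a0 fg).
rewrite -mulrA; congr (_ * _).
rewrite (reindex_omap (@Some Fq) id) /=; last by case.
rewrite (eq_bigl xpredT) => [|x]; last by rewrite eqxx.
rewrite -prodrXr -big_split /=; apply: eq_bigr => x _.
by rewrite hornerZ chi_mul exprMn.
Qed.

Lemma Qd_gt0 : 0 < Qd.
Proof. by rewrite prodr_gt0 // => i _; rewrite exprn_gt0 // (q_gt0 Fq R). Qed.

Lemma q_ge1 : 1 <= q.
Proof. by rewrite ler1n; apply/card_gt0P; exists 0. Qed.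

Lemma card_lowered o : \prod_i q ^+ lowered d o i <= Qd.
Proof.
apply: ler_prod => i _; rewrite exprn_ge0 ?ler0n //=.
by rewrite ler_weXn2l ?q_ge1 // leq_subr.
Qed.

Lemma card_lowered_Some j : \prod_i q ^+ lowered d (Some j) i = Qd / q.
Proof.
have q0 := q_gt0 Fq R.
rewrite /Qd (bigD1 j) //= [in RHS](bigD1 j) //= mulrAC; congr (_ * _).
  rewrite /lowered eqxx subn1 -{2}(prednK (d_gt0 j)) exprS mulrAC mulfV ?mul1r //.
  by rewrite gt_eqF.
apply: eq_bigr => i ij; rewrite /lowered.
have -> : (Some j == Some i) = false by apply/eqP => -[ji]; rewrite ji eqxx in ij.
by rewrite subn0.
Qed.

Lemma card_units : \sum_(a : Fq | a != 0) 1 = q - 1 :> R.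
Proof.
rewrite sumr_const (@eq_card _ _ (predC1 0)) // cardC1 -subn1 mulrnBr //.
by apply/card_gt0P; exists 0.
Qed.

Lemma card_option_ord : #|{: option 'I_p.-1}|%:R = p%:R :> R.
Proof. by rewrite card_option card_ord prednK ?prime_gt0. Qed.

(** Only members without lowered degree are counted. By [sum_not_good] at most half of the tuples
    fail to be square-free once [q >= 4 r ^+ 2]. *)
Lemma N_ge : 2 <= q -> 4 * r ^+ 2 <= q -> (q - 1) * Qd / 2 <= N.
Proof.
move=> q2 qr; have q0 := q_gt0 Fq R.
rewrite /N card_fset_sum1 natr_sum (big_Fhat_union d_gt0 (fun=> 1)).
rewrite (bigD1 None) //=.
set u := \sum_(a | _) _; set v := \sum_(o | _) _.
have v0 : 0 <= v by do 3 (apply: sumr_ge0 => ? _).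
apply: (@le_trans _ _ u); last by rewrite lerDl.
rewrite /u -mulrA -card_units mulr_suml; apply: ler_sum => a _; rewrite mul1r.
have := card_fam Fq R (lowered_lt d None); have := sum_not_good (lowered_lt d None) q2.
rewrite [\sum_(f | fam _ _) 1](bigID (@good Fq n 'I_p.-1)) /= => h1 h2.
have E : \prod_i q ^+ lowered d None i = Qd by apply: eq_bigr => i _; rewrite /lowered subn0.
rewrite E in h1 h2.
have h3 : 2 * r ^+ 2 / q * Qd <= Qd / 2.
  rewrite [leRHS]mulrC ler_wpM2r ?(ltW Qd_gt0) // ler_pdivrMr //.
  by move: qr; set rr := r ^+ 2; set qq := q; lra.
have := lerD h1 (lexx (\sum_(f : T | fam (lowered d None) f && good f) (1 : R))).
rewrite [leLHS]addrC h2 => h4.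
have h5 : Qd <= Qd / 2 + \sum_(f : T | fam (lowered d None) f && good f) 1.
  by apply: le_trans h4 _; rewrite lerD2r.
lra.
Qed.

Lemma sum_chi (k : nat) : ~~ (p %| k)%N -> \sum_(a : Fq | a != 0) chi a ^+ k = 0.
Proof.
move=> pk; have [la la0 cla] := character_nontrivial chiP pk.
set s := \sum_(a | _) _.
have : s = chi la ^+ k * s.
  rewrite {1}/s (reindex_inj (mulfI la0)) /= mulr_sumr.
  apply: eq_big => [a|a _]; first by rewrite mulf_eq0 (negbTE la0).
  by rewrite chi_mul exprMn.
move=> /eqP; rewrite -subr_eq0 -[X in X - _]mul1r -mulrBl mulf_eq0 => /orP[|/eqP //].
by rewrite subr_eq0 eq_sym (negbTE cla).
Qed.

(** If [p] fails to divide the exponent at a finite point, sieve and vanishing lemma apply; the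
    strict bound on [d i] leaves room for a lowered degree. Otherwise it fails only at infinity:
    lowered members have [F(infinity) = 0], and for the others the sum over the leading coefficient
    vanishes. The constant [2 p] combines the [p] choices of [o] with the factor 2 of [N_ge]. *)
Lemma moment_nontrivial (nu : option Fq -> nat) (k m : nat) : 2 <= q -> 4 * r ^+ 2 <= q ->
  (exists x, ~~ (p %| nu x)%N) -> (#|[set x | nu (Some x) != 0%N]| <= k)%N ->
  (forall i, (2 * m + k < d i)%N) ->
  `|\sum_(F <- S) moment nu F| <= (2 * p%:R * expR (r ^+ 2) * (2 / q) ^+ m * N)%:C.
Proof.
move=> q2 qr nontriv supp dk; have q0 := q_gt0 Fq R.
have B0 : 0 <= (2 / q) ^+ m * expR (r ^+ 2).
  by rewrite mulr_ge0 ?expR_ge0 // exprn_ge0 // divr_ge0 // ltW.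
apply: (@le_trans _ _ (p%:R * ((q - 1) * ((2 / q) ^+ m * expR (r ^+ 2) * Qd)))%:C); last first.
  rewrite lecR; have := N_ge q2 qr; rewrite ler_pdivrMr // => NN.
  rewrite [leRHS](_ : _ = p%:R * ((2 / q) ^+ m * expR (r ^+ 2)) * (N * 2)); last by ring.
  rewrite [leLHS](_ : _ = p%:R * ((2 / q) ^+ m * expR (r ^+ 2)) * ((q - 1) * Qd)); last by ring.
  by rewrite ler_wpM2l // mulr_ge0.
rewrite (big_Fhat_union d_gt0).
have p2 : (2 < p)%N by apply: odd_prime_gt2.
have i0lt : (0 < p.-1)%N by move: p2; case: (p) => [|[|]].
pose i0 : 'I_p.-1 := Ordinal i0lt.
have E o : \sum_(a | a != 0) \sum_(f : T | fam (lowered d o) f && good f) moment nu (a *: prodX f) =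
    \sum_(a | a != 0) chi (if o == None then a else 0) ^+ nu None *
      chi a ^+ (\sum_x nu (Some x)) *
    \sum_(f : T | fam (lowered d o) f && good f) Psi chi (fun x => nu (Some x)) f.
  by apply: eq_bigr => a a0; rewrite mulr_sumr; apply: eq_bigr => f fg; rewrite (moment_family nu a0 fg).
rewrite (eq_bigr _ (fun o _ => E o)).
have [[x0 nux0]|triv] := pselect (exists x0, ~~ (p %| nu (Some x0))%N).
  apply: le_trans (ler_norm_sum _ _ _) _.
  apply: (@le_trans _ _ (\sum_(o : option 'I_p.-1) \sum_(a : Fq | a != 0)
      ((2 / q) ^+ m * expR (r ^+ 2) * Qd)%:C)); last first.
    rewrite -!rmorph_sum /= lecR sumr_const card_option card_ord prednK ?prime_gt0 //.
    rewrite -[leLHS]mulr_natl ler_wpM2l // -card_units mulr_suml.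
    by apply: ler_sum => a _; rewrite mul1r.
  apply: ler_sum => o _; apply: le_trans (ler_norm_sum _ _ _) _.
  apply: ler_sum => a a0; rewrite !normrM.
  apply: (@le_trans _ _ `|\sum_(f : T | fam (lowered d o) f && good f)
      Psi chi (fun x => nu (Some x)) f|).
    rewrite -[leRHS]mul1r ler_wpM2r // mulr_ile1 // normrX exprn_ile1 ?chi_norm_le1 //.
  apply: (@le_trans _ _ ((2 / q) ^+ m * expR (r ^+ 2) * \prod_i q ^+ lowered d o i)%:C).
    apply: (sieve_bound (lowered_lt d o)) => //.
      move=> f; rewrite /Psi normr_prod prodr_ile1 // => x _.
      by rewrite normr_ge0 normrX exprn_ile1 ?chi_norm_le1.
    move=> A pA dA; apply: (@sum_Psi_vanish _ _ _ _ _ _ i0 chiP (lowered_lt d o) _ _ _ m k x0) => //.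
    apply: (@leq_trans (d i0).-1); first by have := dk i0; case: (d i0).
    by rewrite -subn1 leq_sub2l // leq_b1.
  by rewrite lecR ler_wpM2l // card_lowered.
have pS x : (p %| nu (Some x))%N by apply: contrapT => /negP H; apply: triv; exists x.
have pN : ~~ (p %| nu None)%N.
  by have [[x|]] := nontriv; first by rewrite pS.
have nuN0 : nu None != 0%N by apply: contraNneq pN => ->.
rewrite big1 ?normr0 => [|o _].
  by rewrite lecR mulr_ge0 // mulr_ge0 ?subr_ge0 ?q_ge1 // mulr_ge0 // ltW // Qd_gt0.
rewrite -mulr_suml; case: o {E} => [j|] /=.
  by rewrite big1 ?mul0r // => a a0; rewrite chi_eq0 expr0n (negbTE nuN0) mul0r.
rewrite (eq_bigr (fun a => chi a ^+ nu None)); first by rewrite sum_chi // mul0r.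
move=> a a0; have /dvdnP [c ->] : (p %| \sum_x nu (Some x))%N by apply: dvdn_sum.
by rewrite mulnC exprM (chi_pow_p chiP) // expr1n mulr1.
Qed.

Lemma norm_moment_le1 nu F : `|moment nu F| <= 1.
Proof.
rewrite /moment normr_prod prodr_ile1 // => x _.
by rewrite normr_ge0 normrX exprn_ile1 ?chi_norm_le1.
Qed.

(** The moment equals 1 unless [F] vanishes at one of the at most [k] points of the support, and
    each point is a zero of a proportion [O(1/q)] of the members. At infinity these are the lowered
    members, whose factor tuples are rarer by a factor [q]. *)
Lemma moment_trivial (nu : option Fq -> nat) (k : nat) : 2 <= q -> 4 * r ^+ 2 <= q ->
  (forall x, (p %| nu x)%N) -> (#|[set x | nu x != 0%N]| <= k)%N ->
  `|\sum_(F <- S) (moment nu F - 1)| <= (4 * p%:R ^+ 2 * k%:R / q * N)%:C.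
Proof.
move=> q2 qr triv supp; have q0 := q_gt0 Fq R.
pose Z x (F : {poly Fq}) : R := (proj_value p F x == 0)%:R.
have bound F : `|moment nu F - 1| <= (\sum_(x | nu x != 0%N) 2 * Z x F)%:C.
  have [[x nx Fx]|nz] := pselect (exists2 x, nu x != 0%N & proj_value p F x = 0).
    apply: (@le_trans _ _ 2); first by rewrite (le_trans (ler_normB _ _)) // normr1 lerD // norm_moment_le1.
    rewrite -(rmorph_nat (real_complex R)) lecR (bigD1 x) //= /Z Fx eqxx mulr1 lerDl.
    by apply: sumr_ge0 => y _; apply: mulr_ge0; rewrite ?ler0n.
  rewrite /moment big1 ?subrr ?normr0.
    by rewrite lecR; apply: sumr_ge0 => y _; apply: mulr_ge0; rewrite ?ler0n.
  move=> x _; have [->|nx] := eqVneq (nu x) 0%N; first by rewrite expr0.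
  have Fx : proj_value p F x != 0 by apply/eqP => Fx; apply: nz; exists x.
  by have /dvdnP [c ->] := triv x; rewrite mulnC exprM (chi_pow_p chiP) // expr1n.
apply: le_trans (ler_norm_sum _ _ _) _.
apply: le_trans (ler_sum _ (fun F _ => bound F)) _.
rewrite -rmorph_sum /= lecR exchange_big /=.
have zero x : \sum_(F <- S) Z x F <= p%:R ^+ 2 / q * ((q - 1) * Qd).
  rewrite (big_Fhat_union d_gt0 (Z x)).
  have rp : r <= p%:R by rewrite card_ord ler_nat leq_pred.
  case: x => [x|].
    apply: (@le_trans _ _ (\sum_(o : option 'I_p.-1) \sum_(a : Fq | a != 0) (r / q * Qd))).
      apply: ler_sum => o _; apply: ler_sum => a a0.
      apply: (@le_trans _ _ (\sum_(f : T | fam (lowered d o) f &&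
          ((\prod_i (f i : {poly Fq})).[x] == 0)) 1)).
        rewrite big_mkcond [leRHS]big_mkcond /=; apply: ler_sum => f _.
        rewrite /Z /= hornerZ mulf_eq0 (negbTE a0) /= /prodX !horner_prod.
        case: ifP => [/andP[-> _]|_]; last by case: ifP.
        case: eqP => [|_]; last by case: ifP.
        move/eqP; rewrite prodf_seq_eq0 => /hasP [i _ /=]; rewrite horner_exp expf_eq0 /= => fi0.
        suff -> : \prod_i (f i : {poly Fq}).[x] == 0 by [].
        by apply/prodf_eq0; exists i.
      apply: le_trans (sum_root R (lowered_lt d o) x) _.
      by rewrite ler_wpM2l ?card_lowered // divr_ge0 // ltW.
    rewrite sumr_const -[leLHS]mulr_natl card_option_ord.
    rewrite (_ : \sum_(a | a != 0) r / q * Qd = (q - 1) * (r / q * Qd)); last first.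
      by rewrite -card_units mulr_suml; apply: eq_bigr => a _; rewrite mul1r.
    rewrite [leLHS](_ : _ = p%:R * r * (q^-1 * ((q - 1) * Qd))); last by ring.
    rewrite -[leRHS]mulrA expr2 ler_wpM2r ?ler_wpM2l //.
    by rewrite mulr_ge0 ?invr_ge0 ?(ltW q0) // mulr_ge0 ?subr_ge0 ?q_ge1 // ltW // Qd_gt0.
  apply: (@le_trans _ _ (\sum_(o : option 'I_p.-1) \sum_(a : Fq | a != 0) (Qd / q))).
    apply: ler_sum => o _; apply: ler_sum => a a0.
    case: o => [j|].
      rewrite -(card_lowered_Some j) -(card_fam Fq R (lowered_lt d (Some j))).
      rewrite big_mkcondr; apply: ler_sum => f _; case: ifP => // _.
      by rewrite /Z; case: (_ == 0); rewrite ?ler01.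
    rewrite big1 ?divr_ge0 ?(ltW q0) ?(ltW Qd_gt0) // => f fg.
    by rewrite /Z (proj_value_family a0 fg) (negbTE a0).
  rewrite sumr_const -[leLHS]mulr_natl card_option_ord.
  rewrite (_ : \sum_(a | a != 0) Qd / q = (q - 1) * (Qd / q)); last first.
    by rewrite -card_units mulr_suml; apply: eq_bigr => a _; rewrite mul1r.
  rewrite [leLHS](_ : _ = p%:R * (q^-1 * ((q - 1) * Qd))); last by ring.
  rewrite -[leRHS]mulrA ler_wpM2r //.
    by rewrite mulr_ge0 ?invr_ge0 ?(ltW q0) // mulr_ge0 ?subr_ge0 ?q_ge1 // ltW // Qd_gt0.
  by rewrite expr2 ler_peMl // ler1n prime_gt0.
apply: (@le_trans _ _ (\sum_(x | nu x != 0%N) 2 * (p%:R ^+ 2 / q * ((q - 1) * Qd)))).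
  by apply: ler_sum => x _; rewrite -mulr_sumr ler_wpM2l.
rewrite sumr_const -[leLHS]mulr_natl.
have := N_ge q2 qr; rewrite ler_pdivrMr // => NN.
have pq0 : 0 <= p%:R ^+ 2 / q :> R by rewrite divr_ge0 ?exprn_ge0 ?(ltW q0).
have u0 : 0 <= (q - 1) * Qd by rewrite mulr_ge0 ?subr_ge0 ?q_ge1 // ltW // Qd_gt0.
apply: (@le_trans _ _ (k%:R * (2 * (p%:R ^+ 2 / q * ((q - 1) * Qd))))).
  apply: ler_wpM2r; first by apply: mulr_ge0 => //; apply: mulr_ge0.
  by rewrite ler_nat; move: supp; rewrite cardsE.
rewrite [leRHS](_ : _ = k%:R * (2 * (p%:R ^+ 2 / q * (N * 2)))); last by ring.
by rewrite !ler_wpM2l.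
Qed.

End Moments.

(** * The independent model *)

Section CosTaylor.
Variable R : realType.
Implicit Types (c y : R).

Lemma derive_ge0_le (h dh : R -> R) : (forall x : R, is_derive x 1 h (dh x)) ->
  (forall x, 0 <= x -> 0 <= dh x) -> forall y, 0 <= y -> h 0 <= h y.
Proof.
move=> hd dh0 y y0.
have hc : {within `[0, y], continuous h}%classic.
  apply: continuous_subspaceT => x; apply/differentiable_continuous/derivable1_diffP.
  by have [] := hd x.
have [x xy] := MVT_segment y0 (fun x _ => hd x) hc.
move=> E; rewrite -subr_ge0 E subr0 mulr_ge0 // dh0 //.
by move: xy; rewrite in_itv /= => /andP[].
Qed.

(** The Taylor polynomial of [cos (c + y)] at [y = 0]: each derivative adds [pi / 2] to the phase.
    Carrying the phase [c] also covers the sine. *)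
Definition cos_taylor c n : {poly R} :=
  \poly_(k < n) (cos (c + k%:R * (pi / 2)) / k`!%:R).

Lemma deriv_cos_taylor c n : (cos_taylor c n.+1)^`() = cos_taylor (c + pi / 2) n.
Proof.
apply/polyP => k; rewrite coef_deriv !coef_poly ltnS; case: ltnP => _; last by rewrite mul0rn.
rewrite -addrA -[X in c + (X + _)]mul1r -mulrDl nat1r factS natrM.
have k1 : k.+1%:R != 0 :> R by rewrite pnatr_eq0.
by rewrite -[LHS]mulr_natr -mulrA; congr (_ * _); rewrite invfM mulrAC mulVf // mul1r.

Qed.

(** The derivative of the remainder is the remainder of order one less with phase [c + pi / 2]. By
    induction it is dominated by the derivative of [y ^+ n.+1 / (n.+1)!], and both vanish at 0. *)
Lemma cos_taylor_ge0 n : forall c y, 0 <= y ->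
  `|cos (c + y) - (cos_taylor c n).[y]| <= y ^+ n / n`!%:R.
Proof.
elim: n => [|n IH] c y y0.
  by rewrite /cos_taylor poly_def big_ord0 horner0 subr0 expr0 divr1 cos_max.
pose g x := cos (c + x) - (cos_taylor c n.+1).[x].
pose dg x := cos (c + pi / 2 + x) - (cos_taylor (c + pi / 2) n).[x].
have gd (x : R) : is_derive x 1 g (dg x).
  have -> : dg x = - sin (c + x) * (0 + 1) - (cos_taylor c n.+1)^`().[x].
    by rewrite deriv_cos_taylor /dg addrAC cosDpihalf add0r mulr1.
  have cd : is_derive x 1 (fun x => cos (c + x)) (- sin (c + x) * (0 + 1)).
    apply: (@is_derive1_comp _ (@cos R) (fun x : R => c + x) x).
  exact: (@is_deriveB _ _ _ (fun x => cos (c + x)) (horner (cos_taylor c n.+1))).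
pose P := ((n.+1)`!%:R^-1 : R) *: ('X^(n.+1) : {poly R}).
have Pd (x : R) : is_derive x 1 (horner P) (x ^+ n / n`!%:R).
  have -> : x ^+ n / n`!%:R = P^`().[x].
    rewrite /P derivZ derivXn hornerZ hornerMn hornerXn factS natrM invfM /= -[x ^+ n *+ _]mulr_natr.
    have : n.+1%:R != 0 :> R by rewrite pnatr_eq0.
    have : n`!%:R != 0 :> R by rewrite pnatr_eq0 -lt0n fact_gt0.
    set u := n`!%:R; set v := n.+1%:R => u0 v0; field; exact/andP.
  exact: is_derive_poly.
have Px x : P.[x] = x ^+ n.+1 / (n.+1)`!%:R by rewrite hornerZ hornerXn mulrC.
have g0 : g 0 = 0.
  by rewrite /g addr0 horner_poly big_ord_recl /= !mul0r addr0 expr0 mulr1 divr1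
    big1 ?addr0 ?subrr // => i _; rewrite expr0n mulr0.
have dgle x : 0 <= x -> `|dg x| <= x ^+ n / n`!%:R by exact: IH.
rewrite -/(g y) -Px ler_norml lerNl.
have P0 : P.[0] = 0 by rewrite Px expr0n mul0r.
apply/andP; split; rewrite -subr_ge0.
  have H := @derive_ge0_le (horner P + g) (fun x => x ^+ n / n`!%:R + dg x)
    (fun x => is_deriveD (Pd x) (gd x)) _ y y0.
  apply: le_trans (_ : P.[y] + g y <= _); last by rewrite opprK.
  apply: le_trans (_ : P.[0] + g 0 <= _); first by rewrite P0 g0 addr0.
  apply: H => x x0; rewrite addrC -lerBlDr sub0r.
  by have := dgle x x0; rewrite ler_norml => /andP[].
have H := @derive_ge0_le (horner P - g) (fun x => x ^+ n / n`!%:R - dg x)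
  (fun x => is_deriveB (Pd x) (gd x)) _ y y0.
apply: le_trans (_ : P.[0] - g 0 <= _); first by rewrite P0 g0 subr0.
by apply: H => x x0; have := dgle x x0; rewrite ler_norml => /andP[_]; rewrite subr_ge0.
Qed.

Lemma cos_taylorN c n y : (cos_taylor c n).[- y] = (cos_taylor (- c) n).[y].
Proof.
rewrite !horner_poly; apply: eq_bigr => k _; rewrite exprNn [LHS]mulrA; congr (_ * _).
rewrite [LHS]mulrAC; congr (_ / _); rewrite -[RHS]cosN opprD opprK.
have -> : c + k%:R * (pi / 2) = c - k%:R * (pi / 2) + pi *+ k.
  by rewrite -mulr_natl; field.
rewrite (alternatingn (@cosDpi R)) -signr_odd; case: (odd k);
  by rewrite /= ?expr0 ?expr1 ?mulr1 ?mul1r // mulN1r mulrN1 opprK.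
Qed.

Lemma cos_taylor_bound c n y :
  `|cos (c + y) - (cos_taylor c n).[y]| <= `|y| ^+ n / n`!%:R.
Proof.
have [y0|/ltW y0] := leP 0 y; first by rewrite (ger0_norm y0) //; exact: cos_taylor_ge0.
rewrite (ler0_norm y0) //; have := @cos_taylor_ge0 n (- c) (- y).
by rewrite -cos_taylorN opprK -opprD cosN; apply; rewrite oppr_ge0.
Qed.

Lemma coef_cos_taylor_le c n k : `|(cos_taylor c n)`_k| <= k`!%:R^-1.
Proof.
rewrite coef_poly; case: ltnP => _; last by rewrite normr0 invr_ge0.
by rewrite normrM [X in _ * X]ger0_norm ?invr_ge0 // ler_piMl ?invr_ge0 // cos_max.
Qed.

Lemma cos_taylor3 y : (cos_taylor 0 3).[y] = 1 - 2^-1 * y ^+ 2.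
Proof.
rewrite horner_poly !big_ord_recr big_ord0 /=.
have -> : 2%:R * (pi / 2) = pi :> R by field.
rewrite !add0r mul0r mul1r cos0 cos_pihalf cospi.
have -> : 2`!%:R = 2 :> R by [].
by rewrite mul0r mul0r addr0 expr0 divr1 mulr1 mulN1r mulNr.
Qed.

Lemma sin_taylor3 y : (cos_taylor (- (pi / 2)) 3).[y] = y.
Proof.
rewrite horner_poly !big_ord_recr big_ord0 /=.
have -> : - (pi / 2) + 2%:R * (pi / 2) = pi / 2 :> R by field.
rewrite add0r mul0r mul1r addr0 addNr cosN cos_pihalf cos0.
by rewrite !mul0r addr0 add0r divr1 mul1r expr1.
Qed.

End CosTaylor.

Section FiniteMean.
Variables (K : numFieldType).

Definition fmean (A : finType) (h : A -> K) : K := (\sum_a h a) / #|A|%:R.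

Lemma fmean_prod (P U : finType) (g : P -> U -> K) :
  fmean (fun t : {ffun P -> U} => \prod_x g x (t x)) = \prod_x fmean (g x).
Proof. by rewrite /fmean prodf_div prodr_const -natrX -card_ffun bigA_distr_bigA. Qed.

Variable A : finType.
Implicit Types g h : A -> K.

Lemma ler_fmean g h : (forall a, g a <= h a) -> fmean g <= fmean h.
Proof. by move=> gh; rewrite ler_wpM2r ?invr_ge0 // ler_sum. Qed.

Lemma fmean_cst (c : K) : (0 < #|A|)%N -> fmean (fun _ : A => c) = c.
Proof.
by move=> A0; rewrite /fmean sumr_const -[X in X / _]mulr_natr mulfK // pnatr_eq0 -lt0n.
Qed.

Lemma fmeanD g h : fmean (fun a => g a + h a) = fmean g + fmean h.
Proof. by rewrite /fmean big_split mulrDl. Qed.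

Lemma fmeanZ c h : fmean (fun a => c * h a) = c * fmean h.
Proof. by rewrite /fmean -mulr_sumr mulrA. Qed.

Lemma fmeanB g h : fmean (fun a => g a - h a) = fmean g - fmean h.
Proof. by rewrite /fmean sumrB mulrBl. Qed.

Lemma fmean_sum (I : finType) (h : I -> A -> K) :
  fmean (fun a => \sum_i h i a) = \sum_i fmean (h i).
Proof. by rewrite /fmean exchange_big mulr_suml. Qed.

Lemma ler_norm_fmean h : `|fmean h| <= fmean (fun a => `|h a|).
Proof.
by rewrite normrM normfV normr_nat ler_wpM2r ?invr_ge0 // ler_norm_sum.
Qed.

End FiniteMean.

Lemma norm_exprB_le (K : numDomainType) (z w : K) n : `|z| <= 1 -> `|w| <= 1 ->
  `|z ^+ n - w ^+ n| <= n%:R * `|z - w|.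
Proof.
move=> z1 w1; rewrite subrXX normrM mulrC ler_wpM2r //.
apply: le_trans (ler_norm_sum _ _ _) _.
rewrite -[n in leRHS]card_ord -sumr_const; apply: ler_sum => i _.
by rewrite normrM !normrX mulr_ile1 // ?exprn_ge0 // exprn_ile1.
Qed.

Section Exp.
Variable R : realType.
Implicit Types x y z : R.

Lemma expR_le1Dx z : z <= 1 / 2 -> expR z <= 1 + z + 2 * z ^+ 2.
Proof.
move=> z2; have h : 0 < 1 - z by lra.
apply: (@le_trans _ _ (1 - z)^-1).
  by rewrite -[expR z]invrK -expRN lef_pV2 ?posrE ?expR_gt0 // expR_ge1Dx.
rewrite -[leLHS]mul1r ler_pdivrMr // -subr_ge0.
have -> : (1 + z + 2 * z ^+ 2) * (1 - z) - 1 = z ^+ 2 * (1 - 2 * z) by ring.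
by rewrite mulr_ge0 ?sqr_ge0 //; lra.
Qed.

Lemma expr_norm_le_exp x (k : nat) : `|x| ^+ k / k`!%:R <= expR x + expR (- x).
Proof.
apply: (@le_trans _ _ (expR `|x|)).
  case: k => [|k]; first by rewrite expr0 fact0 divr1 -expR0 ler_expR.
  by apply: le_trans (expR_ge1Dxn k (normr_ge0 x)); rewrite lerDr.
have := expR_ge0 x; have := expR_ge0 (- x).
by case: (ler0P x) => _; lra.
Qed.

Lemma expr1D_le_exp (c : R) n : 0 <= c -> (1 + c / n%:R) ^+ n <= expR c.
Proof.
move=> c0; case: n => [|n]; first by rewrite expr0 -expR0 ler_expR.
apply: (@le_trans _ _ (expR (c / n.+1%:R) ^+ n.+1)).
  by rewrite lerXn2r ?nnegrE ?addr_ge0 ?divr_ge0 ?expR_ge0 // expR_ge1Dx.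
by rewrite -expRM_natl mulrC divfK // pnatr_eq0.
Qed.

Definition cis x : R[i] := cos x +i* sin x.

Lemma cisD x y : cis (x + y) = cis x * cis y.
Proof. by rewrite /cis cosD sinD; apply/eqP; rewrite eq_complex /= eqxx /= addrC. Qed.

Lemma norm_cis x : `|cis x| = 1.
Proof. by rewrite normc_def /= cos2Dsin2 sqrtr1. Qed.

Lemma cis_sum (I : finType) (h : I -> R) : cis (\sum_i h i) = \prod_i cis (h i).
Proof.
apply: (big_morph cis cisD); by rewrite /cis cos0 sin0.
Qed.

Lemma norm_complex_le (u v : R) : `|u +i* v| <= (`|u| + `|v|)%:C.
Proof.
rewrite normc_def lecR -[leRHS]ger0_norm ?addr_ge0 // -sqrtr_sqr ler_wsqrtr //=.
rewrite sqrrD !real_normK ?num_real // lerD2r lerDl.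
by rewrite mulrn_wge0 // mulr_ge0.
Qed.

Lemma Re_mulr (z : R[i]) x : complex.Re (z * x%:C) = complex.Re z * x.
Proof. by case: z => s t /=; rewrite mulr0 subr0. Qed.

Lemma Im_mulr (z : R[i]) x : complex.Im (z * x%:C) = complex.Im z * x.
Proof. by case: z => s t /=; rewrite mulr0 add0r. Qed.

End Exp.

(** * Sums of independent roots of unity *)

Section IID.
Variables (R : realType) (p : nat) (P U : finType) (xi : U -> R[i]).
Hypotheses (p_prime : prime p) (p_odd : odd p).
Hypotheses (xi_norm : forall u, `|xi u| = 1) (U_gt0 : (0 < #|U|)%N) (P_gt0 : (0 < #|P|)%N).
Hypothesis xi_sum : forall k, ~~ (p %| k)%N -> \sum_u xi u ^+ k = 0.
Variables (a b : R).

Local Notation n := (#|P|%:R : R).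

Definition linear_form (z : R[i]) : R := a * complex.Re z + b * complex.Im z.

Local Notation A := (`|a| + `|b|).
Let y (u : U) : R := (Num.sqrt n)^-1 * linear_form (xi u).

Definition iid_sum (t : {ffun P -> U}) : R := \sum_x y (t x).

Lemma sqr_ReIm u : complex.Re (xi u) ^+ 2 + complex.Im (xi u) ^+ 2 = 1.
Proof.
have := xi_norm u; rewrite normc_def => /(congr1 (@complex.Re R)) /= E.
by rewrite -[LHS]sqr_sqrtr ?E ?expr1n // addr_ge0 ?sqr_ge0.
Qed.

Lemma norm_linear_form u : `|linear_form (xi u)| <= A.
Proof.
have E := sqr_ReIm u; set s := complex.Re _ in E; set t := complex.Im _ in E.
have s1 : `|s| <= 1.
  by rewrite -(ler_pXn2r (n := 2)) ?nnegrE // real_normK ?num_real // expr1n -E lerDl sqr_ge0.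
have t1 : `|t| <= 1.
  by rewrite -(ler_pXn2r (n := 2)) ?nnegrE // real_normK ?num_real // expr1n -E lerDr sqr_ge0.
apply: le_trans (ler_normD _ _) _.
by rewrite !normrM lerD // ler_piMr.
Qed.

Lemma xi_sum1 : \sum_u complex.Re (xi u) = 0 /\ \sum_u complex.Im (xi u) = 0.
Proof.
have p1 : ~~ (p %| 1)%N by rewrite dvdn1; apply: contraTneq p_prime => ->.
have E := xi_sum p1.
rewrite (eq_bigr xi) in E => [|u _]; last by rewrite expr1.
by split; [have := congr1 (@complex.Re R) E | have := congr1 (@complex.Im R) E]; rewrite raddf_sum.
Qed.

(** Since [p] is odd, it does not divide 2 and [xi ^+ 2] has mean zero: real and imaginary parts are
    uncorrelated with equal variances, which is what makes the limit a complex Gaussian. *)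
Lemma xi_sum2 : \sum_u (complex.Re (xi u) ^+ 2 - complex.Im (xi u) ^+ 2) = 0 /\
  \sum_u (complex.Re (xi u) * complex.Im (xi u)) = 0.
Proof.
have p2 : ~~ (p %| 2)%N by rewrite gtnNdvd // odd_prime_gt2.
have E := xi_sum p2.
have E2 u : xi u ^+ 2 = (complex.Re (xi u) ^+ 2 - complex.Im (xi u) ^+ 2) +i*
    (complex.Re (xi u) * complex.Im (xi u) *+ 2).
  by case: (xi u) => s t; rewrite expr2 /=; apply/eqP; rewrite eq_complex /= !expr2 eqxx /= mulr2n [t * s]mulrC.
rewrite (eq_bigr _ (fun u _ => E2 u)) in E.
split; first by have := congr1 (@complex.Re R) E; rewrite raddf_sum.
have := congr1 (@complex.Im R) E; rewrite raddf_sum /= sumrMnl => /eqP.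
by rewrite mulrn_eq0 /= => /eqP.
Qed.

Lemma mean_linear_form : fmean (fun u => linear_form (xi u)) = 0.
Proof.
by rewrite fmeanD !fmeanZ /fmean !(proj1 xi_sum1, proj2 xi_sum1) !mul0r !mulr0 addr0.
Qed.

Lemma mean_linear_form_sqr : fmean (fun u => linear_form (xi u) ^+ 2) = (a ^+ 2 + b ^+ 2) / 2.
Proof.
have E u : linear_form (xi u) ^+ 2 = (a ^+ 2 + b ^+ 2) / 2 +
    ((a ^+ 2 - b ^+ 2) / 2 * (complex.Re (xi u) ^+ 2 - complex.Im (xi u) ^+ 2) +
     2 * a * b * (complex.Re (xi u) * complex.Im (xi u))).
  have := sqr_ReIm u; rewrite /linear_form; set s := complex.Re _; set t := complex.Im _ => E.
  transitivity ((a ^+ 2 + b ^+ 2) / 2 * (s ^+ 2 + t ^+ 2) +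
    ((a ^+ 2 - b ^+ 2) / 2 * (s ^+ 2 - t ^+ 2) + 2 * a * b * (s * t))); first by field.
  by rewrite E mulr1.
transitivity (fmean (fun u => (a ^+ 2 + b ^+ 2) / 2 +
    ((a ^+ 2 - b ^+ 2) / 2 * (complex.Re (xi u) ^+ 2 - complex.Im (xi u) ^+ 2) +
     2 * a * b * (complex.Re (xi u) * complex.Im (xi u))))).
  by rewrite /fmean; congr (_ / _); apply: eq_bigr.
rewrite !fmeanD !fmeanZ fmean_cst // /fmean (proj1 xi_sum2) (proj2 xi_sum2).
by rewrite !mul0r !mulr0 !addr0.
Qed.

Let n_gt0 : 0 < n. Proof. by rewrite ltr0n. Qed.
Let sn_gt0 : 0 < Num.sqrt n. Proof. by rewrite sqrtr_gt0. Qed.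
Let sn2 : Num.sqrt n ^+ 2 = n. Proof. by rewrite sqr_sqrtr ?ltW. Qed.

Let norm_y u : `|y u| <= A / Num.sqrt n.
Proof.
rewrite /y normrM mulrC [X in _ * X]ger0_norm ?invr_ge0 ?sqrtr_ge0 // ler_wpM2r ?invr_ge0 ?sqrtr_ge0 //.
exact: norm_linear_form.
Qed.

Let mean_y : fmean y = 0.
Proof. by rewrite /y fmeanZ mean_linear_form mulr0. Qed.

Let mean_y2 : fmean (fun u => y u ^+ 2) = (a ^+ 2 + b ^+ 2) / 2 / n.
Proof.
rewrite (_ : (fun u => y u ^+ 2) = (fun u => n^-1 * linear_form (xi u) ^+ 2)).
  by rewrite fmeanZ mean_linear_form_sqr mulrC.
by apply/funext => u; rewrite /y exprMn exprVn sn2.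
Qed.

(** By independence the mean is an [n]-th power. The terms [l * y] have mean zero and absolute value
    at most one half, so each factor is at most [1 + 2 l ^+ 2 A ^+ 2 / n]. *)
Lemma iid_exp_moment (l : R) : 2 * `|l| * A <= Num.sqrt n ->
  fmean (fun t => expR (l * iid_sum t)) <= expR (2 * l ^+ 2 * A ^+ 2).
Proof.
move=> lA.
have B0 : 0 <= 2 * l ^+ 2 * A ^+ 2 by rewrite mulr_ge0 ?sqr_ge0 // mulr_ge0 ?sqr_ge0.
rewrite (_ : (fun t : {ffun P -> U} => expR (l * iid_sum t)) =
    (fun t => \prod_x expR (l * y (t x)))); last first.
  by apply/funext => t; rewrite /iid_sum mulr_sumr expR_sum.
rewrite (fmean_prod (fun _ u => expR (l * y u))) prodr_const.
apply: (@le_trans _ _ ((1 + 2 * l ^+ 2 * A ^+ 2 / n) ^+ #|P|)); last first.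
  exact: expr1D_le_exp.
have m0 : 0 <= fmean (fun u => expR (l * y u)).
  by rewrite divr_ge0 // sumr_ge0 // => u _; rewrite expR_ge0.
rewrite lerXn2r ?nnegrE //; first by rewrite addr_ge0 // divr_ge0.
have le u : expR (l * y u) <= 1 + l * y u + 2 * l ^+ 2 * A ^+ 2 / n.
  have ly : `|l * y u| <= `|l| * (A / Num.sqrt n) by rewrite normrM ler_wpM2l.
  have ly2 : `|l| * (A / Num.sqrt n) <= 1 / 2.
    by rewrite mulrA ler_pdivrMr //; move: lA; set s := Num.sqrt n; lra.
  apply: le_trans (expR_le1Dx _) _.
    by apply: le_trans (ler_norm _) _; exact: le_trans ly ly2.
  rewrite lerD2l -[leRHS]mulrA -[leRHS]mulrA ler_wpM2l //.
  rewrite -sn2 -expr_div_n -[l ^+ 2]real_normK ?num_real // -exprMn -[leLHS]real_normK ?num_real //.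
  by rewrite lerXn2r ?nnegrE // mulr_ge0 // divr_ge0 ?addr_ge0 // ltW.
apply: le_trans (ler_fmean le) _.
by rewrite !fmeanD fmeanZ mean_y mulr0 !fmean_cst // addr0.
Qed.

(** Bounds [(l |S|) ^+ k / k!] by [expR (l S) + expR (- l S)] and uses the exponential moments at
    [l] and [- l]. The free parameter [l] gives geometric decay in [k]. *)
Lemma iid_moment_le (l : R) k : 0 < l -> 2 * l * A <= Num.sqrt n ->
  fmean (fun t => `|iid_sum t| ^+ k) / k`!%:R <= 2 * expR (2 * l ^+ 2 * A ^+ 2) / l ^+ k.
Proof.
move=> l0 lA.
have h1 := @iid_exp_moment l; have h2 := @iid_exp_moment (- l).
rewrite normrN sqrrN in h2; rewrite (gtr0_norm l0) in h1 h2.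
have := lerD (h1 lA) (h2 lA); rewrite -mulr2n -[X in _ <= X -> _]mulr_natl -fmeanD => h.
rewrite ler_pdivlMr ?exprn_gt0 //; apply: le_trans h.
have -> : fmean (fun t => `|iid_sum t| ^+ k) / k`!%:R * l ^+ k =
    fmean (fun t => l ^+ k / k`!%:R * `|iid_sum t| ^+ k) by rewrite fmeanZ; ring.
apply: ler_fmean => t; rewrite mulNr; apply: le_trans (expr_norm_le_exp _ k).
by rewrite normrM exprMn (gtr0_norm l0) mulrAC.
Qed.

(** The central limit theorem with an explicit rate. The characteristic function of a summand, [z],
    and [w = expR (- s / n)] both have norm at most 1, so their [n]-th powers differ by at most
    [n * |z - w|]. Taylor polynomials of order 3 estimate [z - w]. *)
Lemma iid_char (c : R) :
  `|fmean (fun t => cos (c + iid_sum t)) - cos c * expR (- ((a ^+ 2 + b ^+ 2) / 4))| <=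
  2 * A ^+ 3 / Num.sqrt n + 2 * ((a ^+ 2 + b ^+ 2) / 4) ^+ 2 / n.
Proof.
set s := (a ^+ 2 + b ^+ 2) / 4.
have s0 : 0 <= s by rewrite divr_ge0 // addr_ge0 ?sqr_ge0.
pose z := fmean (fun u => cis (y u)); pose w := (expR (- (s / n)))%:C.
have EE : fmean (fun t => cis (c + iid_sum t)) = cis c * z ^+ #|P|.
  rewrite (_ : (fun t => _) = fun t : {ffun P -> U} => cis c * \prod_x cis (y (t x))); last first.
    by apply/funext => t; rewrite cisD cis_sum.
  by rewrite fmeanZ (fmean_prod (fun _ u => cis (y u))) prodr_const.
have ReE (fT : finType) (h : fT -> R) : complex.Re (fmean (fun t => cis (h t))) = fmean (fun t => cos (h t)).
  by rewrite /fmean -(rmorph_nat (real_complex R)) -(fmorphV (real_complex R)) Re_mulr raddf_sum.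
have ImE (fT : finType) (h : fT -> R) : complex.Im (fmean (fun t => cis (h t))) = fmean (fun t => sin (h t)).
  by rewrite /fmean -(rmorph_nat (real_complex R)) -(fmorphV (real_complex R)) Im_mulr raddf_sum.
have Ew : cos c * expR (- s) = complex.Re (cis c * w ^+ #|P|).
  rewrite /w -(rmorphXn (real_complex R)) Re_mulr -expRM_natl mulrN mulrCA mulfV ?mulr1 //.
  by rewrite gt_eqF.
have z1 : `|z| <= 1.
  apply: le_trans (ler_norm_fmean _) _.
  by rewrite -[leRHS](fmean_cst (1 : R[i]) U_gt0); apply: ler_fmean => u; rewrite norm_cis.
have w1 : `|w| <= 1.
  by rewrite /w normc_def /= expr0n addr0 sqrtr_sqr lecR ger0_norm ?expR_ge0 // expR_le1 oppr_le0 divr_ge0.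
rewrite -(ReE _ (fun t => c + iid_sum t)) Ew EE -raddfB -mulrBr -lecR.
apply: le_trans (normc_ge_Re _) _.
rewrite normrM norm_cis mul1r; apply: le_trans (norm_exprB_le _ z1 w1) _.
have zw : `|z - w| <= (2 * A ^+ 3 / Num.sqrt n / n + 2 * s ^+ 2 / n ^+ 2)%:C.
  have -> : z - w = (fmean (fun u => cos (y u)) - expR (- (s / n))) +i* fmean (fun u => sin (y u)).
    by rewrite -ReE -ImE -/z; case: (z) => u v; apply/eqP; rewrite eq_complex /= ?oppr0 ?subr0 ?addr0 !eqxx.
  apply: le_trans (norm_complex_le _ _) _; rewrite lecR.
  have y3 u : `|y u| ^+ 3 / 3`!%:R <= A ^+ 3 / Num.sqrt n / n.
    have -> : A ^+ 3 / Num.sqrt n / n = (A / Num.sqrt n) ^+ 3.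
      by rewrite expr_div_n [Num.sqrt n ^+ 3]exprS sn2 invfM mulrA.
    apply: (@le_trans _ _ (`|y u| ^+ 3)).
      by rewrite ler_piMr ?exprn_ge0 // invf_le1 ?ltr0n ?fact_gt0 // ler1n fact_gt0.
    by rewrite lerXn2r ?nnegrE ?divr_ge0 ?addr_ge0 // ltW.
  have y3m : fmean (fun u => `|y u| ^+ 3 / 3`!%:R) <= A ^+ 3 / Num.sqrt n / n.
    by apply: le_trans (ler_fmean y3) _; rewrite fmean_cst.
  have h1 : `|fmean (fun u => cos (y u)) - (1 - s / n)| <= A ^+ 3 / Num.sqrt n / n.
    have -> : 1 - s / n = fmean (fun u => 1 - 2^-1 * y u ^+ 2).
      rewrite fmeanB fmeanZ mean_y2 fmean_cst // /s; congr (_ - _).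
      by rewrite mulrA; congr (_ / _); field.
    rewrite -fmeanB; apply: le_trans (ler_norm_fmean _) _; apply: le_trans y3m.
    apply: ler_fmean => u; have := cos_taylor_bound 0 3 (y u).
    by rewrite add0r cos_taylor3.
  have h2 : `|fmean (fun u => sin (y u))| <= A ^+ 3 / Num.sqrt n / n.
    have -> : fmean (fun u => sin (y u)) = fmean (fun u => sin (y u) - y u).
      by rewrite fmeanB mean_y subr0.
    apply: le_trans (ler_norm_fmean _) _; apply: le_trans y3m.
    apply: ler_fmean => u; have := cos_taylor_bound (- (pi / 2)) 3 (y u).
    by rewrite [- (pi / 2) + _]addrC cosBpihalf sin_taylor3.
  have h3 : `|1 - s / n - expR (- (s / n))| <= 2 * s ^+ 2 / n ^+ 2.
    have u0 : 0 <= s / n by rewrite divr_ge0 // ltW.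
    rewrite -mulrA -expr_div_n; set u := s / n in u0 *.
    have := expR_ge1Dx (- u); have := @expR_le1Dx R (- u); rewrite sqrrN => g1 g2.
    have {}g1 : expR (- u) <= 1 - u + 2 * u ^+ 2 by apply: g1; lra.
    by rewrite distrC ger0_norm; lra.
  rewrite [leRHS](_ : _ = A ^+ 3 / Num.sqrt n / n + 2 * s ^+ 2 / n ^+ 2 + A ^+ 3 / Num.sqrt n / n); last first.
    by ring.
  apply: lerD h2.
  rewrite -(subrK (1 - s / n) (fmean _)) -addrA.
  by apply: le_trans (ler_normD _ _) _; exact: lerD.
apply: le_trans (ler_wpM2l _ zw) _ => //.
rewrite -(rmorph_nat (real_complex R)) -rmorphM /= lecR le_eqVlt; apply/orP; left; apply/eqP.
have : n != 0 by rewrite gt_eqF.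
have : Num.sqrt n != 0 by rewrite gt_eqF.
by set nn := n; set sq := Num.sqrt nn => ? ?; field; apply/andP.
Qed.

End IID.

(** * Comparison of moments *)

Section Expansion.
Variables (R : realType) (p : nat) (P : finType) (a b s : R).
Implicit Types v : P -> R[i].

Definition monomial (nu : P -> nat) v : R[i] := \prod_x v x ^+ nu x.

(** Chosen so that the linear form is [c z + conjc c * conjc z]. On roots of unity, and on 0,
    conjugation is the power [p.-1]; powers of the form thus expand into monomials with natural
    exponents. *)
Let c : R[i] := (a / 2) +i* (- b / 2).
Let cf (e : bool) : R[i] := if e then conjc c else c.
Let ex (e : bool) : nat := if e then p.-1 else 1%N.

Lemma linear_form_conj z : (linear_form a b z)%:C = c * z + conjc c * conjc z.
Proof.
case: z => x y; rewrite /linear_form; apply/eqP; rewrite eq_complex /=.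
by apply/andP; split; apply/eqP; field.
Qed.

(** A word chooses for each of the [k] factors a point and whether its value is conjugated; a
    conjugated letter counts with exponent [p.-1]. *)
Definition word_exponent k (g : {ffun 'I_k -> P * bool}) (x : P) : nat :=
  (\sum_(j | (g j).1 == x) ex (g j).2)%N.

Definition word_coef k (g : {ffun 'I_k -> P * bool}) : R[i] :=
  (s ^+ k)%:C * \prod_j cf (g j).2.

Lemma linear_form_power v k : (forall x, v x ^+ p.-1 = conjc (v x)) ->
  ((s * linear_form a b (\sum_x v x)) ^+ k)%:C =
  \sum_(g : {ffun 'I_k -> P * bool}) word_coef g * monomial (word_exponent g) v.
Proof.
move=> vp; rewrite rmorphXn rmorphM /= linear_form_conj exprMn.
have -> : c * (\sum_x v x) + conjc c * conjc (\sum_x v x) =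
    \sum_(y : P * bool) cf y.2 * v y.1 ^+ ex y.2.
  rewrite -(pair_bigA _ (fun x e => cf e * v x ^+ ex e)) /= rmorph_sum !mulr_sumr -big_split /=.
  by apply: eq_bigr => x _; rewrite big_bool /= addrC expr1 vp.
rewrite -[X in _ * _ ^+ X]card_ord -prodr_const bigA_distr_bigA mulr_sumr.
apply: eq_bigr => g _; rewrite big_split /= mulrA /word_coef rmorphXn /=; congr (_ * _).
rewrite (partition_big (fun j => (g j).1) xpredT) //=; apply: eq_bigr => x _.
by rewrite /word_exponent -prodrXr; apply: eq_bigr => j /eqP ->.
Qed.

Lemma norm_word_coef k (g : {ffun 'I_k -> P * bool}) : 0 <= s ->
  `|word_coef g| <= ((s * (`|a| + `|b|)) ^+ k)%:C.
Proof.
move=> s0; rewrite /word_coef exprMn rmorphM normrM /=.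
have -> : `|(s ^+ k)%:C| = (s ^+ k)%:C :> R[i] by rewrite ger0_norm // lecR exprn_ge0.
apply: ler_wpM2l; first by rewrite lecR exprn_ge0.
rewrite normr_prod.
rewrite -[X in _ <= (_ ^+ X)%:C]card_ord -prodr_const rmorph_prod /=.
apply: ler_prod => j _; rewrite normr_ge0 /=.
suff H : `|c| <= (`|a| + `|b|)%:C.
  rewrite /cf; case: ifP => // _.
  by move: H; rewrite !normc_def /= sqrrN.
apply: le_trans (norm_complex_le _ _) _; rewrite lecR mulNr normrN.
by rewrite !normrM (ger0_norm (x := 2^-1)) // -mulrDl ler_piMr ?addr_ge0 // invf_le1 // ler1n.
Qed.

Lemma word_exponent_support k (g : {ffun 'I_k -> P * bool}) :
  (#|[set x | word_exponent g x != 0%N]| <= k)%N.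
Proof.
rewrite -[k in leqRHS]card_ord -cardsT.
apply: leq_trans (leq_imset_card (fun j => (g j).1) [set: 'I_k]).
apply: subset_leq_card; apply/fintype.subsetP => x; rewrite finset.in_set.
apply: contraR => xg; rewrite /word_exponent big1 // => j /eqP gj.
by case/negP: xg; apply/imsetP; exists j; rewrite ?finset.in_setT.
Qed.

End Expansion.

Definition list_mean (K : numFieldType) (T : Type) (S : seq T) (h : T -> K) : K :=
  (\sum_(F <- S) h F) / (size S)%:R.

Section ListMean.
Variables (K : numFieldType) (T : Type) (S : seq T).
Implicit Types g h : T -> K.

Lemma ler_list_mean g h : (forall F, g F <= h F) -> list_mean S g <= list_mean S h.
Proof. by move=> gh; rewrite ler_wpM2r ?invr_ge0 // ler_sum. Qed.

Lemma list_mean_cst (c : K) : (0 < size S)%N -> list_mean S (fun _ : T => c) = c.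
Proof.
move=> S0; rewrite /list_mean big_const_seq count_predT iter_addr_0.
by rewrite -[X in X / _]mulr_natr mulfK // pnatr_eq0 -lt0n.
Qed.

Lemma list_meanD g h : list_mean S (fun F => g F + h F) = list_mean S g + list_mean S h.
Proof. by rewrite /list_mean big_split mulrDl. Qed.

Lemma list_meanB g h : list_mean S (fun F => g F - h F) = list_mean S g - list_mean S h.
Proof. by rewrite /list_mean sumrB mulrBl. Qed.

Lemma list_meanZ c h : list_mean S (fun F => c * h F) = c * list_mean S h.
Proof. by rewrite /list_mean -mulr_sumr mulrA. Qed.

Lemma list_mean_sum (I : finType) (P : pred I) (h : I -> T -> K) :
  list_mean S (fun F => \sum_(i | P i) h i F) = \sum_(i | P i) list_mean S (h i).
Proof. by rewrite /list_mean exchange_big mulr_suml. Qed.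

Lemma ler_norm_list_mean h : `|list_mean S h| <= list_mean S (fun F => `|h F|).
Proof. by rewrite normrM normfV normr_nat ler_wpM2r ?invr_ge0 // ler_norm_sum. Qed.

End ListMean.

Lemma fmean_list_mean (K : numFieldType) (A : finType) (h : A -> K) :
  fmean h = list_mean (enum A) h.
Proof. by rewrite /list_mean -cardE big_enum. Qed.

Lemma list_mean_real (R : realType) (T : Type) (S : seq T) (h : T -> R) :
  (list_mean S h)%:C = list_mean S (fun F => (h F)%:C).
Proof. by rewrite /list_mean rmorphM fmorphV rmorph_nat rmorph_sum. Qed.

(** * Transfer from moments to cosines *)

Section Comparison.
Variables (R : realType) (p : nat) (P U : finType) (xi : U -> R[i]).
Hypotheses (p_prime : prime p) (p_odd : odd p).
Hypotheses (xi_norm : forall u, `|xi u| = 1) (U_gt0 : (0 < #|U|)%N) (P_gt0 : (0 < #|P|)%N).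
Hypothesis xi_p : forall u, xi u ^+ p = 1.
Hypothesis xi_sum : forall k, ~~ (p %| k)%N -> \sum_u xi u ^+ k = 0.
Variables (T : Type) (S : seq T) (V : T -> P -> R[i]).
Hypotheses (S_gt0 : (0 < size S)%N) (V_conj : forall F x, V F x ^+ p.-1 = conjc (V F x)).
Variables (m : nat) (D B : R).
Hypotheses (D_ge0 : 0 <= D) (B_ge0 : 0 <= B).
Hypothesis mean_trivial : forall k (nu : P -> nat), (k <= m)%N -> (forall x, p %| nu x)%N ->
  (#|[set x | nu x != 0%N]| <= k)%N ->
  `|list_mean S (fun F => monomial nu (V F)) - 1| <= (k%:R * D)%:C.
Hypothesis mean_nontrivial : forall k (nu : P -> nat), (k <= m)%N ->
  (exists x, ~~ (p %| nu x)%N) -> (#|[set x | nu x != 0%N]| <= k)%N ->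
  `|list_mean S (fun F => monomial nu (V F))| <= B%:C.
Local Notation n := (#|P|%:R : R).
Local Notation s := (Num.sqrt n)^-1.

Definition trivial_exponents (nu : P -> nat) := [forall x, (p %| nu x)%N].

Lemma xi_conj u : xi u ^+ p.-1 = conjc (xi u).
Proof.
have xi0 : xi u != 0 by rewrite -normr_eq0 xi_norm oner_eq0.
apply: (mulfI xi0); rewrite -exprS prednK ?prime_gt0 // xi_p.
have := xi_norm u; case: (xi u) => x y; rewrite normc_def /= => -[E].
have {}E : x ^+ 2 + y ^+ 2 = 1.
  by rewrite -[LHS]sqr_sqrtr ?E ?expr1n // addr_ge0 ?sqr_ge0.
apply/eqP; rewrite eq_complex /=; apply/andP; split; apply/eqP; last by ring.
by rewrite -E; ring.
Qed.

Lemma iid_monomial (nu : P -> nat) :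
  fmean (fun t : {ffun P -> U} => monomial nu (xi \o t)) = (trivial_exponents nu)%:R.
Proof.
rewrite (fmean_prod (fun x u => xi u ^+ nu x)).
have [/forallP triv|] := boolP (trivial_exponents nu).
  rewrite big1 // => x _; have /dvdnP [e ->] := triv x.
  rewrite -[RHS](fmean_cst (1 : R[i]) U_gt0); congr fmean; apply/funext => u.
  by rewrite mulnC exprM xi_p expr1n.
rewrite negb_forall => /existsP [x nx].
by rewrite (bigD1 x) //= /fmean (xi_sum nx) !mul0r.
Qed.

Lemma iid_sumE a b (t : {ffun P -> U}) :
  iid_sum xi a b t = s * linear_form a b (\sum_x (xi \o t) x).
Proof.
rewrite /iid_sum -mulr_sumr; congr (_ * _).
rewrite /linear_form big_split /= -!mulr_sumr.
by rewrite !raddf_sum.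
Qed.

Let s_ge0 : 0 <= s. Proof. by rewrite invr_ge0 sqrtr_ge0. Qed.

Lemma iid_power a b k :
  (fmean (fun t : {ffun P -> U} => iid_sum xi a b t ^+ k))%:C =
  \sum_(g : {ffun 'I_k -> P * bool}) word_coef a b s g * (trivial_exponents (word_exponent p g))%:R.
Proof.
rewrite fmean_list_mean list_mean_real -fmean_list_mean.
transitivity (fmean (fun t : {ffun P -> U} => \sum_(g : {ffun 'I_k -> P * bool})
    word_coef a b s g * monomial (word_exponent p g) (xi \o t))).
  congr fmean; apply/funext => t; rewrite iid_sumE (@linear_form_power _ p) // => x.
  exact: xi_conj.
by rewrite fmean_sum; apply: eq_bigr => g _; rewrite fmeanZ iid_monomial.
Qed.

Let Y a b F := s * linear_form a b (\sum_x V F x).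

Lemma list_power a b k : (list_mean S (fun F => Y a b F ^+ k))%:C =
  \sum_(g : {ffun 'I_k -> P * bool})
    word_coef a b s g * list_mean S (fun F => monomial (word_exponent p g) (V F)).
Proof.
rewrite list_mean_real.
transitivity (list_mean S (fun F => \sum_(g : {ffun 'I_k -> P * bool})
    word_coef a b s g * monomial (word_exponent p g) (V F))).
  by congr list_mean; apply/funext => F; rewrite (@linear_form_power _ p).
by rewrite list_mean_sum; apply: eq_bigr => g _; rewrite list_meanZ.
Qed.

(** For [a = 2] and [b = 0] all letters have coefficient 1, and the [k]-th moment of the independent
    model is exactly the left side. [iid_moment_le] with [l = 1] and [A = 2] gives the constant
    [2 * expR 8]. *)
Lemma card_trivial_words k : 4 <= Num.sqrt n ->
  s ^+ k * (\sum_(g : {ffun 'I_k -> P * bool}) trivial_exponents (word_exponent p g))%:R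
  <= k`!%:R * (2 * expR 8).
Proof.
move=> n4.
have E : (fmean (fun t : {ffun P -> U} => iid_sum xi 2 0 t ^+ k)) =
    s ^+ k * (\sum_(g : {ffun 'I_k -> P * bool}) trivial_exponents (word_exponent p g))%:R.
  apply: (fmorph_inj (real_complex R)); rewrite /= iid_power rmorphM /= rmorph_nat natr_sum mulr_sumr.
  apply: eq_bigr => g _; congr (_ * _); rewrite /word_coef big1 ?mulr1 // => j _.
  by case: ifP => _; rewrite ?mulfV ?oppr0 ?mul0r //=; apply/eqP; rewrite eq_complex /= ?oppr0 !eqxx.
rewrite -E; apply: le_trans (_ : fmean (fun t : {ffun P -> U} => `|iid_sum xi 2 0 t| ^+ k) <= _).
  by apply: ler_fmean => t; rewrite -normrX ler_norm.
have f0 : 0 < k`!%:R :> R by rewrite ltr0n fact_gt0.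
rewrite mulrC -ler_pdivrMr //.
have := @iid_moment_le R p P U xi p_prime xi_norm U_gt0 P_gt0 xi_sum 2 0 1 k ltr01.
rewrite normr0 addr0 (ger0_norm (x := 2)) // !expr1n !mulr1 divr1 => H.
apply: le_trans (H _) _; first by move: n4; set sq := Num.sqrt _; lra.
by rewrite ler_wpM2l // ler_expR expr2; lra.
Qed.

(** Word by word: coefficients are at most [(s A) ^+ k], words with all exponents divisible by [p]
    contribute the error [k D], and the others at most [B]. Counting all [(2 n) ^+ k] words for the
    latter produces [(2 sqrt n) ^+ k]. *)
Lemma power_comparison a b k : 4 <= Num.sqrt n -> (k <= m)%N ->
  `|list_mean S (fun F => Y a b F ^+ k) - fmean (fun t : {ffun P -> U} => iid_sum xi a b t ^+ k)| <=
  (`|a| + `|b|) ^+ k * (k%:R * D * (k`!%:R * (2 * expR 8)) + B * (2 * Num.sqrt n) ^+ k).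
Proof.
move=> n4 km; set A := `|a| + `|b|.
have A0 : 0 <= A by rewrite addr_ge0.
have sn0 : 0 < Num.sqrt n by rewrite sqrtr_gt0 ltr0n.
pose tr (g : {ffun 'I_k -> P * bool}) := trivial_exponents (word_exponent p g).
apply: (@le_trans _ _ (\sum_(g : {ffun 'I_k -> P * bool})
    (s * A) ^+ k * ((tr g)%:R * (k%:R * D) + B))); last first.
  rewrite -mulr_sumr big_split /= -mulr_suml sumr_const card_ffun card_prod card_bool card_ord.
  rewrite mulrDr [leRHS]mulrDr; apply: lerD.
    rewrite -natr_sum exprMn.
    have -> : s ^+ k * A ^+ k * ((\sum_g tr g)%:R * (k%:R * D)) =
      A ^+ k * (k%:R * D * (s ^+ k * (\sum_g tr g)%:R)) by ring.
    rewrite ler_wpM2l ?exprn_ge0 // ler_wpM2l ?mulr_ge0 //.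
    exact: card_trivial_words.
  rewrite -[B *+ _]mulr_natr natrX natrM.
  have -> : 2 * Num.sqrt n = s * (n * 2).
    have : Num.sqrt n != 0 by rewrite gt_eqF.
    have : Num.sqrt n ^+ 2 = n by rewrite sqr_sqrtr.
    by set sq := Num.sqrt n => <- sq0; field.
  by rewrite !exprMn le_eqVlt; apply/orP; left; apply/eqP; ring.
rewrite -lecR.
apply: le_trans (_ : `|(list_mean S (fun F => Y a b F ^+ k) -
   fmean (fun t : {ffun P -> U} => iid_sum xi a b t ^+ k))%:C| <= _).
  by rewrite normc_def /= expr0n addr0 sqrtr_sqr.
rewrite rmorphB /= list_power iid_power -sumrB rmorph_sum /=.
apply: le_trans (ler_norm_sum _ _ _) _; apply: ler_sum => g _.
rewrite -mulrBr normrM rmorphM /=.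
apply: ler_pM => //; first exact: norm_word_coef.
have supp := @word_exponent_support p P k g.
rewrite -/(tr g); have [/forallP triv|] := boolP (tr g).
  apply: le_trans (mean_trivial km triv supp) _.
  by rewrite lecR mul1r lerDl.
rewrite negb_forall subr0 mul0r add0r => /existsP [x nx].
by apply: (mean_nontrivial km) => //; exists x.
Qed.

(** Both cosines are replaced by Taylor polynomials. As [K] is even, the remainder is a genuine
    [K]-th moment: for the sample it is compared with the independent model, where it decays in
    [K]. *)
Lemma cos_comparison a b c K : 4 <= Num.sqrt n -> 4 * (`|a| + `|b|) <= Num.sqrt n ->
  (K <= m)%N -> ~~ odd K ->
  `|list_mean S (fun F => cos (c + Y a b F)) - fmean (fun t : {ffun P -> U} => cos (c + iid_sum xi a b t))| <=
  \sum_(k < K.+1) (`|a| + `|b|) ^+ k *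
    (k%:R * D * (k`!%:R * (2 * expR 8)) + B * (2 * Num.sqrt n) ^+ k)
  + 4 * expR (8 * (`|a| + `|b|) ^+ 2) / 2 ^+ K.
Proof.
move=> n4 nA Km evK.
pose d k := (`|a| + `|b|) ^+ k * (k%:R * D * (k`!%:R * (2 * expR 8)) + B * (2 * Num.sqrt n) ^+ k).
have comp k : (k <= K)%N -> `|list_mean S (fun F => Y a b F ^+ k) - fmean (fun t : {ffun P -> U} => iid_sum xi a b t ^+ k)| <= d k.
  by move=> kK; apply: power_comparison => //; exact: leq_trans kK Km.
have d0 k : 0 <= d k.
  apply: mulr_ge0; first by rewrite exprn_ge0 ?addr_ge0.
  apply: addr_ge0; first by rewrite !mulr_ge0 ?expR_ge0.
  by apply: mulr_ge0 => //; rewrite exprn_ge0 // mulr_ge0 ?sqrtr_ge0.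
have taylorS : `|list_mean S (fun F => cos (c + Y a b F)) - list_mean S (fun F => (cos_taylor c K).[Y a b F])|
    <= list_mean S (fun F => Y a b F ^+ K) / K`!%:R.
  rewrite -list_meanB; apply: le_trans (ler_norm_list_mean _ _) _.
  rewrite mulrC -list_meanZ; apply: ler_list_mean => F; rewrite mulrC.
  by apply: le_trans (cos_taylor_bound _ _ _) _; rewrite -normrX ger0_norm // exprn_even_ge0.
have taylorU : `|fmean (fun t : {ffun P -> U} => cos (c + iid_sum xi a b t)) - fmean (fun t : {ffun P -> U} => (cos_taylor c K).[iid_sum xi a b t])|
    <= fmean (fun t : {ffun P -> U} => iid_sum xi a b t ^+ K) / K`!%:R.
  rewrite -fmeanB; apply: le_trans (ler_norm_fmean _) _.
  rewrite mulrC -fmeanZ; apply: ler_fmean => t; rewrite mulrC.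
  by apply: le_trans (cos_taylor_bound _ _ _) _; rewrite -normrX ger0_norm // exprn_even_ge0.
have mid : `|list_mean S (fun F => (cos_taylor c K).[Y a b F]) - fmean (fun t : {ffun P -> U} => (cos_taylor c K).[iid_sum xi a b t])|
    <= \sum_(k < K) d k.
  have E1 : list_mean S (fun F => (cos_taylor c K).[Y a b F]) =
      \sum_(k < K) (cos_taylor c K)`_k * list_mean S (fun F => Y a b F ^+ k).
    under [RHS]eq_bigr do rewrite -list_meanZ.
    rewrite -list_mean_sum; congr list_mean; apply/funext => F.
    by rewrite (horner_coef_wide _ (size_poly _ _)).
  have E2 : fmean (fun t : {ffun P -> U} => (cos_taylor c K).[iid_sum xi a b t]) =
      \sum_(k < K) (cos_taylor c K)`_k * fmean (fun t : {ffun P -> U} => iid_sum xi a b t ^+ k).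
    under [RHS]eq_bigr do rewrite -fmeanZ.
    rewrite -fmean_sum; congr fmean; apply/funext => t.
    by rewrite (horner_coef_wide _ (size_poly _ _)).
  rewrite E1 E2 -sumrB; apply: le_trans (ler_norm_sum _ _ _) _; apply: ler_sum => k _.
  rewrite -mulrBr normrM; apply: le_trans (comp k (ltnW (ltn_ord k))).
  rewrite ler_piMl //; apply: le_trans (coef_cos_taylor_le _ _ _) _.
  by rewrite invf_le1 ?ltr0n ?fact_gt0 // ler1n fact_gt0.
(* The moment bound is taken at [l = 2], which gives the factor [2 ^ (- K)]. *)
have tail : fmean (fun t : {ffun P -> U} => iid_sum xi a b t ^+ K) / K`!%:R <= 2 * expR (8 * (`|a| + `|b|) ^+ 2) / 2 ^+ K.
  have := @iid_moment_le R p P U xi p_prime xi_norm U_gt0 P_gt0 xi_sum a b 2 K (ltr0Sn _ _).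
  have -> : 2 * 2 ^+ 2 = 8 :> R by rewrite expr2; ring.
  have -> : 2 * 2 = 4 :> R by ring.
  move=> /(_ nA); apply: le_trans; rewrite ler_wpM2r ?invr_ge0 //.
  by apply: ler_fmean => t; rewrite -normrX ler_norm.
have last : list_mean S (fun F => Y a b F ^+ K) / K`!%:R <=
    fmean (fun t : {ffun P -> U} => iid_sum xi a b t ^+ K) / K`!%:R + d K.
  have := comp K (leqnn K); rewrite ler_norml => /andP[_]; rewrite lerBlDr => h.
  apply: (@le_trans _ _ ((d K + fmean (fun t : {ffun P -> U} => iid_sum xi a b t ^+ K)) / K`!%:R)).
    by rewrite ler_wpM2r ?invr_ge0.
  rewrite mulrDl addrC lerD2l ler_piMr // invf_le1 ?ltr0n ?fact_gt0 // ler1n fact_gt0 //.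
rewrite -[\sum_(k < K.+1) _]/(\sum_(k < K.+1) d k) big_ord_recr /=.
set LS := list_mean S (fun F => cos _) in taylorS *.
set LT := list_mean S _ in taylorS mid; set LU := fmean (fun t : {ffun P -> U} => cos _) in taylorU *.
set LV := fmean _ in taylorU mid.
have -> : LS - LU = (LS - LT) + (LT - LV) - (LU - LV) by ring.
apply: le_trans (ler_normB _ _) _.
apply: le_trans (lerD (ler_normD _ _) (lexx _)) _.
apply: le_trans (lerD (lerD taylorS mid) taylorU) _.
have -> : 4 * expR (8 * (`|a| + `|b|) ^+ 2) / 2 ^+ K =
  2 * expR (8 * (`|a| + `|b|) ^+ 2) / 2 ^+ K + 2 * expR (8 * (`|a| + `|b|) ^+ 2) / 2 ^+ K by ring.
move: last tail.
set u := _ / K`!%:R; set w := _ / K`!%:R; set tt := 2 * _ / _; set sd := \sum_(k < K) _.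
move=> *; lra.
Qed.

End Comparison.

(** * The comparison for traces over a fixed finite field *)

Section Specialization.
Variables (Fq : finFieldType) (p : nat) (d : 'I_p.-1 -> nat).
Variables (R : realType) (chi : Fq -> R[i]).
Hypotheses (p_prime : prime p) (p_odd : odd p) (chiP : character_of_order p chi).
Hypothesis Dp : (p %| \sum_(i < p.-1) i.+1 * d i)%N.
Local Notation S := (fset_set [set F : {poly Fq} | Fhat_union d F]%classic).
Local Notation q := (#|Fq|%:R : R).
Local Notation r := (#|'I_p.-1|%:R : R).
Local Notation n := (#|{: option Fq}|%:R : R).
Variable K : nat.
Hypotheses (q2 : 2 <= q) (qr : 4 * r ^+ 2 <= q) (dK : forall i, (3 * K + 2 < d i)%N).

Local Notation U := {x : Fq | x != 0}.
(** A uniform [p]-th root of unity is realized as the character of a uniform nonzero element, so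
    that orthogonality gives the power sums. *)
Let xi (u : U) : R[i] := chi (val u).
Let V (F : {poly Fq}) x : R[i] := chi (proj_value p F x).
Let D : R := 4 * p%:R ^+ 2 / q.
(** The sieve level is [K.+1]: against [(2 sqrt n) ^+ k <= (4 q) ^+ K] this leaves a factor [1 / q].
    It asks for degrees above [2 (K + 1) + K = 3 K + 2]. *)
Let B : R := 2 * p%:R * expR (r ^+ 2) * (2 / q) ^+ K.+1.

Let q0 : 0 < q. Proof. by apply: lt_le_trans q2. Qed.
Let d_gt0 i : (0 < d i)%N. Proof. exact: leq_ltn_trans (dK i). Qed.

Lemma size_sample_gt0 : (0 < size (S : seq _))%N.
Proof.
have := N_ge d_gt0 q2 qr; have := Qd_gt0 Fq d R => Q0 h.
rewrite -(ltr0n R); apply: lt_le_trans h.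
by rewrite divr_gt0 // mulr_gt0 //; move: q2; lra.
Qed.

Let xi_norm u : `|xi u| = 1. Proof. exact: (chi_norm p_prime chiP (valP u)). Qed.

Let xi_p u : xi u ^+ p = 1. Proof. exact: (chi_pow_p chiP (valP u)). Qed.

Let xi_sum k : ~~ (p %| k)%N -> \sum_u xi u ^+ k = 0.
Proof.
move=> pk; rewrite -[RHS](sum_chi chiP pk) [RHS](reindex_omap (val : U -> Fq) insub) /=; last first.
  by move=> x x0; rewrite insubT.
by apply: eq_bigl => u; rewrite valK eqxx (valP u).
Qed.

Let U_gt0 : (0 < #|{: U}|)%N.
Proof. by apply/card_gt0P; exists (exist _ 1 (oner_neq0 Fq)). Qed.

Let P_gt0 : (0 < #|{: option Fq}|)%N. Proof. by rewrite card_option. Qed.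

Let V_conj F x : V F x ^+ p.-1 = conjc (V F x).
Proof.
rewrite /V; have [->|v0] := eqVneq (proj_value p F x) 0.
  rewrite (chi_eq0 chiP) rmorph0 expr0n -subn1 subn_eq0 leqNgt.
  by rewrite (ltn_trans _ (odd_prime_gt2 p_odd p_prime)).
have H := xi_conj p_prime xi_norm xi_p (exist (fun x : Fq => is_true (x != 0)) _ v0).
exact: H.
Qed.

Let D_ge0 : 0 <= D. Proof. by rewrite divr_ge0 ?(ltW q0) // mulr_ge0 ?sqr_ge0. Qed.
Let B_ge0 : 0 <= B.
Proof.
apply: mulr_ge0; last by rewrite exprn_ge0 // divr_ge0 ?(ltW q0).
by apply: mulr_ge0; [exact: mulr_ge0 | exact: expR_ge0].
Qed.

Let list_mean_norm (h : {poly Fq} -> R[i]) (e : R) :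
  `|\sum_(F <- S) h F| <= (e * (#|` S|)%:R)%:C -> `|list_mean S h| <= e%:C.
Proof.
move=> H; rewrite /list_mean normrM normfV normr_nat ler_pdivrMr; last first.
  by rewrite ltr0n; exact: size_sample_gt0.
by apply: le_trans H _; rewrite rmorphM /= rmorph_nat.
Qed.

Let mean_trivial k (nu : option Fq -> nat) : (k <= K)%N -> (forall x, p %| nu x)%N ->
  (#|[set x | nu x != 0%N]| <= k)%N ->
  `|list_mean S (fun F => monomial nu (V F)) - 1| <= (k%:R * D)%:C.
Proof.
move=> kK triv supp.
rewrite -{1}(list_mean_cst (1 : R[i]) size_sample_gt0) -list_meanB.
apply: list_mean_norm; have := moment_trivial p_prime chiP Dp d_gt0 q2 qr triv supp.
have -> : 4 * p%:R ^+ 2 * k%:R / q = k%:R * D by rewrite /D; ring.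
by [].
Qed.

Let mean_nontrivial k (nu : option Fq -> nat) : (k <= K)%N -> (exists x, ~~ (p %| nu x)%N) ->
  (#|[set x | nu x != 0%N]| <= k)%N ->
  `|list_mean S (fun F => monomial nu (V F))| <= B%:C.
Proof.
move=> kK nontriv supp; apply: list_mean_norm.
apply: (@moment_nontrivial _ _ _ _ _ p_prime p_odd chiP Dp d_gt0 nu k) => //.
  apply: leq_trans supp; rewrite -(card_imset _ (@Some_inj _)).
  apply: subset_leq_card; apply/fintype.subsetP => y /imsetP [x].
  by rewrite !finset.in_set => nx ->.
by move=> i; apply: leq_ltn_trans (dK i); lia.
Qed.

(** Collects what does not depend on [q]; the factor [4 ^+ K] comes from [2 sqrt n <= 4 q]. *)
Definition comparison_constant (A : R) k : R :=
  A ^+ k * (k%:R * (4 * p%:R ^+ 2) * (k`!%:R * (2 * expR 8)) +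
            2 * p%:R * expR (r ^+ 2) * 2 ^+ K.+1 * 4 ^+ K).

Lemma comparison_constant_ge0 (A : R) k : 0 <= A -> 0 <= comparison_constant A k.
Proof.
move=> A0; rewrite /comparison_constant mulr_ge0 ?exprn_ge0 // addr_ge0 // mulr_ge0 //.
Qed.

Let error_le (A : R) k : 0 <= A -> (k <= K)%N ->
  A ^+ k * (k%:R * D * (k`!%:R * (2 * expR 8)) + B * (2 * Num.sqrt n) ^+ k) <=
  comparison_constant A k / q.
Proof.
move=> A0 kK; rewrite /comparison_constant -[leRHS]mulrA ler_wpM2l ?exprn_ge0 // [leRHS]mulrDl.
apply: lerD; first by rewrite /D le_eqVlt; apply/orP; left; apply/eqP; ring.
have nq : n <= 2 * q by rewrite card_option -natr1; move: q2; lra.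
have sq : 2 * Num.sqrt n <= 4 * q.
  have : Num.sqrt n <= n.
    rewrite -{2}[n]sqr_sqrtr // expr2 ler_peMr ?sqrtr_ge0 //.
    by rewrite -{1}[1]sqrtr1 ler_sqrt // card_option ler1n.
  by move: nq; lra.
apply: (@le_trans _ _ (B * (4 * q) ^+ K)).
  rewrite ler_wpM2l //; apply: (@le_trans _ _ ((4 * q) ^+ k)).
    by rewrite lerXn2r ?nnegrE ?mulr_ge0 ?sqrtr_ge0 // ltW.
  by rewrite ler_weXn2l //; move: q2; lra.
rewrite /B !exprMn exprVn exprS [q ^+ K.+1]exprS le_eqVlt; apply/orP; left; apply/eqP.
have qK : q ^+ K != 0 by rewrite expf_neq0 // gt_eqF.
have qn : q != 0 by rewrite gt_eqF.
by move: qK qn; set qK := q ^+ K; set qq := q => *; field; apply/andP.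
Qed.

Local Notation Z F := (((Num.sqrt (#|Fq|%:R + 1))^-1)%:C * frob_trace p chi F).

(** The sign of the trace is absorbed into [a] and [b], which enter the bounds only through absolute
    values and squares. *)
Let linear_form_Z a b F :
  linear_form a b (Z F) = (Num.sqrt n)^-1 * linear_form (- a) (- b) (\sum_x V F x).
Proof.
have -> : n = #|Fq|%:R + 1 by rewrite card_option -natr1.
rewrite /frob_trace -/(V F); set w := \sum_x _.
by case: w => x y; rewrite /linear_form /=; ring.
Qed.

Lemma sample_power a b k : 4 <= Num.sqrt n -> (k <= K)%N ->
  `|list_mean S (fun F => linear_form a b (Z F) ^+ k) -
    fmean (fun t : {ffun option Fq -> U} => iid_sum xi (- a) (- b) t ^+ k)| <=
  comparison_constant (`|a| + `|b|) k / q.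
Proof.
move=> n4 kK; apply: le_trans (error_le _ kK); last by rewrite addr_ge0.
have := @power_comparison R p _ _ xi p_prime xi_norm U_gt0 P_gt0 xi_p xi_sum _ S V V_conj K D B
  D_ge0 B_ge0 mean_trivial mean_nontrivial (- a) (- b) k n4 kK.
rewrite !normrN; congr (`|_ - _| <= _); congr list_mean.
by apply/funext => F; rewrite linear_form_Z.
Qed.

(** Real and imaginary part are the linear forms with [A = 1]. The moment bound at [l = 1] and
    [k = 2] gives [2! * 2 * expR 2 = 4 expR 2] for each. *)
Lemma sample_square : 4 <= Num.sqrt n -> (2 <= K)%N ->
  list_mean S (fun F => complex.Re (Z F) ^+ 2 + complex.Im (Z F) ^+ 2) <=
  8 * expR 2 + 2 * comparison_constant 1 2.
Proof.
move=> n4 K2.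
have C0 : 0 <= comparison_constant 1 2 by exact: comparison_constant_ge0.
have H a b : `|a| + `|b| = 1 -> list_mean S (fun F => linear_form a b (Z F) ^+ 2) <=
    4 * expR 2 + comparison_constant 1 2.
  move=> ab; have := sample_power a b n4 K2; rewrite ab ler_norml => /andP[_].
  rewrite lerBlDr => h; apply: le_trans h _; rewrite addrC lerD //; last first.
    by rewrite ler_pdivrMr // ler_peMr //; move: q2; lra.
  have := @iid_moment_le R p (option Fq) U xi p_prime xi_norm U_gt0 P_gt0 xi_sum (- a) (- b) 1 2 ltr01.
  rewrite !normrN ab !mulr1 !expr1n divr1 !mulr1 => h2.
  have n2 : 2 <= Num.sqrt n by apply: le_trans n4; rewrite ler_nat.
  have {}h2 := h2 n2.
  have : fmean (fun t : {ffun option Fq -> U} => iid_sum xi (- a) (- b) t ^+ 2) <=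
      fmean (fun t : {ffun option Fq -> U} => `|iid_sum xi (- a) (- b) t| ^+ 2).
    by apply: ler_fmean => t; rewrite real_normK ?num_real.
  move=> h3; apply: le_trans h3 _.
  have f2 : 2`!%:R = 2 :> R by [].
  rewrite f2 ler_pdivrMr // in h2; apply: le_trans h2 _.
  by have := expR_ge0 (2 : R); set e := expR 2; lra.
rewrite list_meanD.
have h1 := H 1 0; have h2 := H 0 1.
rewrite normr1 normr0 addr0 in h1; rewrite normr1 normr0 add0r in h2.
have {}h1 := h1 erefl; have {}h2 := h2 erefl.
have E1 : list_mean S (fun F => linear_form 1 0 (Z F) ^+ 2) = list_mean S (fun F => complex.Re (Z F) ^+ 2).
  by congr list_mean; apply/funext => F; rewrite /linear_form mul1r mul0r addr0.
have E2 : list_mean S (fun F => linear_form 0 1 (Z F) ^+ 2) = list_mean S (fun F => complex.Im (Z F) ^+ 2).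
  by congr list_mean; apply/funext => F; rewrite /linear_form mul1r mul0r add0r.
rewrite E1 in h1; rewrite E2 in h2; have := lerD h1 h2.
move: (expR 2) (comparison_constant 1 2) => e C; set u := _ + _; lra.
Qed.

Lemma sample_cos a b c : 4 <= Num.sqrt n -> 4 * (`|a| + `|b|) <= Num.sqrt n -> ~~ odd K ->
  `|list_mean S (fun F => cos (c + linear_form a b (Z F))) -
    cos c * expR (- ((a ^+ 2 + b ^+ 2) / 4))| <=
  (\sum_(k < K.+1) comparison_constant (`|a| + `|b|) k) / q +
  4 * expR (8 * (`|a| + `|b|) ^+ 2) / 2 ^+ K +
  (2 * (`|a| + `|b|) ^+ 3 + 2 * ((a ^+ 2 + b ^+ 2) / 4) ^+ 2) / Num.sqrt n.
Proof.
move=> n4 nA evK.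
have h1 := @cos_comparison R p _ _ xi p_prime xi_norm U_gt0 P_gt0 xi_p xi_sum _ S V V_conj K D B
  D_ge0 B_ge0 mean_trivial mean_nontrivial (- a) (- b) c K n4.
rewrite !normrN in h1; have {}h1 := h1 nA (leqnn K) evK.
have h2 := @iid_char R p (option Fq) U xi p_prime p_odd xi_norm U_gt0 P_gt0 xi_sum (- a) (- b) c.
rewrite !normrN !sqrrN in h2.
have sn0 : 0 < Num.sqrt n by apply: lt_le_trans n4.
have h3 : 2 * ((a ^+ 2 + b ^+ 2) / 4) ^+ 2 / n <= 2 * ((a ^+ 2 + b ^+ 2) / 4) ^+ 2 / Num.sqrt n.
  rewrite ler_wpM2l //; first by rewrite mulr_ge0 ?sqr_ge0.
  rewrite lef_pV2 ?posrE ?ltr0n ?P_gt0 //.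
  rewrite -{2}[n]sqr_sqrtr // expr2 ler_peMr ?sqrtr_ge0 //.
  by apply: le_trans n4; rewrite ler1n.
have h4 : \sum_(k < K.+1) (`|a| + `|b|) ^+ k *
    (k%:R * D * (k`!%:R * (2 * expR 8)) + B * (2 * Num.sqrt n) ^+ k) <=
    (\sum_(k < K.+1) comparison_constant (`|a| + `|b|) k) / q.
  by rewrite mulr_suml; apply: ler_sum => k _; apply: error_le; rewrite ?addr_ge0 // -ltnS.
have -> : list_mean S (fun F => cos (c + linear_form a b (Z F))) =
    list_mean S (fun F => cos (c + (Num.sqrt n)^-1 * linear_form (- a) (- b) (\sum_x V F x))).
  by congr list_mean; apply/funext => F; rewrite linear_form_Z.
move: h1 h2; set u := list_mean _ _; set v := fmean _; set w := cos c * _ => h1 h2.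
rewrite -(subrK v u) -addrA; apply: le_trans (ler_normD _ _) _.
apply: lerD; first by apply: le_trans h1 _; rewrite lerD2r.
by apply: le_trans h2 _; rewrite [leRHS]mulrDl; apply: lerD.
Qed.

End Specialization.

(** * Uniformity in the field and the degrees *)

Section Limits.
Variables (R : realType) (p : nat).
Hypotheses (p_prime : prime p) (p_odd : odd p).

Definition sample (Fq : finFieldType) (chi : Fq -> R[i]) (d : 'I_p.-1 -> nat) : seq R[i] :=
  [seq ((Num.sqrt (#|Fq|%:R + 1))^-1)%:C * frob_trace p chi F
    | F <- fset_set [set F : {poly Fq} | Fhat_union d F]%classic].

(** Retains of a family only the list of its normalized traces, so that the limit argument can treat
    lists of complex numbers without reference to any field. *)
Definition large_sample (N : nat) (s : seq R[i]) : Prop :=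
  exists (Fq : finFieldType) (chi : Fq -> R[i]) (d : 'I_p.-1 -> nat),
    [/\ character_of_order p chi, (p %| \sum_(i < p.-1) i.+1 * d i)%N,
        (N <= #|Fq|)%N, (forall i, (N <= d i)%N) & s = sample chi d].

Lemma list_mean_sample (Fq : finFieldType) (chi : Fq -> R[i]) (d : 'I_p.-1 -> nat) (h : R[i] -> R) :
  list_mean (sample chi d) h =
  list_mean (fset_set [set F : {poly Fq} | Fhat_union d F]%classic)
    (fun F => h (((Num.sqrt (#|Fq|%:R + 1))^-1)%:C * frob_trace p chi F)).
Proof. by rewrite /list_mean /sample size_map big_map. Qed.

Let sqrt_ge (Fq : finFieldType) (x : R) : 0 <= x -> x ^+ 2 <= #|Fq|%:R ->
  x <= Num.sqrt #|{: option Fq}|%:R.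
Proof.
move=> x0 h; rewrite -[leLHS]ger0_norm // -sqrtr_sqr ler_wsqrtr // (le_trans h) //.
by rewrite card_option ler_nat.
Qed.

Lemma large_sample_gt0 : exists N, forall s, large_sample N s -> (0 < size s)%N.
Proof.
set r := #|'I_p.-1|.
exists (3 + 4 * r ^ 2)%N => s [Fq [chi [d [chiP Dp qN dN ->]]]].
rewrite size_map; apply: (size_sample_gt0 (R := R) (K := 0)) => //.
- by rewrite ler_nat; move: qN; lia.
- by rewrite -natrX -natrM ler_nat; move: qN; rewrite -/r; lia.
by move=> i; have := dN i; lia.
Qed.

Lemma large_sample_square : exists (N : nat) (M : R), forall s, large_sample N s ->
  list_mean s (fun z => complex.Re z ^+ 2 + complex.Im z ^+ 2) <= M.
Proof.
set r := #|'I_p.-1|.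
exists (16 + 4 * r ^ 2)%N, (8 * expR 2 + 2 * comparison_constant p 2 1 2).
move=> s [Fq [chi [d [chiP Dp qN dN ->]]]].
rewrite list_mean_sample; apply: sample_square => //.
- by rewrite ler_nat; move: qN; lia.
- by rewrite -natrX -natrM ler_nat; move: qN; rewrite -/r; lia.
- by move=> i; have := dN i; lia.
by apply: sqrt_ge => //; rewrite -natrX ler_nat; move: qN; lia.
Qed.

Let split_bound (x y z u v m : nat) : (x + y + z + (u + v) <= m)%N ->
  [/\ (x <= m)%N, (y <= m)%N, (z <= m)%N, (u <= m)%N & (v <= m)%N].
Proof. by move=> h; split; lia. Qed.

Lemma large_sample_cos (a b c eps : R) : 0 < eps -> exists N, forall s, large_sample N s ->
  `|list_mean s (fun z => cos (c + linear_form a b z)) -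
    cos c * expR (- ((a ^+ 2 + b ^+ 2) / 4))| < eps.
Proof.
move=> e0; set A := `|a| + `|b|; have A0 : 0 <= A by rewrite addr_ge0.
set r := #|'I_p.-1|.
pose E := 4 * expR (8 * A ^+ 2).
have E0 : 0 <= E by rewrite mulr_ge0 ?expR_ge0.
(* The order [K] is fixed by [eps] and [A] alone, before [q]: the constant [C] below depends on [K].
   Twice an Archimedean bound is even and makes [2 ^+ K] large enough. *)
have [K KE evK] : exists2 K, E / 2 ^+ K < eps / 3 & ~~ odd K.
  pose K := (2 * Num.bound (3 * E / eps))%N; exists K; last by rewrite /K mul2n odd_double.
  have h : 3 * E / eps < 2 ^+ K.
    apply: lt_le_trans (archi_boundP _) _; first by rewrite divr_ge0 ?mulr_ge0 // ltW.
    rewrite -natrX ler_nat; apply: leq_trans (ltnW (ltn_expl _ (ltnSn 1))) _.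
    by rewrite leq_exp2l // leq_pmull.
  move: h; rewrite ltr_pdivrMr // ltr_pdivrMr ?exprn_gt0 //; set t := 2 ^+ K; nra.
set C := \sum_(k < K.+1) comparison_constant p K A k.
have C0 : 0 <= C.
  by apply: sumr_ge0 => k _; apply: comparison_constant_ge0.
pose G := 2 * A ^+ 3 + 2 * ((a ^+ 2 + b ^+ 2) / 4) ^+ 2.
have G0 : 0 <= G by rewrite addr_ge0 // mulr_ge0 ?exprn_ge0 // divr_ge0 // addr_ge0 ?sqr_ge0.
(* One lower bound for the square root of [q + 1] that serves the three requirements [4], [4 A] and
   [3 G / eps]. *)
pose X := 4 + 4 * A + 3 * G / eps.
have G1 : 0 <= 3 * G / eps by rewrite divr_ge0 ?mulr_ge0 // ltW.
have X0 : 0 <= X by rewrite /X !addr_ge0 // mulr_ge0.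
have C1 : 0 <= 3 * C / eps by rewrite divr_ge0 ?mulr_ge0 // ltW.
have [N1 N1P] : exists N1 : nat, X ^+ 2 < N1%:R.
  by exists (Num.bound (X ^+ 2)); apply: archi_boundP; rewrite exprn_ge0.
have [N2 N2P] : exists N2 : nat, 3 * C / eps < N2%:R.
  by exists (Num.bound (3 * C / eps)); exact: archi_boundP.
exists (2 + 4 * r ^ 2 + (3 * K + 3) + (N1 + N2))%N.
move=> s [Fq [chi [d [chiP Dp qN dN ->]]]]; rewrite list_mean_sample.
have [q2' qr' _ qN1 qN2] := split_bound qN.
have q2 : 2 <= #|Fq|%:R :> R by rewrite ler_nat.
have qX : X ^+ 2 <= #|Fq|%:R by apply: ltW; apply: lt_le_trans N1P _; rewrite ler_nat.
have qC : 3 * C / eps < #|Fq|%:R by apply: lt_le_trans N2P _; rewrite ler_nat.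
have nX := sqrt_ge X0 qX.
have qr : 4 * #|'I_p.-1|%:R ^+ 2 <= #|Fq|%:R :> R by rewrite -natrX -natrM ler_nat.
have dK i : (3 * K + 2 < d i)%N.
  by have [_ _ + _ _] := split_bound (dN i); rewrite -[X in _ -> (X <= _)%N]addnS.
have A1 : 0 <= 4 * A by rewrite mulr_ge0.
set sn := Num.sqrt _ in nX.
have n4 : 4 <= sn by apply: le_trans nX; rewrite /X; lra.
have nA : 4 * A <= sn by apply: le_trans nX; rewrite /X; lra.
apply: le_lt_trans (@sample_cos Fq p d R chi p_prime p_odd chiP Dp K q2 qr dK a b c n4 nA evK) _.
rewrite -/A -/C -/E -/G -/sn.
have q0 : 0 < #|Fq|%:R :> R by apply: lt_le_trans q2.
have h1 : C / #|Fq|%:R < eps / 3.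
  by move: qC; rewrite ltr_pdivrMr // ltr_pdivrMr //; set t := #|Fq|%:R; nra.
have sn0 : 0 < sn by apply: lt_le_trans n4.
have h2 : G / sn <= eps / 3.
  have : 3 * G / eps <= sn by apply: le_trans nX; rewrite /X; lra.
  by rewrite ler_pdivrMr // ler_pdivrMr //; nra.
move: h1 h2 KE; set u := C / _; set v := G / _; set w := E / _; lra.
Qed.

End Limits.

(** * The Fourier transform of the Gaussian *)

Section GaussFourier.
Variable R : realType.
Local Notation mu := (@lebesgue_measure R).
Implicit Types b c y : R.

(** A Gaussian of slower decay: it dominates both [gauss_fun y] and [y * gauss_fun y], and is
    integrable as a multiple of the normal density. *)
Let w y : R := expR (- y ^+ 2 / 2).

Let integrable_w : mu.-integrable [set: R] (EFin \o w).
Proof.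
pose k : R := normal_peak 1.
have k0 : 0 < k by apply: normal_peak_gt0; rewrite oner_eq0.
have := @integrable_normal_pdf R 0 1; rewrite normal_pdfE ?oner_eq0 // => H.
have := integrableZl measurableT k^-1 H.
apply: eq_integrable => // y _; rewrite -EFinM mulKf ?gt_eqF //.
by rewrite /normal_fun /w subr0 expr1n.
Qed.

Lemma integrable_gauss_bounded (h : R -> R) (C : R) : continuous h ->
  (forall y, `|h y| <= C * expR (- y ^+ 2 / 2)) -> mu.-integrable [set: R] (EFin \o h).
Proof.
move=> ch hC; have H := integrableZl measurableT C integrable_w.
apply: le_integrable H => //.
  by apply/measurable_EFinP; exact: continuous_measurable_fun.
move=> y _ /=; rewrite lee_fin; apply: le_trans (hC y) _; exact: ler_norm.
Qed.

Lemma gauss_le y : gauss_fun y <= w y.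
Proof. by rewrite ler_expR mulNr lerN2 ler_piMr ?sqr_ge0 // invf_le1 // ler1n. Qed.

Lemma id_gauss_le y : `|y| * gauss_fun y <= w y.
Proof.
have -> : gauss_fun y = w y * expR (- (y ^+ 2 / 2)).
  by rewrite /gauss_fun /w -expRD; congr expR; field.
rewrite mulrCA ler_piMr ?expR_ge0 // expRN ler_pdivrMr ?expR_gt0 // mul1r.
apply: le_trans (expR_ge1Dx _); rewrite -(real_normK (num_real y)).
by have := sqr_ge0 (`|y| - 1); set t := `|y|; nra.
Qed.

Let phase c b y : R := cos (c + b * y).

Let derive_phase c b y : is_derive y 1 (phase c b) (- b * sin (c + b * y)).
Proof.
have -> : - b * sin (c + b * y) = - sin (c + b * y) * (0 + b * 1) by ring.
apply: (@is_derive1_comp _ (@cos R) (fun y : R => c + b * y) y).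
Qed.

Let derive_gauss y : is_derive y 1 (@gauss_fun R) (- (2 * y) * gauss_fun y).
Proof.
have -> : - (2 * y) * gauss_fun y = gauss_fun y * - (y * 1 + y * 1) by ring.
have sq : is_derive y 1 (fun y : R => - y ^+ 2) (- (y * 1 + y * 1)).
  exact: (@is_deriveN _ _ _ (fun y : R => y ^+ 2) _ _ _ (@is_deriveM _ _ id id y 1 1 1 _ _)).
exact: (@is_derive1_comp _ (@expR R) (fun y : R => - y ^+ 2) y).
Qed.

Let H c b y : R := phase c b y * gauss_fun y.
Let dH c b y : R := phase c b y * (- (2 * y) * gauss_fun y) + gauss_fun y * (- b * sin (c + b * y)).

Let derive_H c b y : is_derive y 1 (H c b) (dH c b y).
Proof. exact: (is_deriveM (derive_phase c b y) (derive_gauss y)). Qed.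

Lemma is_derive_continuous (h dh : R -> R) : (forall y : R, is_derive y 1 h (dh y)) -> continuous h.
Proof.
move=> hd y; apply/differentiable_continuous/derivable1_diffP.
by have [] := hd y.
Qed.

Let continuous_affine c b : continuous (fun y => c + b * y).
Proof.
apply: (@is_derive_continuous _ (fun=> 0 + b * 1)) => y; exact: is_deriveD.
Qed.

Let continuous_phase c b : continuous (phase c b).
Proof. exact: (is_derive_continuous (derive_phase c b)). Qed.

Let continuous_sin_phase c b : continuous (fun y => sin (c + b * y)).
Proof. by move=> y; apply: continuous_comp; [exact: continuous_affine|exact: continuous_sin]. Qed.

Let continuous_id_gauss : continuous (fun y : R => y * gauss_fun y).
Proof. by move=> y; apply: cvgM; [exact: cvg_id|exact: continuous_gauss_fun]. Qed.

Let continuous_H c b : continuous (H c b).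
Proof. exact: (is_derive_continuous (derive_H c b)). Qed.

Lemma integrable_gauss_wave c b : mu.-integrable [set: R] (EFin \o (fun y => cos (c + b * y) * gauss_fun y)).
Proof.
apply: (@integrable_gauss_bounded _ 1); first exact: continuous_H.
move=> y; rewrite mul1r normrM [X in _ * X]ger0_norm ?gauss_fun_ge0 //.
by apply: le_trans (gauss_le y); rewrite ler_piMl ?gauss_fun_ge0 // cos_max.
Qed.

Let i_sin c b : mu.-integrable [set: R] (EFin \o (fun y => sin (c + b * y) * gauss_fun y)).
Proof.
apply: (@integrable_gauss_bounded _ 1).
  by move=> y; apply: cvgM; [exact: continuous_sin_phase|exact: continuous_gauss_fun].
move=> y; rewrite mul1r normrM [X in _ * X]ger0_norm ?gauss_fun_ge0 //.
by apply: le_trans (gauss_le y); rewrite ler_piMl ?gauss_fun_ge0 // sin_max.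
Qed.

Let i_ycos c b : mu.-integrable [set: R] (EFin \o (fun y => cos (c + b * y) * (y * gauss_fun y))).
Proof.
apply: (@integrable_gauss_bounded _ 1).
  by move=> y; apply: cvgM; [exact: continuous_phase|exact: continuous_id_gauss].
move=> y; rewrite mul1r !normrM (ger0_norm (gauss_fun_ge0 y)) ?gauss_fun_ge0 //.
apply: le_trans (id_gauss_le y); rewrite ler_piMl ?mulr_ge0 ?gauss_fun_ge0 //; exact: cos_max.
Qed.

Let dHE c b : dH c b = fun y => - 2 * (cos (c + b * y) * (y * gauss_fun y)) - b * (sin (c + b * y) * gauss_fun y).
Proof. by apply/funext => y; rewrite /dH /phase; ring. Qed.

Let continuous_dH c b : continuous (dH c b).
Proof.
rewrite dHE => y; apply: cvgB; apply: cvgM; try exact: cvg_cst.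
  by apply: cvgM; [exact: continuous_phase|exact: continuous_id_gauss].
by apply: cvgM; [exact: continuous_sin_phase|exact: continuous_gauss_fun].
Qed.

Let i_dH c b : mu.-integrable [set: R] (EFin \o dH c b).
Proof.
rewrite dHE; have h1 := integrableZl measurableT (- 2) (i_ycos c b).
have h2 := integrableZl measurableT b (i_sin c b).
by apply: eq_integrable (integrableB measurableT h1 h2).
Qed.

Let integral_dH_segment c b (n : nat) :
  (\int[mu]_(x in `[(- n%:R)%R, n%:R]) (dH c b x)%:E)%E = (H c b n%:R - H c b (- n%:R))%:E.
Proof.
case: n => [|n].
  by rewrite oppr0 set_itv1 integral_set1 subrr.
rewrite (continuous_FTC2 (F := H c b)) //.
- by rewrite -subr_gt0 opprK addr_gt0.
- by apply: continuous_subspaceT => y; exact: continuous_dH.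
- split.
  + by move=> y _; have [] := derive_H c b y.
  + by apply: cvg_at_right_filter; exact: continuous_H.
  + by apply: cvg_at_left_filter; exact: continuous_H.
by move=> y _; rewrite derive1E; apply: derive_val.
Qed.

Let cvg_H c b : ((fun n : nat => H c b n%:R - H c b (- n%:R)) @ \oo --> (0 : R))%classic.
Proof.
have hn : ((fun n : nat => gauss_fun n%:R : R) @ \oo --> (0 : R))%classic.
  by apply: (cvg_comp _ _ _ cvg_gauss_fun); exact: cvgr_idn.
apply: norm_cvg0.
apply: (@squeeze_cvgr _ _ _ _ (cst 0) (fun n => 2 * gauss_fun n%:R)).
- apply: nearW => n; rewrite /= normr_ge0 /=.
  apply: le_trans (ler_normB _ _) _; rewrite mulr_natl mulr2n; apply: lerD.
    by rewrite /H normrM (ger0_norm (gauss_fun_ge0 n%:R)) ler_piMl ?gauss_fun_ge0 // cos_max.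
  rewrite /H normrM (ger0_norm (gauss_fun_ge0 (- n%:R))) /gauss_fun sqrrN.
  by rewrite ler_piMl ?expR_ge0 // cos_max.
- exact: cvg_cst.
- by rewrite (_ : 0 = 2 * 0 :> R); [apply: cvgM => //; exact: cvg_cst|rewrite mulr0].
Qed.

(** The derivative of [cos (c + b y) * gauss_fun y] has integral zero: over [[- n, n]] it is a
    difference of boundary values tending to 0, and dominated convergence passes to the line. *)
Lemma integral_by_parts_gauss c b :
  \int[mu]_y (cos (c + b * y) * (y * gauss_fun y)) =
  - (b / 2) * \int[mu]_y (sin (c + b * y) * gauss_fun y).
Proof.
have Z : (\int[mu]_x (dH c b x)%:E)%E = 0%E.
  pose f_ (n : nat) : R -> \bar R := (EFin \o dH c b) \_ `[(- n%:R)%R, n%:R]%classic.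
  have mdH : measurable_fun setT (EFin \o dH c b).
    by apply/measurable_EFinP; exact: continuous_measurable_fun.
  have mf n : measurable_fun setT (f_ n).
    by apply/(measurable_restrictT _ _).1 => //; exact: measurable_funTS.
  have cf : {ae mu, forall x, setT x -> ((fun n => f_ n x) @ \oo --> (EFin \o dH c b) x)%classic}.
    apply: aeW => x _; apply: cvg_near_cst; near=> n.
    rewrite /f_ patchE mem_set //= in_itv /= -ler_norml.
    by near: n; exact: nbhs_infty_ger.
  have bf : {ae mu, forall x n, setT x -> (`|f_ n x| <= (EFin \o (fun y => `|dH c b y|)%R) x)%E}.
    apply: aeW => x n _; rewrite /f_ patchE; case: ifP => _ //=.
    by rewrite normr0 lee_fin.
  have iF : mu.-integrable setT (EFin \o (fun y => `|dH c b y|)) by exact: (integrable_abse (i_dH c b)).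
  have [_ _ C] := @dominated_convergence _ _ R mu setT measurableT f_ (EFin \o dH c b)
    (EFin \o (fun y => `|dH c b y|)) mf mdH cf iF bf.
  apply: (cvg_unique _ C) => //.
  have -> : [sequence (\int[mu]_x f_ n x)%E]_n = (fun n => (H c b n%:R - H c b (- n%:R))%:E).
    by apply/funext => n; rewrite -integral_dH_segment [RHS]integral_mkcond.
  by apply: (cvg_comp _ _ (cvg_H c b)); exact: cvg_id.
have : \int[mu]_x (dH c b x) = 0 by rewrite /Rintegral Z.
rewrite dHE RintegralB //; last first.
- exact: (integrableZl measurableT b (i_sin c b)).
- exact: (integrableZl measurableT (- 2) (i_ycos c b)).
rewrite !RintegralZl //; (try exact: i_sin); (try exact: i_ycos).
set u := \int[mu]_x _; set v := \int[mu]_x _; lra.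
Unshelve. all: end_near. Qed.

Let J c b := \int[mu]_y (cos (c + b * y) * gauss_fun y).

(** Differentiation under the integral brings out [- y sin (c + b y)], which is [y] times the cosine
    with phase [c + pi / 2]; the integration by parts with that phase returns the original
    integral. *)
Let derive_J c b : is_derive b 1 (J c) (- (b / 2) * J c b).
Proof.
pose f (x y : R) : R := cos (c + x * y) * gauss_fun y.
have fd (x y : R) : is_derive x 1 (f ^~ y) (- sin (c + x * y) * y * gauss_fun y).
  have -> : - sin (c + x * y) * y * gauss_fun y =
    cos (c + x * y) * 0 + gauss_fun y * (- sin (c + x * y) * (0 + (x * 0 + y * 1))) by ring.
  apply: (@is_deriveM _ _ (fun x : R => cos (c + x * y)) (cst (gauss_fun y))).
have d1 x y : partial1of2 f x y = - sin (c + x * y) * y * gauss_fun y.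
  by rewrite partial1of2E; apply: derive_val.
have Ib : `]b - 1, b + 1[%classic b by rewrite /= in_itv /=; apply/andP; split; lra.
have intf x : `]b - 1, b + 1[%classic x -> mu.-integrable setT (EFin \o f x).
  by move=> _; exact: integrable_gauss_wave.
have fder x y : `]b - 1, b + 1[%classic x -> setT y -> derivable (f ^~ y) x 1.
  by move=> _ _; have [] := fd x y.
have w0 y : 0 <= w y by exact: expR_ge0.
have bd x y : `]b - 1, b + 1[%classic x -> setT y -> `|partial1of2 f x y| <= w y.
  move=> _ _; rewrite d1 !normrM normrN (ger0_norm (gauss_fun_ge0 y)) ?gauss_fun_ge0 //.
  apply: le_trans (id_gauss_le y); rewrite -mulrA ler_piMl ?mulr_ge0 ?gauss_fun_ge0 //; exact: sin_max.
have D1 := differentiation_under_integral measurableT Ib intf fder w0 integrable_w bd.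
have D2 := derivable_under_integral measurableT Ib intf fder w0 integrable_w bd.
apply: DeriveDef; first exact: D2.
rewrite -derive1E D1.
have -> : (fun y => partial1of2 f b y) = (fun y => cos (c + pi / 2 + b * y) * (y * gauss_fun y)).
  by apply/funext => y; rewrite d1 addrAC cosDpihalf mulrA.
rewrite integral_by_parts_gauss; congr (_ * _); apply: eq_Rintegral => y _.
by rewrite addrAC sinDpihalf.
Qed.

(** The differential equation for [J] says that [J c x * expR (x ^+ 2 / 4)] is constant in [x]; at
    [x = 0] it is the Gaussian integral. *)
Lemma gauss_fourier c b : \int[mu]_y (cos (c + b * y) * gauss_fun y) =
  Num.sqrt pi * cos c * expR (- (b ^+ 2 / 4)).
Proof.
pose k x := J c x * expR (x ^+ 2 / 4).
have kd (x : R) : is_derive x 1 k 0.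
  have ed : is_derive x 1 (fun x : R => expR (x ^+ 2 / 4)) (expR (x ^+ 2 / 4) * (x / 2)).
    have -> : x / 2 = x ^+ 2 * 0 + 4^-1 * (x * 1 + x * 1) by field.
    apply: (@is_derive1_comp _ (@expR R) (fun x : R => x ^+ 2 / 4) x).
    exact: (@is_deriveM _ _ (fun x : R => x ^+ 2) (cst 4^-1) x 1 _ _ (@is_deriveM _ _ id id x 1 1 1 _ _)).
  have := is_deriveM (derive_J c x) ed.
  by congr (is_derive x 1 _ _); rewrite /GRing.scale /=; field.
have := is_derive_0_is_cst b 0 kd; rewrite /k expr0n mul0r expR0 mulr1 => E.
have -> : \int[mu]_y (cos (c + b * y) * gauss_fun y) = J c 0 * expR (- (b ^+ 2 / 4)).
  by rewrite -E -mulrA -expRD subrr expR0 mulr1.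
congr (_ * _); rewrite /J.
transitivity (cos c * \int[mu]_y (gauss_fun y)).
  rewrite -(@RintegralZl _ _ _ mu setT _ (cos c) measurableT (@integrableT_gauss R)).
  by apply: eq_Rintegral => y _; rewrite mul0r addr0.
by rewrite /Rintegral integralT_gauss /= mulrC.
Qed.

End GaussFourier.

(** * The Gaussian measure on the plane *)

Section Gauss2.
Variable R : realType.
Local Notation mu := (@lebesgue_measure R).
Local Notation mu2 := (mu \x mu)%E.
Implicit Types (z : R * R).

Lemma pdfE x y : complex_gaussian_pdf (x, y) = pi^-1 * (gauss_fun x * gauss_fun y) :> R.
Proof. by rewrite /complex_gaussian_pdf /gauss_fun -expRD opprD. Qed.

Lemma pdf_ge0 z : 0 <= complex_gaussian_pdf z.
Proof. by rewrite mulr_ge0 ?expR_ge0 // invr_ge0 pi_ge0. Qed.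

Lemma measurable_pdf : measurable_fun setT (@complex_gaussian_pdf R).
Proof.
apply: measurable_funM; first exact: measurable_cst.
apply: measurableT_comp => //; apply: measurableT_comp => //.
by apply: measurable_funD; apply: measurable_funX; [exact: measurable_fst|exact: measurable_snd].
Qed.

Lemma measurable_wave (a b c : R) : measurable_fun setT (fun z => cos (c + (a * z.1 + b * z.2))).
Proof.
apply: measurableT_comp; first by apply: continuous_measurable_fun; exact: continuous_cos.
apply: measurable_funD; first exact: measurable_cst.
by apply: measurable_funD; apply: measurable_funM; try exact: measurable_cst;
  [exact: measurable_fst|exact: measurable_snd].
Qed.

Lemma gauss_fourierE (c b k : R) :
  (\int[mu]_y (k * (cos (c + b * y) * gauss_fun y))%:E)%E =
  (k * (Num.sqrt pi * cos c * expR (- (b ^+ 2 / 4))))%:E.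
Proof.
have i1 := @integrable_gauss_wave R c b.
rewrite -gauss_fourier -(@RintegralZl _ _ _ mu setT _ k measurableT i1) /Rintegral fineK //.
exact: (integrable_fin_num measurableT (integrableZl measurableT k i1)).
Qed.

Let sqrt_pi2 : Num.sqrt pi * Num.sqrt pi = pi :> R.
Proof. by rewrite -expr2 sqr_sqrtr // pi_ge0. Qed.

Lemma integrable_pdf : mu2.-integrable setT (EFin \o @complex_gaussian_pdf R).
Proof.
apply/integrable12ltyP; first by apply/measurable_EFinP; exact: measurable_pdf.
rewrite (_ : (\int[mu]_x \int[mu]_y `|(EFin \o @complex_gaussian_pdf R) (x, y)|)%E = 1%E) ?ltry //.
transitivity (\int[mu]_x (pi^-1 * Num.sqrt pi * (cos (0 + 0 * x) * gauss_fun x))%:E)%E.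
  apply: eq_integral => x _.
  transitivity (\int[mu]_y (pi^-1 * gauss_fun x * (cos (0 + 0 * y) * gauss_fun y))%:E)%E.
    apply: eq_integral => y _; rewrite /= ger0_norm ?pdf_ge0 // pdfE.
    by rewrite mul0r addr0 cos0 mul1r mulrA.
  rewrite gauss_fourierE mul0r addr0 cos0 expr0n mul0r oppr0 expR0 !mulr1 mul1r.
  by congr EFin; ring.
rewrite gauss_fourierE cos0 expr0n mul0r oppr0 expR0 !mulr1.
by rewrite -mulrA sqrt_pi2 mulVf // gt_eqF // pi_gt0.
Qed.

Lemma integrable_bounded_pdf (h : R * R -> R) (M : R) : measurable_fun setT h ->
  (forall z, `|h z| <= M) -> mu2.-integrable setT (EFin \o (fun z => h z * complex_gaussian_pdf z)).
Proof.
move=> mh hM; apply: (le_integrable measurableT _ _ (integrableZl measurableT M integrable_pdf)).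
  by apply/measurable_EFinP; apply: measurable_funM => //; exact: measurable_pdf.
move=> z _ /=; rewrite lee_fin normrM [leRHS]normrM ler_wpM2r //.
by apply: le_trans (hM z) _; exact: ler_norm.
Qed.

(** By Fubini; for fixed [x] the inner integral has phase [c + a x], which is why the
    one-dimensional formula carries a phase. *)
Lemma complex_gaussian_cos (a b c : R) :
  complex_gaussian_mean (fun z : R[i] => cos (c + linear_form a b z)) =
  cos c * expR (- ((a ^+ 2 + b ^+ 2) / 4)).
Proof.
rewrite /complex_gaussian_mean /Rintegral.
have iw : mu2.-integrable setT (EFin \o (fun z => cos (c + (a * z.1 + b * z.2)) * complex_gaussian_pdf z)).
  by apply: (@integrable_bounded_pdf _ 1) => [|z]; [exact: measurable_wave|exact: cos_max].
rewrite (_ : (\int[mu2]_z _)%E = (cos c * expR (- ((a ^+ 2 + b ^+ 2) / 4)))%:E) //.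
rewrite -(integral12_prod_meas1 iw) /fubini_F.
transitivity (\int[mu]_x (pi^-1 * Num.sqrt pi * expR (- (b ^+ 2 / 4)) * (cos (c + a * x) * gauss_fun x))%:E)%E.
  apply: eq_integral => x _.
  transitivity (\int[mu]_y (pi^-1 * gauss_fun x * (cos (c + a * x + b * y) * gauss_fun y))%:E)%E.
    by apply: eq_integral => y _; rewrite /= pdfE addrA; congr EFin; ring.
  by rewrite gauss_fourierE; congr EFin; ring.
rewrite gauss_fourierE mulrDl opprD expRD; congr EFin.
have p0 : pi^-1 * (Num.sqrt pi * Num.sqrt pi) = 1 :> R by rewrite sqrt_pi2 mulVf // gt_eqF // pi_gt0.
transitivity (pi^-1 * (Num.sqrt pi * Num.sqrt pi) *
  (cos c * (expR (- (a ^+ 2 / 4)) * expR (- (b ^+ 2 / 4))))); first by ring.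
by rewrite p0 mul1r.
Qed.

End Gauss2.

(** * Approximation by trigonometric polynomials *)

Section TrigPolynomials.
Variable R : realType.

(** Generated by waves and sums, because the limit statement is linear and known for waves; closure
    under products comes from the addition formulas. *)
Inductive trig_poly : (R[i] -> R) -> Prop :=
| trig_wave (k a b c : R) : trig_poly (fun z => k * cos (c + linear_form a b z))
| trig_add g h : trig_poly g -> trig_poly h -> trig_poly (fun z => g z + h z).

Lemma trig_const (k : R) : trig_poly (fun=> k).
Proof.
have := trig_wave k 0 0 0; congr trig_poly; apply/funext => z.
by rewrite /linear_form !mul0r !addr0 cos0 mulr1.
Qed.

Lemma trig_mul g h : trig_poly g -> trig_poly h -> trig_poly (fun z => g z * h z).
Proof.
move=> tg; elim: tg h => {g} [k a b c h|g1 g2 _ IH1 _ IH2 h th]; last first.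
  have := trig_add (IH1 _ th) (IH2 _ th); congr trig_poly; apply/funext => z.
  by rewrite mulrDl.
elim=> {h} [k' a' b' c'|h1 h2 _ IH1 _ IH2]; last first.
  have := trig_add IH1 IH2; congr trig_poly; apply/funext => z.
  by rewrite mulrDr.
have := trig_add (trig_wave (k * k' / 2) (a + a') (b + b') (c + c'))
  (trig_wave (k * k' / 2) (a - a') (b - b') (c - c')).
congr trig_poly; apply/funext => z.
have -> : c + c' + linear_form (a + a') (b + b') z = (c + linear_form a b z) + (c' + linear_form a' b' z).
  by rewrite /linear_form; ring.
have -> : c - c' + linear_form (a - a') (b - b') z = (c + linear_form a b z) - (c' + linear_form a' b' z).
  by rewrite /linear_form; ring.
by rewrite cosD cosB; field.
Qed.

Lemma trig_scale (k : R) h : trig_poly h -> trig_poly (fun z => k * h z).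
Proof. exact: (trig_mul (trig_const k)). Qed.

Lemma trig_measurable h : trig_poly h -> measurable_fun setT (fun z : R * R => h (z.1 +i* z.2)).
Proof.
elim=> {h} [k a b c|g h _ mg _ mh]; last exact: measurable_funD.
by apply: measurable_funM; [exact: measurable_cst|exact: measurable_wave].
Qed.

Lemma trig_bounded h : trig_poly h -> exists M, forall z, `|h z| <= M.
Proof.
elim=> {h} [k a b c|g h _ [M gM] _ [N hN]].
  by exists `|k| => z; rewrite normrM ler_piMr // cos_max.
by exists (M + N) => z; apply: le_trans (ler_normD _ _) _; exact: lerD.
Qed.

End TrigPolynomials.

(** * Bernstein polynomials *)

Section Bernstein.
Variable R : realFieldType.
Implicit Types (g h : nat -> R) (s x : R).

(* The value at s of the k-th Bernstein polynomial of g (i / k), that is the mean of g at a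
   binomial variable with parameters k and s. *)
Fixpoint bernstein k g s : R :=
  if k is l.+1 then s * bernstein l (g \o succn) s + (1 - s) * bernstein l g s else g 0%N.

Lemma bernstein_const k (c s : R) : bernstein k (fun=> c) s = c.
Proof. by elim: k => //= k; rewrite /comp => ->; ring. Qed.

Lemma ler_bernstein k g h s : 0 <= s <= 1 -> (forall i, (i <= k)%N -> g i <= h i) ->
  bernstein k g s <= bernstein k h s.
Proof.
move=> /andP[s0 s1]; elim: k g h => [|k IH] g h gh /=; first exact: gh.
apply: lerD; apply: ler_wpM2l; rewrite ?subr_ge0 //; apply: IH => i ik /=; apply: gh => //.
exact: leqW.
Qed.

Lemma bernsteinD k g h s : bernstein k (fun i => g i + h i) s = bernstein k g s + bernstein k h s.
Proof. by elim: k g h => //= k IH g h; rewrite /comp !IH; ring. Qed.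

Lemma bernsteinZ k c g s : bernstein k (fun i => c * g i) s = c * bernstein k g s.
Proof. by elim: k g => //= k IH g; rewrite /comp !IH; ring. Qed.

(** The second moment of a binomial variable about [x]. The centre must be arbitrary for the
    induction, since a success in the first trial moves it to [x - 1]. *)
Lemma bernstein_variance k x s :
  bernstein k (fun i => (i%:R - x) ^+ 2) s = (k%:R * s - x) ^+ 2 + k%:R * (s * (1 - s)).
Proof.
elim: k x => [|k IH] x /=; first by rewrite !mul0r addr0.
rewrite IH (_ : (_ \o succn) = (fun i => (i%:R - (x - 1)) ^+ 2)).
  by rewrite IH -natr1; ring.
by apply/funext => i /=; rewrite -natr1; ring.
Qed.

(** A Chebyshev estimate in two variables: each quadratic deviation has mean [k s (1 - s)], hence at
    most [k]. *)
Lemma bernstein2_le k (s t e c y : R) (g : nat -> nat -> R) : 0 <= s <= 1 -> 0 <= t <= 1 -> 0 <= c ->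
  (forall i j, (i <= k)%N -> (j <= k)%N ->
    g i j <= y + (e + c * ((i%:R - k%:R * s) ^+ 2 + (j%:R - k%:R * t) ^+ 2))) ->
  bernstein k (fun i => bernstein k (g i) t) s <= y + (e + 2 * c * k%:R).
Proof.
move=> s01 t01 c0 gle.
have var u : 0 <= u <= 1 -> bernstein k (fun i => c * (i%:R - k%:R * u) ^+ 2) u <= c * k%:R.
  move=> /andP[u0 u1]; rewrite bernsteinZ bernstein_variance subrr expr0n add0r.
  by rewrite ler_wpM2l // ler_piMr // mulr_ile1 ?subr_ge0 // lerBlDr lerDl.
apply: (@le_trans _ _ (bernstein k (fun i => (y + e + c * k%:R) + c * (i%:R - k%:R * s) ^+ 2) s)).
  apply: ler_bernstein => // i ik.
  apply: (@le_trans _ _ (bernstein k (fun j => (y + e + c * (i%:R - k%:R * s) ^+ 2) +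
     c * (j%:R - k%:R * t) ^+ 2) t)).
    by apply: ler_bernstein => // j jk; apply: le_trans (gle _ _ ik jk) _; rewrite le_eqVlt; apply/orP; left; apply/eqP; ring.
  by rewrite bernsteinD bernstein_const; have := var _ t01; lra.
by rewrite bernsteinD bernstein_const; have := var _ s01; lra.
Qed.

End Bernstein.

Lemma trig_bernstein (R : realType) k (G : nat -> R[i] -> R) (s : R[i] -> R) :
  (forall i, trig_poly (G i)) -> trig_poly s -> trig_poly (fun z => bernstein k (G^~ z) (s z)).
Proof.
move=> tG ts; elim: k G tG => [|k IH] G tG /=; first exact: tG.
apply: trig_add; apply: trig_mul => //.
- exact: (IH (fun i => G i.+1)).
- by apply: trig_add; [exact: trig_const|have := trig_scale (-1) ts; congr trig_poly; apply/funext => z; rewrite mulN1r].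
exact: IH.
Qed.

(** * How far the sine separates points *)

Section Sine.
Variable R : realType.
(** The angle [3 pi / 8] is half of [pi / 4 + pi / 2], the largest possible half-sum or
    half-difference in [sin_sub_ge]. *)
Let kappa : R := cos (3 * pi / 8).

Let kappa_gt0 : 0 < kappa.
Proof. by apply: cos_gt0_pihalf; have := pi_gt0 R; lra. Qed.

Lemma cos_ge_kappa (m : R) : `|m| <= 3 * pi / 8 -> kappa <= cos m.
Proof.
move=> m3; have -> : cos m = cos `|m| by case: (ler0P m) => _ //; rewrite cosN.
have p0 := pi_gt0 R; rewrite leNgt ltr_cos; first by rewrite -leNgt.
  by rewrite in_itv /=; lra.
by rewrite in_itv /= normr_ge0 /=; lra.
Qed.

Lemma sin_ge_kappa (h : R) : `|h| <= 3 * pi / 8 -> kappa * `|h| <= `|sin h|.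
Proof.
wlog h0 : h / 0 <= h.
  move=> H; have [|/ltW] := leP 0 h; first exact: H.
  by rewrite -oppr_ge0 => /H; rewrite sinN !normrN.
rewrite (ger0_norm h0) => h3.
have cs : {within `[0, h], continuous (@sin R)}%classic.
  by apply: continuous_subspaceT => x; exact: continuous_sin.
have [x xh] := MVT_segment h0 (fun x _ => is_derive_sin x) cs.
rewrite sin0 !subr0 => ->; rewrite normrM (ger0_norm h0) ler_wpM2r //.
apply: le_trans (ler_norm _); apply: cos_ge_kappa.
move: xh; rewrite in_itv /= => /andP[x0 xh]; rewrite ger0_norm //; exact: le_trans xh h3.
Qed.

(** By [sin A - sin B = 2 cos m sin h]. The ranges differ on purpose: [B] runs through the nodes, up
    to the critical points of the sine, while [A] stays away from them. *)
Lemma sin_sub_ge (A B : R) : `|A| <= pi / 4 -> `|B| <= pi / 2 ->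
  kappa ^+ 2 * `|A - B| <= `|sin A - sin B|.
Proof.
move=> A4 B2; pose m := (A + B) / 2; pose h := (A - B) / 2.
have m3 : `|m| <= 3 * pi / 8.
  rewrite /m normrM (ger0_norm (x := 2^-1)) // ; have := ler_normD A B; move: A4 B2; set u := `|A|; set v := `|B|; lra.
have h3 : `|h| <= 3 * pi / 8.
  rewrite /h normrM (ger0_norm (x := 2^-1)) // ; have := ler_normB A B; move: A4 B2; set u := `|A|; set v := `|B|; lra.
have -> : sin A - sin B = 2 * (cos m * sin h).
  have -> : A = m + h by rewrite /m /h; field.
  have -> : B = m - h by rewrite /m /h; field.
  by rewrite sinD sinB; ring.
have -> : A - B = 2 * h by rewrite /h; field.
move: m h m3 h3 => m h m3 h3.
rewrite !normrM (ger0_norm (x := 2)) // mulrCA ler_wpM2l // expr2 -mulrA.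
apply: ler_pM; rewrite ?mulr_ge0 ?(ltW kappa_gt0) //; last exact: sin_ge_kappa.
by apply: le_trans (ler_norm _); exact: cos_ge_kappa.
Qed.

Lemma sin_separation : exists2 k : R, 0 < k & forall A B : R, `|A| <= pi / 4 -> `|B| <= pi / 2 ->
  k * `|A - B| <= `|sin A - sin B|.
Proof. by exists (kappa ^+ 2); [exact: exprn_gt0|exact: sin_sub_ge]. Qed.

End Sine.

(** * Uniform continuity of the test function *)

Section UniformContinuity.
Variables (R : realType) (f : R[i] -> R).
Hypothesis f_cont : continuous (f : R[i]^o -> R).

Lemma complex_continuousP (z : R[i]) (e : R) : 0 < e -> exists2 r : R, 0 < r &
  forall w, `|complex.Re w - complex.Re z| < r -> `|complex.Im w - complex.Im z| < r -> `|f z - f w| < e.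
Proof.
move=> e0; have /cvgrPdist_lt /(_ e e0) /nbhs_normP [r /= r0 H] := @f_cont z.
(* Radii of balls in [R[i]^o] are elements of [R[i]]; a positive one is real. *)
have r1 : 0 < complex.Re r by move: r0; rewrite ltcE => /andP[].
have rE : r = (complex.Re r)%:C.
  by move: r0; rewrite ltcE /= => /andP[/eqP E _]; case: (r) E => x y /= ->.
exists (complex.Re r / 2); first by rewrite divr_gt0.
move=> w w1 w2; apply: H => /=.
have -> : (z : R[i]) - w = (complex.Re z - complex.Re w) +i* (complex.Im z - complex.Im w).
  by case: (z) => a b; case: (w) => c d.
apply: le_lt_trans (norm_complex_le _ _) _; rewrite rE ltcR distrC (distrC (complex.Im z)).
by move: w1 w2; set u := `|_|; set v := `|_|; lra.
Qed.

(** Only one of the two points is confined to the square, since the Bernstein nodes may lie outside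
    it. *)
Lemma uniform_continuity_square (L e : R) : 0 < e -> exists2 r : R, 0 < r & forall x y x' y' : R,
  `|x| <= L -> `|y| <= L -> `|x' - x| < r -> `|y' - y| < r -> `|f (x +i* y) - f (x' +i* y')| < e.
Proof.
move=> e0; pose K := (`[(- L), L] `*` `[(- L), L])%classic : set (R * R).
have cK : compact K by apply: compact_setX; exact: segment_compact.
pose P (n : nat) (z : R * R) := forall x' y', `|x' - z.1| < n.+1%:R^-1 -> `|y' - z.2| < n.+1%:R^-1 ->
  `|f (z.1 +i* z.2) - f (x' +i* y')| < e.
have [] := (compact_near_coveringP K).1 cK nat \oo%classic P _ _.
  move=> z Kz; have e2 : 0 < e / 2 by rewrite divr_gt0.
  have [r r0 H] := complex_continuousP (z.1 +i* z.2) e2.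
  have r2 : 0 < r / 2 by rewrite divr_gt0.
  have [n0 n0r] : exists n0 : nat, n0.+1%:R^-1 < r / 2.
    exists (Num.bound (r / 2)^-1); rewrite invf_plt ?posrE //.
    apply: lt_trans (archi_boundP _) _; first by rewrite invr_ge0 ltW.
    by rewrite ltr_nat.
  exists ((ball z (r / 2)), [set n | (n0 <= n)%N])%classic.
    by split; [exact: nbhsx_ballx|exists n0].
  move=> [w n] /= [[w1 w2] n0n] x' y' h1 h2.
  have nr : n.+1%:R^-1 < r / 2 :> R.
    by apply: le_lt_trans n0r; rewrite lef_pV2 ?posrE ?ltr0n // ler_nat.
  rewrite /ball /= in w1 w2.
  have d1 : `|f (z.1 +i* z.2) - f (w.1 +i* w.2)| < e / 2.
    by apply: H => /=; rewrite distrC; [apply: lt_trans w1 _|apply: lt_trans w2 _]; lra.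
  have d2 : `|f (z.1 +i* z.2) - f (x' +i* y')| < e / 2.
    apply: H => /=.
      rewrite -(subrK w.1 x') -addrA; apply: le_lt_trans (ler_normD _ _) _.
      by rewrite distrC in w1; apply: lt_le_trans (ltrD (lt_trans h1 nr) w1) _; lra.
    rewrite -(subrK w.2 y') -addrA; apply: le_lt_trans (ler_normD _ _) _.
    by rewrite distrC in w2; apply: lt_le_trans (ltrD (lt_trans h2 nr) w2) _; lra.
  have -> : f (w.1 +i* w.2) - f (x' +i* y') = (f (z.1 +i* z.2) - f (x' +i* y')) - (f (z.1 +i* z.2) - f (w.1 +i* w.2)).
    by ring.
  by apply: le_lt_trans (ler_normB _ _) _; move: d1 d2; set u := `|_|; set v := `|_|; lra.
move=> n _ /(_ n (leqnn n)) Hn; exists n.+1%:R^-1; first by rewrite invr_gt0.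
move=> x y x' y' xL yL; apply: (Hn (x, y)).
by split; rewrite /= in_itv /= -ler_norml.
Qed.

End UniformContinuity.

Lemma bernstein2_dist (R : realFieldType) k (s t e c y : R) (g : nat -> nat -> R) :
  0 <= s <= 1 -> 0 <= t <= 1 -> 0 <= c ->
  (forall i j, (i <= k)%N -> (j <= k)%N ->
    `|g i j - y| <= e + c * ((i%:R - k%:R * s) ^+ 2 + (j%:R - k%:R * t) ^+ 2)) ->
  `|bernstein k (fun i => bernstein k (g i) t) s - y| <= e + 2 * c * k%:R.
Proof.
move=> s01 t01 c0 gle.
have up : bernstein k (fun i => bernstein k (g i) t) s <= y + (e + 2 * c * k%:R).
  apply: bernstein2_le => // i j ik jk; rewrite addrC -lerBlDr.
  exact: le_trans (ler_norm _) (gle _ _ ik jk).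
have lo : - bernstein k (fun i => bernstein k (g i) t) s <= - y + (e + 2 * c * k%:R).
  rewrite -mulN1r -bernsteinZ.
  rewrite (_ : (fun i => _) = (fun i => bernstein k (fun j => -1 * g i j) t)); last first.
    by apply/funext => i; rewrite bernsteinZ.
  apply: bernstein2_le => // i j ik jk; rewrite mulN1r addrC -lerBlDr opprK addrC.
  by apply: le_trans (ler_norm _) _; rewrite distrC; exact: gle.
by rewrite ler_norml; apply/andP; split; lra.
Qed.

Section Approximation.
Variables (R : realType) (f : R[i] -> R) (M : R).
Hypothesis f_cont : continuous (f : R[i]^o -> R).
Hypothesis f_bound : forall z, `|f z| <= M.

Let M_ge0 : 0 <= M. Proof. exact: le_trans (normr_ge0 _) (f_bound 0). Qed.

Lemma trig_approximation (L e : R) : 0 < L -> 0 < e -> exists T : R[i] -> R,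
  [/\ trig_poly T, forall z, `|T z| <= M &
      forall z, `|complex.Re z| <= L -> `|complex.Im z| <= L -> `|f z - T z| <= e].
Proof.
move=> L0 e0; have p0 := pi_gt0 R.
(* With this scale the square is mapped to angles up to [pi / 4], while the nodes, at angles up to
   [pi / 2], stay within the square of half-side [2 L]. *)
pose al : R := pi / (4 * L).
have al0 : 0 < al by rewrite divr_gt0 // mulr_gt0.
have alL : al * L = pi / 4 by rewrite /al; field; rewrite gt_eqF.
pose S x : R := (1 + sin (al * x)) / 2.
have S01 x : 0 <= S x <= 1.
  by have := sin_max (al * x); rewrite ler_norml /S => /andP[h1 h2]; apply/andP; split; lra.
have [ka ka0 sep] := sin_separation R.
have e2 : 0 < e / 2 by rewrite divr_gt0.
have [r r0 unif] := uniform_continuity_square f_cont L e2.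
(* By the separation property of the sine, values of [S] closer than [de] force the arguments to be
   closer than [r]; the factor one half is that of [S]. *)
pose de := ka * al * r / 2.
have de0 : 0 < de by rewrite divr_gt0 // mulr_gt0 // mulr_gt0.
have near_S x x' : `|x| <= L -> `|x'| <= 2 * L -> `|S x' - S x| < de -> `|x' - x| < r.
  move=> xL xL' Sd.
  have h1 : `|al * x| <= pi / 4 by rewrite normrM gtr0_norm // -alL ler_wpM2l // ltW.
  have h2 : `|al * x'| <= pi / 2.
    rewrite normrM gtr0_norm //; have -> : pi / 2 = al * (2 * L) by rewrite mulrCA alL; field.
    by rewrite ler_wpM2l // ltW.
  have := sep _ _ h1 h2; rewrite -mulrBr normrM (gtr0_norm al0) => h3.
  have E : `|sin (al * x) - sin (al * x')| = 2 * `|S x' - S x|.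
    rewrite distrC (_ : S x' - S x = 2^-1 * (sin (al * x') - sin (al * x))); last by rewrite /S; field.
    by rewrite normrM (ger0_norm (x := 2^-1)) // mulrA mulfV // mul1r.
  rewrite E distrC in h3.
  have h4 : ka * (al * `|x' - x|) < ka * (al * r).
    by apply: le_lt_trans h3 _; move: Sd; rewrite /de mulrA; set u := `|_|; lra.
  by move: h4; rewrite ltr_pM2l // ltr_pM2l.
clearbody de.
have [k kP] : exists k : nat, 8 * M / (de ^+ 2 * e) < k.+1%:R.
  exists (Num.bound (8 * M / (de ^+ 2 * e))).
  apply: lt_trans (archi_boundP _) _; last by rewrite ltr_nat.
  by apply: divr_ge0; [exact: mulr_ge0|rewrite mulr_ge0 ?sqr_ge0 // ltW].
pose K := k.+1; have K0 : 0 < K%:R :> R by rewrite ltr0n.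
(* The preimage under [S] of the Bernstein node [i / K]. *)
pose node (i : nat) : R := asin (2 * i%:R / K%:R - 1) / al.
have node_arg i : (i <= K)%N -> -1 <= (2 * i%:R / K%:R - 1 : R) <= 1.
  move=> iK; have h0 : 0 <= i%:R / K%:R :> R by rewrite divr_ge0 // ltW.
  have h1 : i%:R / K%:R <= 1 :> R by rewrite ler_pdivrMr // mul1r ler_nat.
  by rewrite -mulrA; apply/andP; split; lra.
have S_node i : (i <= K)%N -> S (node i) = i%:R / K%:R.
  move=> iK; rewrite /S /node mulrCA mulfV ?gt_eqF // mulr1 asinK; last by rewrite in_itv /= node_arg.
  by rewrite addrC subrK -mulrA mulrAC mulfV ?mul1r.
have node_le i : (i <= K)%N -> `|node i| <= 2 * L.
  move=> iK; rewrite /node normrM [X in _ * X]gtr0_norm ?invr_gt0 // ler_pdivrMr //.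
  have -> : 2 * L * al = pi / 2 by rewrite mulrAC -mulrA alL; field.
  by rewrite ler_norml asin_geNpi2 ?node_arg // asin_lepi2 // node_arg.
pose g i j := f (node i +i* node j).
pose T (z : R[i]) := bernstein K (fun i => bernstein K (g i) (S (complex.Im z))) (S (complex.Re z)).
have trig_S (a b : R) : trig_poly (fun z => (1 + sin (linear_form a b z)) / 2).
  have := trig_add (trig_const 2^-1) (trig_wave 2^-1 a b (- (pi / 2))); congr trig_poly; apply/funext => z.
  by rewrite [- (pi / 2) + _]addrC cosBpihalf; field.
exists T; split.
- apply: (@trig_bernstein _ K (fun i z => bernstein K (g i) (S (complex.Im z)))) => [i|].
    apply: (@trig_bernstein _ K (fun j _ => g i j)) => [j|]; first exact: trig_const.
    by have := trig_S 0 al; congr trig_poly; apply/funext => z; rewrite /linear_form mul0r add0r.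
  by have := trig_S al 0; congr trig_poly; apply/funext => z; rewrite /linear_form mul0r addr0.
- move=> z; have := @bernstein2_dist R K _ _ M 0 0 g (S01 (complex.Re z)) (S01 (complex.Im z)) (lexx 0).
  rewrite subr0 mulr0 mul0r addr0; apply=> i j _ _.
  by rewrite subr0 mul0r addr0; exact: f_bound.
move=> z zL1 zL2; rewrite distrC.
(* For a node with [i / K] at distance at least [de] from the argument, [C] makes the quadratic term
   at least [2 M], the trivial bound; the choice of [K] keeps the total cost [2 C K] below
   [e / 2]. *)
pose C := 2 * M / (de ^+ 2 * K%:R ^+ 2).
have C0 : 0 <= C by apply: divr_ge0; [exact: mulr_ge0|rewrite mulr_ge0 ?sqr_ge0].
have CK : 2 * C * K%:R <= e / 2.
  have -> : 2 * C * K%:R = 4 * M / (de ^+ 2 * K%:R) by rewrite /C; field; rewrite !gt_eqF.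
  rewrite ler_pdivrMr ?mulr_gt0 ?exprn_gt0 //.
  move: kP; rewrite -/K ltr_pdivrMr ?mulr_gt0 ?exprn_gt0 //.
  by rewrite [K%:R * _]mulrA [K%:R * _]mulrC; set u := de ^+ 2 * K%:R; lra.
apply: (@le_trans _ _ (e / 2 + 2 * C * K%:R)); last by lra.
apply: bernstein2_dist => // i j iK jK.
have far x m : (m <= K)%N -> de <= `|S (node m) - x| -> 2 * M <= C * (m%:R - K%:R * x) ^+ 2.
  move=> mK; rewrite S_node // => h.
  have -> : C * (m%:R - K%:R * x) ^+ 2 = 2 * M * ((m%:R / K%:R - x) ^+ 2 / de ^+ 2).
    by rewrite /C; field; rewrite !gt_eqF.
  rewrite ler_peMr ?mulr_ge0 // ler_pdivlMr ?exprn_gt0 // mul1r -[leRHS]real_normK ?num_real //.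
  by rewrite lerXn2r ?nnegrE // ltW.
have big : `|g i j - f z| <= 2 * M.
  apply: le_trans (ler_normB _ _) _; rewrite mulr_natl mulr2n; apply: lerD; exact: f_bound.
have q0 (m : nat) x : 0 <= C * (m%:R - K%:R * x) ^+ 2 by rewrite mulr_ge0 ?sqr_ge0.
have := q0 i (S (complex.Re z)); have := q0 j (S (complex.Im z)); rewrite mulrDr.
have [h1|h1] := ltP `|S (node i) - S (complex.Re z)| de; last first.
  by have := far _ _ iK h1; lra.
have [h2|h2] := ltP `|S (node j) - S (complex.Im z)| de; last first.
  by have := far _ _ jK h2; lra.
have := unif _ _ _ _ zL1 zL2 (near_S _ _ zL1 (node_le _ iK) h1) (near_S _ _ zL2 (node_le _ jK) h2).
rewrite distrC -/(g i j) (_ : f (complex.Re z +i* complex.Im z) = f z); last by case: (z).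
by set u := `|_|; lra.
Qed.

End Approximation.

(** * From cosines to bounded continuous test functions *)

Section Levy.
Variables (R : realType) (A : nat -> seq R[i] -> Prop).
Hypothesis A_mono : forall N N' s, (N <= N')%N -> A N' s -> A N s.
Hypothesis A_gt0 : exists N, forall s, A N s -> (0 < size s)%N.
Hypothesis A_square : exists (N : nat) (M : R), forall s, A N s ->
  list_mean s (fun z => complex.Re z ^+ 2 + complex.Im z ^+ 2) <= M.
Hypothesis A_cos : forall a b c eps : R, 0 < eps -> exists N, forall s, A N s ->
  `|list_mean s (fun z => cos (c + linear_form a b z)) -
    cos c * expR (- ((a ^+ 2 + b ^+ 2) / 4))| < eps.
Local Notation mu2 := (@lebesgue_measure R \x @lebesgue_measure R)%E.

Lemma trig_integrable h : trig_poly h ->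
  mu2.-integrable setT (EFin \o (fun z => h (z.1 +i* z.2) * complex_gaussian_pdf z)).
Proof.
move=> th; have [M hM] := trig_bounded th.
by apply: (integrable_bounded_pdf (trig_measurable th)) => z; exact: hM.
Qed.

Lemma trig_limit h (eps : R) : trig_poly h -> 0 < eps -> exists N, forall s, A N s ->
  `|list_mean s h - complex_gaussian_mean h| < eps.
Proof.
move=> th; elim: th eps => {h} [k a b c|g h tg IHg th IHh] eps e0.
  have k1 : 0 < `|k| + 1 by rewrite ltr_wpDl.
  have [N HN] := A_cos a b c (divr_gt0 e0 k1).
  exists N => s /HN; rewrite list_meanZ -complex_gaussian_cos.
  have -> : complex_gaussian_mean (fun z => k * cos (c + linear_form a b z)) =
      k * complex_gaussian_mean (fun z : R[i] => cos (c + linear_form a b z)).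
    have iw := trig_integrable (trig_wave 1 a b c).
    rewrite /complex_gaussian_mean.
    transitivity (k * \int[mu2]_z (1 * cos (c + linear_form a b (z.1 +i* z.2)) * complex_gaussian_pdf z)).
      rewrite -(@RintegralZl _ _ _ mu2 setT _ k measurableT iw).
      by apply: eq_Rintegral => z _; rewrite mul1r mulrA.
    by congr (_ * _); apply: eq_Rintegral => z _; rewrite mul1r.
  rewrite -mulrBr normrM ltr_pdivlMr //; set u := `|_ - _| => H.
  by apply: le_lt_trans H; rewrite mulrDr mulr1 mulrC lerDl /u normr_ge0.
have e2 : 0 < eps / 2 by rewrite divr_gt0.
have [N1 H1] := IHg _ e2; have [N2 H2] := IHh _ e2.
exists (maxn N1 N2) => s As.
have {}H1 := H1 s (A_mono (leq_maxl _ _) As).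
have {}H2 := H2 s (A_mono (leq_maxr _ _) As).
have -> : complex_gaussian_mean (fun z => g z + h z) = complex_gaussian_mean g + complex_gaussian_mean h.
  rewrite /complex_gaussian_mean -(@RintegralD _ _ _ mu2 setT _ _ measurableT (trig_integrable tg) (trig_integrable th)).
  by apply: eq_Rintegral => z _; rewrite mulrDl.
rewrite list_meanD opprD addrACA; apply: le_lt_trans (ler_normD _ _) _.
by move: H1 H2; set u := `|_|; set v := `|_|; lra.
Qed.

Variables (f : R[i] -> R) (M : R).
Hypothesis f_cont : continuous (f : R[i]^o -> R).
Hypothesis f_bound : forall z, `|f z| <= M.

Let M_ge0 : 0 <= M. Proof. exact: le_trans (normr_ge0 _) (f_bound 0). Qed.

(** Dominated convergence replaces an estimate of the Gaussian tail, and the pointwise limit also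
    provides the measurability of the integrand of [f]. *)
Lemma gaussian_mean_limit (T : nat -> R[i] -> R) : (forall n, trig_poly (T n)) ->
  (forall n z, `|T n z| <= M) ->
  (forall n z, `|complex.Re z| <= n.+1%:R -> `|complex.Im z| <= n.+1%:R -> `|f z - T n z| <= n.+1%:R^-1) ->
  ((fun n => complex_gaussian_mean (T n)) @ \oo --> complex_gaussian_mean f)%classic.
Proof.
move=> tT TM Tf.
pose F n (z : R * R) := (T n (z.1 +i* z.2) * complex_gaussian_pdf z)%:E.
pose G (z : R * R) := (f (z.1 +i* z.2) * complex_gaussian_pdf z)%:E.
have mF n : measurable_fun setT (F n).
  exact: (measurable_int mu2 (trig_integrable (tT n))).
have FG z : (F ^~ z @ \oo --> G z)%classic.
  apply: cvg_EFin; first by apply: nearW.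
  rewrite /=; apply: cvgM; last exact: cvg_cst.
  apply/cvgrPdist_lt => e e0; near=> n.
  apply: le_lt_trans (Tf n _ _ _) _ => /=.
  - by near: n; apply: filterS (nbhs_infty_ger `|z.1|) => n /le_trans; apply; rewrite ler_nat.
  - by near: n; apply: filterS (nbhs_infty_ger `|z.2|) => n /le_trans; apply; rewrite ler_nat.
  by near: n; exact: near_infty_natSinv_lt (PosNum e0).
have mG : measurable_fun setT G by apply: (emeasurable_fun_cvg F) => // z _; exact: FG.
have iM := integrableZl measurableT M (integrable_pdf R).
have bF : {ae mu2, forall z n, setT z -> (`|F n z| <= M%:E * (EFin \o @complex_gaussian_pdf R) z)%E}.
  apply: aeW => z n _; rewrite /F /= lee_fin normrM (ger0_norm (pdf_ge0 z)) ler_wpM2r ?pdf_ge0 //.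
have aeF : {ae mu2, forall z, setT z -> (F ^~ z @ \oo --> G z)%classic} by apply: aeW => z _; exact: FG.
have [iG _ C] := @dominated_convergence _ _ R mu2 setT measurableT F G _ mF mG aeF iM bF.
have E : (\int[mu2]_z G z)%E = (complex_gaussian_mean f)%:E.
  by rewrite /complex_gaussian_mean /Rintegral fineK //; exact: (integrable_fin_num measurableT iG).
by rewrite E in C; exact: (fine_cvg C).
Unshelve. all: end_near. Qed.

Theorem levy (eps : R) : 0 < eps -> exists N, forall s, A N s ->
  `|list_mean s f - complex_gaussian_mean f| < eps.
Proof.
move=> e0; have e4 : 0 < eps / 4 by rewrite divr_gt0.
have ex n : exists T : R[i] -> R, [/\ trig_poly T, forall z, `|T z| <= M &
    forall z, `|complex.Re z| <= n.+1%:R -> `|complex.Im z| <= n.+1%:R -> `|f z - T z| <= n.+1%:R^-1].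
  by apply: trig_approximation => //; rewrite ?ltr0n // invr_gt0 ltr0n.
have [T HT] := choice ex.
have tT n : trig_poly (T n) by case: (HT n).
have TM n z : `|T n z| <= M by case: (HT n).
have Tf n z : `|complex.Re z| <= n.+1%:R -> `|complex.Im z| <= n.+1%:R -> `|f z - T n z| <= n.+1%:R^-1.
  by case: (HT n) => _ _; exact.
have [N0 HN0] := A_gt0; have [N1 [Q HN1]] := A_square.
have lim := gaussian_mean_limit tT TM Tf.
have [n [n1 n2 n3]] : exists n : nat, [/\ n.+1%:R^-1 < eps / 4,
    2 * M * `|Q| / n.+1%:R <= eps / 4 & `|complex_gaussian_mean f - complex_gaussian_mean (T n)| < eps / 4].
  have /cvgrPdist_lt /(_ _ e4) L := lim.
  have [n nP] : exists n, (n.+1%:R^-1 < eps / 4 /\ 8 * M * `|Q| / eps <= n%:R) /\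
      `|complex_gaussian_mean f - complex_gaussian_mean (T n)| < eps / 4.
    apply: (@filter_ex _ \oo%classic); apply: filterI L; apply: filterI.
      exact: near_infty_natSinv_lt (PosNum e4).
    exact: nbhs_infty_ger.
  exists n; have [[h1 h2] h3] := nP; split=> //.
  rewrite ler_pdivrMr ?ltr0n //; move: h2; rewrite ler_pdivrMr // -natr1.
  by have := ltW e0; set u := M * `|Q|; rewrite -!mulrA -/u; nra.
have [N2 HN2] := trig_limit (tT n) e4.
exists (maxn (maxn N0 N1) N2) => s As.
have s0 := HN0 s (A_mono (leq_trans (leq_maxl N0 N1) (leq_maxl _ N2)) As).
have sQ := HN1 s (A_mono (leq_trans (leq_maxr N0 N1) (leq_maxl _ N2)) As).
have sT := HN2 s (A_mono (leq_maxr _ _) As).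
set m : R := n.+1%:R in n1 n2 Tf.
have m0 : 0 < m by rewrite ltr0n.
have m1 : 1 <= m by rewrite ler1n.
pose sq (z : R[i]) := complex.Re z ^+ 2 + complex.Im z ^+ 2.
have sq0 z : 0 <= sq z by rewrite addr_ge0 ?sqr_ge0.
(* Inside the square of half-side [m] the approximation applies; outside, the trivial bound [2 M] is
   at most [2 M / m ^+ 2] times the square of the modulus, whose sample mean is bounded. *)
have dist z : `|f z - T n z| <= m^-1 + 2 * M / m ^+ 2 * sq z.
  have pos : 0 <= 2 * M / m ^+ 2 * sq z by rewrite mulr_ge0 // divr_ge0 ?mulr_ge0 ?exprn_ge0 // ltW.
  have mi : 0 < m^-1 by rewrite invr_gt0.
  have large : m ^+ 2 <= sq z -> `|f z - T n z| <= m^-1 + 2 * M / m ^+ 2 * sq z.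
    move=> mz; apply: (@le_trans _ _ (2 * M)).
      by apply: le_trans (ler_normB _ _) _; rewrite mulr_natl mulr2n lerD.
    apply: (@le_trans _ _ (2 * M / m ^+ 2 * sq z)); last by rewrite lerDr ltW.
    by rewrite -mulrA ler_peMr ?mulr_ge0 // mulrC ler_pdivlMr ?exprn_gt0 // mul1r.
  have [h1|/ltW h1] := leP `|complex.Re z| m; last first.
    apply: large; apply: (@le_trans _ _ (`|complex.Re z| ^+ 2)); first by rewrite lerXn2r ?nnegrE // ltW.
    by rewrite real_normK ?num_real // lerDl sqr_ge0.
  have [h2|/ltW h2] := leP `|complex.Im z| m; last first.
    apply: large; apply: (@le_trans _ _ (`|complex.Im z| ^+ 2)); first by rewrite lerXn2r ?nnegrE // ltW.
    by rewrite real_normK ?num_real // lerDr sqr_ge0.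
  by apply: le_trans (Tf n z h1 h2) _; rewrite lerDl.
have d1 : `|list_mean s f - list_mean s (T n)| <= m^-1 + 2 * M * `|Q| / m.
  rewrite -list_meanB; apply: le_trans (ler_norm_list_mean _ _) _.
  apply: le_trans (ler_list_mean _ dist) _.
  rewrite list_meanD list_mean_cst // list_meanZ lerD2l.
  apply: (@le_trans _ _ (2 * M / m ^+ 2 * `|Q|)).
    rewrite ler_wpM2l ?divr_ge0 ?mulr_ge0 ?exprn_ge0 ?(ltW m0) //.
    exact: le_trans sQ (ler_norm _).
  have -> : 2 * M / m ^+ 2 * `|Q| = (2 * M * `|Q|) / m ^+ 2 by rewrite mulrAC.
  rewrite ler_wpM2l ?mulr_ge0 // lef_pV2 ?posrE ?exprn_gt0 // expr2 ler_peMr // ltW.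
have -> : list_mean s f - complex_gaussian_mean f =
    (list_mean s f - list_mean s (T n)) + (list_mean s (T n) - complex_gaussian_mean (T n))
    - (complex_gaussian_mean f - complex_gaussian_mean (T n)) by ring.
apply: le_lt_trans (ler_normB _ _) _.
apply: le_lt_trans (lerD (ler_normD _ _) (lexx _)) _.
move: d1 sT n1 n2 n3; set u := `|list_mean s f - _|; set v := `|list_mean s (T n) - _|.
set w := `|complex_gaussian_mean f - _|; set mi := m^-1; set x := _ / m; lra.
Qed.

End Levy.

Theorem theorem7p5 (R : realType) (p : nat) (p_prime : prime p) (p_odd : odd p)
    (f : R[i] -> R) (f_cont : continuous (f : R[i]^o -> R))
    (f_bounded : exists M : R, forall z : R[i], `|f z| <= M)
    (eps : R) (eps_gt0 : 0 < eps) :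
  exists N : nat,
    forall (Fq : finFieldType) (zeta : Fq) (chi : Fq -> R[i])
           (d : 'I_p.-1 -> nat),
      #|Fq| = 1 %[mod p] ->
      p.-primitive_root zeta ->
      character_of_order p chi ->
      (\sum_(i < p.-1) i.+1 * d i = 0 %[mod p])%N ->
      (N <= #|Fq|)%N ->
      (forall i, N <= d i)%N ->
      `| moduli_mean zeta d (fun C => f (normalized_trace p chi C))
         - complex_gaussian_mean f | < eps.
Proof.
have [M fM] := f_bounded.
have mono N N' (s : seq R[i]) : (N <= N')%N -> large_sample p N' s -> large_sample p N s.
  move=> NN [Fq [chi [d [chiP Dp qN dN ->]]]]; exists Fq, chi, d; split=> //.
    exact: leq_trans qN.
  by move=> i; exact: leq_trans (dN i).
have [N HN] := levy mono (large_sample_gt0 R p_prime p_odd) (large_sample_square R p_prime p_odd)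
  (large_sample_cos p_prime p_odd) f_cont fM eps_gt0.
exists N => Fq zeta chi d _ zetaP chiP D0 qN dN.
have Dp : (p %| \sum_(i < p.-1) i.+1 * d i)%N by rewrite /dvdn D0 mod0n.
have := HN (sample chi d); rewrite list_mean_sample moduli_mean_uniform //.
by apply; exists Fq, chi, d; split.
Qed.
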